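(* Let $J\subset\mathbb R$ be an open interval and let $\gamma\colon J\to\mathcal S$ be a generic transversal curve parametrized by the natural parameter, with CR bending $\kappa$ and CR twist $\tau$. Then $\gamma$ is a critical curve of the total CR twist functional $\mathcal W$ if and only if $$L'(s)=[L(s),K_{\kappa,\tau}(s)]=L(s)K_{\kappa,\tau}(s)-K_{\kappa,\tau}(s)L(s)\qquad\text{for all } s\in J,$$ where $$L=\begin{pmatrix}0 & i\tau'+3(1-\tau\kappa) & 2i\tau\\ \tau & 0 & \tau'+3i(1-\tau\kappa)\\ 3i & -i\tau & 0\end{pmatrix},\qquad K_{\kappa,\tau}=\begin{pmatrix} i\kappa & -i & \tau\\ 0 & -2i\kappa & 1\\ 1 & 0 & i\kappa\end{pmatrix}.$$
   Context: $\mathbb C^{2,1}$ denotes $\mathbb C^3$ with the Hermitian form $\langle \mathbf z,\mathbf w\rangle={}^t\overline{\mathbf z}\,\mathbf h\,\mathbf w$, $\mathbf h=\begin{pmatrix}0&0&i\\0&1&0\\-i&0&0\end{pmatrix}$ (signature $(2,1)$). $\mathcal S\subset\mathbb{CP}^2$ is the set of null lines, $\mathcal S=\{[\mathbf z]: \langle\mathbf z,\mathbf z\rangle=0\}\cong S^3$. $G=\{A\in SL(3,\mathbb C): {}^t\bar A\mathbf hA=\mathbf h\}$ acts on $\mathcal S$ by $A[\mathbf z]=[A\mathbf z]$. The contact distribution $\mathcal D$ of $\mathcal S$ is the kernel of the real 1-form $\zeta$ obtained by restricting $-i\langle\mathbf z,d\mathbf z\rangle/(\overline{\mathbf z}\cdot\mathbf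 z)$ to $T\mathcal S$. A smooth immersed curve $\gamma\colon J\to\mathcal S$ is transversal if $\gamma'(t)\notin\mathcal D_{\gamma(t)}$ for all $t$; it is always assumed positively parametrized, i.e. $\zeta(\gamma')>0$. A lift of $\gamma$ is a smooth map $\Gamma\colon J\to\mathbb C^{2,1}\setminus\{0\}$ into the null vectors with $\gamma=[\Gamma]$. A transversal curve is generic if $\det(\Gamma,\Gamma',\Gamma'')\neq0$ everywhere for one (hence any) lift. A Wilczynski lift is a lift with $\det(\Gamma,\Gamma',\Gamma'')=-1$ (unique up to cube roots of unity). The infinitesimal strain is $ds=a_\gamma\,dt$, where $a_\gamma=i\langle\Gamma,\Gamma'\rangle^{-1}>0$ for a Wilczynski lift $\Gamma$; it is invariant under $G$ and reparametrization. The curve is parametrized by the natural parameter $s$ if $a_\gamma=1$. For such a generic transversal curve there is a smooth map $\mathcal F=(F_1,F_2,F_3)\colon J\to G$ (a Wilczynski frame, unique up to multiplication by a constant cube root of unity), with $F_1$ a Wilczynski lift of $\gamma$, such that $\mathcal F^{-1}\mathcal F'=K_{\kappa,\tau}$ (the matrix in the claim) for smooth real functions $\kappa,\tau$, called the CR bending and the CR twist. The total CR twist functional on generic transversal curves is $\mathcal W[\gamma]=\int_{J}\tau\,ds$, with $ds$ the infinitesimal strain. $\gamma$ is a critical curve if it is a critical point of $\mathcal W$ with respect to compactly supported variations through generic transversal curves. *)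

(* Defs.v *)
From HB Require Import structures.
From mathcomp Require Import all_boot all_order all_algebra.
From mathcomp Require Import complex.
From mathcomp Require Import all_classical all_reals all_analysis.

Set Implicit Arguments.
Unset Strict Implicit.
Unset Printing Implicit Defensive.

Import Order.TTheory GRing.Theory Num.Theory.
Import numFieldNormedType.Exports.

Local Open Scope classical_set_scope.
Local Open Scope ring_scope.
Local Open Scope complex_scope.

Section Smoothness.
Variable R : realType.

(* Frechet differentiability together with C^k-regularity of every directional
   derivative: for V finite-dimensional (here V = R or V = R * R) this is the
   usual class C^k on the open set U. *)
Fixpoint Ck (V : normedModType R) (k : nat) (U : set V) (f : V -> R) : Prop :=
  match k with
  | 0%N => forall x, U x -> {for x, continuous f}
  | k'.+1 => (forall x, U x -> differentiable f x) /\
             (forall v : V, Ck k' U ('D_v f))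
  end.

Definition smooth (V : normedModType R) (U : set V) (f : V -> R) : Prop :=
  forall k, Ck k U f.

(* Complex matrices carry no R-normed structure in the library, so smoothness
   and derivatives are taken on real and imaginary parts of the entries. *)
Definition mxsmooth (V : normedModType R) (m n : nat) (U : set V)
    (F : V -> 'M[R[i]]_(m, n)) : Prop :=
  forall i j, smooth U (fun x => complex.Re (F x i j)) /\
              smooth U (fun x => complex.Im (F x i j)).

Definition mxderive (m n : nat) (F : R -> 'M[R[i]]_(m, n)) (t : R) :
    'M[R[i]]_(m, n) :=
  \matrix_(i, j) (derive1 (fun s => complex.Re (F s i j)) t +i*
                  derive1 (fun s => complex.Im (F s i j)) t).

End Smoothness.

Section CRSphere.
Variable R : realType.
Local Notation C := R[i].
Local Notation C3 := 'cV[C]_3.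

Definition mx33 (rows : seq (seq C)) : 'M[C]_3 :=
  \matrix_(i, j) nth 0 (nth [::] rows i) j.

Definition hmx : 'M[C]_3 :=
  mx33 [:: [:: 0; 0; 'i]; [:: 0; 1; 0]; [:: - 'i; 0; 0]].

Definition conjT (m n : nat) (A : 'M[C]_(m, n)) : 'M[C]_(n, m) :=
  (map_mx (@conjc R) A)^T.

Definition herm (z w : C3) : C := (conjT z *m hmx *m w) 0 0.

Definition in_G (A : 'M[C]_3) : Prop :=
  \det A = 1 /\ conjT A *m hmx *m A = hmx.

Definition mx3 (u v w : C3) : 'M[C]_3 := row_mx u (row_mx v w).

(* Points of CP^2 are the one-dimensional subspaces of C^3; the point [z] is
   <[z]>%VS with z != 0. *)
Definition cr_sphere : set {vspace C3} :=
  [set P | \dim P = 1%N /\ forall z, z \in P -> herm z z = 0].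

(* Since C^3 \ {0} -> CP^2 is a surjective submersion, a map into CP^2 is
   smooth iff it locally has a smooth nowhere zero representative. *)
Definition smooth_into_CP2 (V : normedModType R) (U : set V)
    (f : V -> {vspace C3}) : Prop :=
  forall p, U p -> exists (W : set V) (Z : V -> C3),
    [/\ open W, W p, mxsmooth W Z &
        forall q, W q -> U q -> Z q != 0 /\ f q = <[Z q]>%VS].

Definition smooth_curve (J : set R) (g : R -> {vspace C3}) : Prop :=
  smooth_into_CP2 J g /\ forall t, J t -> cr_sphere (g t).

Definition lift (J : set R) (g : R -> {vspace C3}) (Gam : R -> C3) : Prop :=
  mxsmooth J Gam /\
  forall t, J t -> [/\ Gam t != 0, herm (Gam t) (Gam t) = 0 &
                       g t = <[Gam t]>%VS].

(* zeta (gamma' t), computed from a lift Gam of gamma.  The value is real and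
   independent of the lift because Gam is null. *)
Definition zeta (Gam : R -> C3) (t : R) : C :=
  - 'i * herm (Gam t) (mxderive Gam t) / (conjT (Gam t) *m Gam t) 0 0.

Definition osc_det (Gam : R -> C3) (t : R) : C :=
  \det (mx3 (Gam t) (mxderive Gam t) (mxderive (mxderive Gam) t)).

(* The order of R[i] makes [0 < z] mean that z is real and positive.  The
   positivity of zeta forces gamma' t != 0, i.e. that gamma is immersed. *)
Definition transversal (J : set R) (g : R -> {vspace C3}) : Prop :=
  exists Gam, lift J g Gam /\ forall t, J t -> 0 < zeta Gam t.

Definition generic (J : set R) (g : R -> {vspace C3}) : Prop :=
  exists Gam, lift J g Gam /\ forall t, J t -> osc_det Gam t != 0.

Definition generic_transversal (J : set R) (g : R -> {vspace C3}) : Prop :=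
  [/\ smooth_curve J g, transversal J g & generic J g].

Definition wilczynski_lift (J : set R) (g : R -> {vspace C3})
    (Gam : R -> C3) : Prop :=
  lift J g Gam /\ forall t, J t -> osc_det Gam t = -1.

(* The function a_gamma such that ds = a_gamma dt. *)
Definition strain (J : set R) (g : R -> {vspace C3}) (a : R -> R) : Prop :=
  exists Gam, wilczynski_lift J g Gam /\
    forall t, J t -> (a t)%:C = 'i * (herm (Gam t) (mxderive Gam t))^-1.

Definition natural_parameter (J : set R) (g : R -> {vspace C3}) : Prop :=
  strain J g (cst 1).

Definition Kmx (kappa tau : R -> R) (s : R) : 'M[C]_3 :=
  let k := (kappa s)%:C in let t := (tau s)%:C in
  mx33 [:: [:: 'i * k; - 'i; t];
           [:: 0; - (2%:R * 'i * k); 1];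
           [:: 1; 0; 'i * k]].

Definition Lmx (kappa tau : R -> R) (s : R) : 'M[C]_3 :=
  let k := (kappa s)%:C in let t := (tau s)%:C in
  let t' := (derive1 tau s)%:C in
  mx33 [:: [:: 0; 'i * t' + 3%:R * (1 - t * k); 2%:R * 'i * t];
           [:: t; 0; t' + 3%:R * 'i * (1 - t * k)];
           [:: 3%:R * 'i; - ('i * t); 0]].

Definition wilczynski_frame (J : set R) (g : R -> {vspace C3})
    (kappa tau : R -> R) (F : R -> 'M[C]_3) : Prop :=
  [/\ mxsmooth J F,
      forall t, J t -> in_G (F t),
      wilczynski_lift J g (fun t => col 0 (F t)) &
      forall t, J t -> invmx (F t) *m mxderive F t = Kmx kappa tau t].

(* For curves parametrized by the natural parameter. *)
Definition bending_twist (J : set R) (g : R -> {vspace C3})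
    (kappa tau : R -> R) : Prop :=
  [/\ smooth J kappa, smooth J tau & exists F, wilczynski_frame J g kappa tau F].

(* g = d \o sigma with sigma an increasing diffeomorphism of J onto
   sigma @` J, on which d is parametrized by the natural parameter. *)
Definition natural_reparam (J : set R) (g : R -> {vspace C3})
    (sigma : R -> R) (d : R -> {vspace C3}) : Prop :=
  [/\ smooth J sigma, forall t, J t -> 0 < derive1 sigma t,
      generic_transversal (sigma @` J) d, natural_parameter (sigma @` J) d &
      forall t, J t -> g t = d (sigma t)].

(* The twist of an arbitrarily parametrized curve is the pull-back of the twist
   of its natural reparametrization. *)
Definition twist (J : set R) (g : R -> {vspace C3}) (tau : R -> R) : Prop :=
  exists sigma d kappa0 tau0,
    [/\ natural_reparam J g sigma d, bending_twist (sigma @` J) d kappa0 tau0 &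
        forall t, J t -> tau t = tau0 (sigma t)].

(* w is the integral of tau ds over the compact subinterval [a, b] of J. *)
Definition total_twist (J : set R) (g : R -> {vspace C3}) (a b w : R) : Prop :=
  exists al tau, [/\ strain J g al, twist J g tau &
    w = (\int[lebesgue_measure]_(t in `[a, b]) (tau t * al t))%R].

(* A compactly supported variation through generic transversal curves, defined
   for |u| < e and supported in [a, b]; v u is the curve at time u. *)
Definition cs_variation (J : set R) (g : R -> {vspace C3}) (a b e : R)
    (v : R -> R -> {vspace C3}) : Prop :=
  [/\ smooth_into_CP2 (J `*` [set u : R | `|u| < e]) (fun p => v p.2 p.1),
      forall u, `|u| < e -> generic_transversal J (v u),
      forall t, J t -> v 0 t = g t &
      forall u t, `|u| < e -> J t -> t \notin `[a, b] -> v u t = g t].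

(* The integral of tau ds over J may diverge; as the variation is supported in
   [a, b], only the contribution of [a, b] varies.  W u is determined by v u,
   since strain and twist do not depend on the choice of lift, frame or
   natural reparametrization. *)
Definition critical_curve (J : set R) (g : R -> {vspace C3}) : Prop :=
  forall (a b e : R) (v : R -> R -> {vspace C3}) (W : R -> R),
    a <= b -> `[a, b] `<=` J -> 0 < e -> cs_variation J g a b e v ->
    (forall u, `|u| < e -> total_twist J (v u) a b (W u)) ->
    is_derive (0 : R) 1 W 0.

End CRSphere.

(* Main.v *)
(* A smooth family of generic transversal curves carries frames F(t, u) in
   U(2,1) whose first column spans the curve and such that F^-1 F_t = P has the
   shape of K, with the strain a and b = tau a as entries.  Put Q = F^-1 F_u.
   For P of this shape tr (L P) = 3 i b.  At u = 0, where P is K plus a scalar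
   and tr L = 0, the compatibility condition P_u = Q_t + [P, Q] gives
     d/dt Im tr (L Q) = 3 b_u + Im tr ((L' - [L, K]) Q).
   All entries of L' - [L, K] vanish, except for an entry w and another one equal
   to i conj w, and the last term is 2 Re (conj w Q_21).  The function
   Im tr (L Q) does not depend on the frame and vanishes outside the support of
   the variation; integrating, dW/du = - (2/3) int Re (conj w Q_21) dt.
   Hence w = 0 implies criticality; conversely a null deformation with
   Q_21 = phi w, for a bump function phi, forces w = 0. *)

Require Import Defs.
From HB Require Import structures.
From mathcomp Require Import all_boot all_order all_algebra.
From mathcomp Require Import complex.
From mathcomp Require Import all_classical all_reals all_analysis.
From mathcomp Require Import ring lra.
Import Order.TTheory GRing.Theory Num.Theory.
Import numFieldNormedType.Exports.
Local Open Scope classical_set_scope.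
Local Open Scope ring_scope.
Local Open Scope complex_scope.
Set Implicit Arguments.
Unset Strict Implicit.
Unset Printing Implicit Defensive.

(** * Smooth functions *)

(** [L] acts as a Lagrange multiplier. It is self-adjoint for the Hermitian form, and paired with
    any matrix of the shape of [P] it sees only the entry [b], so [tr (L P_u)] measures the
    variation of the twist density alone. The freedom left in [L] is spent on killing all entries of
    [L' - [L, K]] except the two that meet [Q_10] and its conjugate [Q_21]; a null deformation can
    prescribe [Q_10] freely. A deformation comes with local lifts only, and [W] is built from a
    strain, a reparametrization and a frame that are merely asserted to exist. The computation
    therefore runs in local frames, and uniqueness of adapted frames up to a phase glues the results
    into functions of [t] and identifies the integrand of [W] with [b]. A change of phase adds a
    scalar to [Q], which [tr L = 0] removes. Criticality speaks only of functions [W] that realize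
    the total twist. To exploit it, each curve of the test deformation must be given a strain and a
    twist: a phase rotation yields a frame of determinant one, and inverting a primitive of the
    strain yields the natural parameter. *)

Section NearDifferentiable.
Variables (R : realType) (V W : normedModType R).

Lemma near0_differentiable (f : V -> W) x :
  (\near x, f x = 0) -> differentiable f x.
Proof.
move=> f0; have fx0 := nbhs_singleton f0.
have H : f \o shift x = cst (f x) + \0 +o_ 0 id.
  apply/eqaddoP => _/posnumP[e]; near=> y.
  rewrite /= !fctE /= fx0 addr0 subr0.
  suff -> : f (y + x) = 0 by rewrite normr0 mulr_ge0.
  by near: y; have := f0; rewrite (near_shift 0 x) subr0.
have D : 'd f x = \0 :> (V -> W).
  by apply: diff_unique => //; exact: cst_continuous.
by apply/diff_locallyP; rewrite D; split=> //; exact: cst_continuous.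
Unshelve. all: end_near. Qed.

Lemma near_eq_differentiable (f g : V -> W) x :
  (\near x, f x = g x) -> differentiable f x -> differentiable g x.
Proof.
move=> fg df; rewrite (_ : g = f + (g - f)); last by rewrite addrC subrK.
apply: (differentiableD df); apply: near0_differentiable.
by apply: filterS fg => y E; rewrite !fctE E subrr.
Qed.

End NearDifferentiable.

Section CkTheory.
Variables (R : realType) (V : normedModType R).
Implicit Types (U : set V) (f g : V -> R).

Lemma Ck_sub k U U' f : U' `<=` U -> Ck k U f -> Ck k U' f.
Proof.
elim: k U U' f => [|k IH] U U' f UU' /=; first by move=> H x /UU'; exact: H.
move=> [H1 H2]; split=> [x /UU'|v]; [exact: H1|exact: IH UU' (H2 v)].
Qed.

Lemma CkS k U f : Ck k.+1 U f -> Ck k U f.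
Proof.
elim: k U f => [|k IH] U f /= [H1 H2].
  by move=> x /H1; exact: differentiable_continuous.
by split=> // v; apply: IH.
Qed.

(** [Ck] differentiates total functions whose values off [U] are arbitrary. Openness of [U] makes
    the directional derivatives agree on [U] again, so the induction can continue. *)
Lemma Ck_eq k U f g : open U -> {in U, f =1 g} -> Ck k U f -> Ck k U g.
Proof.
move=> oU; elim: k f g => [|k IH] f g fg /=.
  move=> H x Ux; have nfg : \near x, f x = g x.
    by apply: filterS (open_nbhs_nbhs (conj oU Ux)) => y Uy; apply: fg; rewrite inE.
  rewrite /prop_for /continuous_at -(nbhs_singleton nfg).
  by apply: cvg_trans (H x Ux); apply: near_eq_cvg.
have nfg x : U x -> \near x, f x = g x.
  move=> Ux; apply: filterS (open_nbhs_nbhs (conj oU Ux)) => y Uy.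
  by apply: fg; rewrite inE.
move=> [H1 H2]; split=> [x Ux|v].
  by apply: near_eq_differentiable (H1 x Ux); exact: nfg.
apply: IH (H2 v) => x /set_mem Ux; exact: near_eq_derive (nfg x Ux).
Qed.

Lemma Ck_cst k U (c : R) : Ck k U (fun=> c).
Proof.
elim: k c => [|k IH] c /=; first by move=> x _; exact: cst_continuous.
split=> [x _|v]; first exact: differentiable_cst.
rewrite (_ : 'D_v _ = fun=> 0); first exact: IH.
by apply/funext => x; rewrite derive_cst.
Qed.

Lemma CkD k U f g : open U -> Ck k U f -> Ck k U g ->
  Ck k U (fun x => f x + g x).
Proof.
move=> oU; elim: k f g => [|k IH] f g /=.
  by move=> H1 H2 x Ux; apply: continuousD; [exact: H1|exact: H2].
move=> [f1 f2] [g1 g2]; split=> [x Ux|v].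
  by apply: differentiableD; [exact: f1|exact: g1].
apply: Ck_eq oU _ (IH _ _ (f2 v) (g2 v)) => x /set_mem Ux.
by rewrite deriveD //; apply: diff_derivable; [exact: f1|exact: g1].
Qed.

Lemma CkM k U f g : open U -> Ck k U f -> Ck k U g ->
  Ck k U (fun x => f x * g x).
Proof.
move=> oU; elim: k f g => [|k IH] f g.
  by move=> H1 H2 x Ux; apply: continuousM; [exact: H1|exact: H2].
move=> Hf Hg; have [f1 f2] := Hf; have [g1 g2] := Hg.
split=> [x Ux|v] /=.
  by apply: differentiableM; [exact: f1|exact: g1].
have H1 := IH _ _ (CkS Hf) (g2 v); have H2 := IH _ _ (CkS Hg) (f2 v).
apply: Ck_eq oU _ (CkD oU H1 H2) => x /set_mem Ux.
by rewrite deriveM //; apply: diff_derivable; [exact: f1|exact: g1].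
Qed.

Lemma smooth_sub U U' f : U' `<=` U -> smooth U f -> smooth U' f.
Proof. by move=> UU' H k; apply: Ck_sub UU' (H k). Qed.

Lemma smooth_eq U f g : open U -> {in U, f =1 g} -> smooth U f -> smooth U g.
Proof. by move=> oU fg H k; apply: Ck_eq oU fg (H k). Qed.

Lemma smooth_cst U (c : R) : smooth U (fun=> c).
Proof. by move=> k; exact: Ck_cst. Qed.

Lemma smoothD U f g : open U -> smooth U f -> smooth U g ->
  smooth U (fun x => f x + g x).
Proof. by move=> oU Hf Hg k; apply: CkD. Qed.

Lemma smoothM U f g : open U -> smooth U f -> smooth U g ->
  smooth U (fun x => f x * g x).
Proof. by move=> oU Hf Hg k; apply: CkM. Qed.

Lemma smoothN U f : open U -> smooth U f -> smooth U (fun x => - f x).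
Proof.
move=> oU Hf; apply: smooth_eq oU _ (smoothM oU (smooth_cst _ (-1)) Hf).
by move=> x _; rewrite mulN1r.
Qed.

Lemma smoothB U f g : open U -> smooth U f -> smooth U g ->
  smooth U (fun x => f x - g x).
Proof. by move=> oU Hf Hg; apply: smoothD => //; exact: smoothN. Qed.

Lemma smooth_differentiable U f x : smooth U f -> U x -> differentiable f x.
Proof. by move=> /(_ 1%N)[H _]; exact: H. Qed.

Lemma smooth_continuous U f x : smooth U f -> U x -> {for x, continuous f}.
Proof. by move=> H Ux; apply: differentiable_continuous; exact: smooth_differentiable Ux. Qed.

Lemma smooth_derivable U f x v : smooth U f -> U x -> derivable f x v.
Proof. by move=> H Ux; apply: diff_derivable; exact: smooth_differentiable Ux. Qed.

Lemma smooth_derive U f v : smooth U f -> smooth U ('D_v f).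
Proof. by move=> H k; have [_] := H k.+1; exact. Qed.

End CkTheory.

Section AffineComp.
Variables (R : realType) (V V' : normedModType R).
Implicit Types (U : set V) (f : V -> R).

(* [p] is a map with constant differential, in practice an affine map. *)
Lemma Ck_comp_affine k (U' : set V') U f
    (p : V' -> V) (l : V' -> V) :
  open U' -> (forall x, is_diff x p l) -> (forall x, U' x -> U (p x)) ->
  Ck k U f -> Ck k U' (f \o p).
Proof.
move=> oU' dp pU; elim: k f => [|k IH] f /=.
  move=> H x Ux; apply: continuous_comp; last exact/H/pU.
  by apply: differentiable_continuous; have := dp x => -[].
move=> [H1 H2]; split=> [x Ux|v].
  by apply: differentiable_comp; [have := dp x => -[]|exact/H1/pU].
apply: Ck_eq oU' _ (IH _ (H2 (l v))) => x /set_mem Ux.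
have dfp := H1 _ (pU _ Ux); have dpx : differentiable p x by have [] := dp x.
rewrite /= deriveE // deriveE; last exact: differentiable_comp.
have E : 'd p x v = l v by rewrite diff_val.
by rewrite (diff_comp dpx dfp) /= E.
Qed.

Lemma smooth_comp_affine (U' : set V') U f
    (p : V' -> V) (l : V' -> V) :
  open U' -> (forall x, is_diff x p l) -> (forall x, U' x -> U (p x)) ->
  smooth U f -> smooth U' (f \o p).
Proof. by move=> oU' dp pU H k; apply: Ck_comp_affine pU (H k). Qed.

End AffineComp.

Section DeriveRules.
Variables (R : realType) (V : normedModType R) (f g : V -> R) (x v : V).
Hypotheses (df : derivable f x v) (dg : derivable g x v).

Lemma derive_add : 'D_v (fun y => f y + g y) x = 'D_v f x + 'D_v g x.
Proof. exact: deriveD. Qed.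

Lemma derive_sub : 'D_v (fun y => f y - g y) x = 'D_v f x - 'D_v g x.
Proof. exact: deriveB. Qed.

Lemma derive_opp : 'D_v (fun y => - f y) x = - 'D_v f x.
Proof. exact: deriveN. Qed.

Lemma derive_mul :
  'D_v (fun y => f y * g y) x = 'D_v f x * g x + f x * 'D_v g x.
Proof.
by rewrite [LHS](deriveM df dg) addrC [in RHS]mulrC.
Qed.

Lemma derivable_mul : derivable (fun y => f y * g y) x v.
Proof. exact: (derivableM df dg). Qed.

End DeriveRules.

Section SmoothComp.
Variables (R : realType) (V : normedModType R).

Lemma derive_comp (f : V -> R) (g : R -> R) (x v : V) :
  differentiable f x -> derivable g (f x) 1 ->
  'D_v (g \o f) x = 'D_1 g (f x) * 'D_v f x.
Proof.
move=> df /derivable1_diffP dg.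
rewrite deriveE; last exact: differentiable_comp.
rewrite diff_comp //= deriveE // deriveE // -[in LHS](mulr1 ('d f x v)).
by rewrite [LHS]linearZ /= mulrC.
Qed.

(** The derivative of [g \o f] is [(g' \o f)] times that of [f], so the induction on the order has
    to let [g] vary. *)
Lemma Ck_comp k (U : set V) (I : set R) (f : V -> R) (g : R -> R) :
  open U -> (forall x, U x -> I (f x)) -> smooth I g -> Ck k U f ->
  Ck k U (g \o f).
Proof.
move=> oU fI; elim: k g => [|k IH] g sg sf.
  move=> x Ux; apply: continuous_comp; first exact: sf.
  by apply: smooth_continuous sg _; exact: fI.
have [df Df] := sf.
split=> [x Ux|v] /=.
  apply: differentiable_comp; first exact: df.
  by apply: smooth_differentiable sg _; exact: fI.
have H := CkM oU (IH _ (smooth_derive (1 : R) sg) (CkS sf)) (Df v).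
apply: Ck_eq oU _ H => x /set_mem Ux /=; rewrite -derive_comp //.
  exact: df.
by apply: smooth_derivable sg _; exact: fI.
Qed.

Lemma smooth_comp (U : set V) (I : set R) (f : V -> R) (g : R -> R) :
  open U -> (forall x, U x -> I (f x)) -> smooth I g -> smooth U f ->
  smooth U (g \o f).
Proof. by move=> oU fI sg sf k; exact: Ck_comp fI sg (sf k). Qed.

Lemma derive_real (g : R -> R) (x v : R) : derivable g x 1 ->
  'D_v g x = v * 'D_1 g x.
Proof.
move=> /derivable1_diffP dg; rewrite !deriveE //.
by rewrite -[in LHS](mulr1 v) -[v * 1]/(v *: 1) linearZ.
Qed.

(** Meant for primitives, whose derivative is known before their regularity: each order of [g] costs
    one order less of [g']. *)
Lemma smooth_eqderiv (I : set R) (g g' : R -> R) : open I ->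
  (forall x, I x -> is_derive x 1 g (g' x)) -> smooth I g' -> smooth I g.
Proof.
move=> oI dg sg' [|k].
  move=> x Ix; apply: differentiable_continuous; apply/derivable1_diffP.
  by have := dg x Ix => -[].
split=> [x Ix|v] /=; first by apply/derivable1_diffP; have := dg x Ix => -[].
have H := CkM oI (Ck_cst k I v) (sg' k).
apply: Ck_eq oI _ H => x /set_mem Ix /=.
by have [dgx <-] := dg x Ix; rewrite -derive_real.
Qed.

Lemma smooth_inv : smooth [set x : R | x != 0] (fun x => x^-1).
Proof.
have oI : open [set x : R | x != 0] by exact: open_neq.
move=> k; elim: k => [|k IH].
  by move=> x x0; exact: inv_continuous.
split=> [x x0|v] /=; first exact: differentiable_Rinv.
have H := CkM oI (Ck_cst k _ (- v)) (CkM oI IH IH).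
apply: Ck_eq oI _ H => x /set_mem x0 /=.
rewrite (@deriveV _ _ id x v x0 (@derivable_id _ _ _ _)) derive_id.
by rewrite /= expr2 invfM mulNr mulrC scaleNr.
Qed.

Lemma smooth_powR (r : R) : smooth [set x : R | 0 < x] (fun x => x `^ r).
Proof.
have oI : open [set x : R | 0 < x] by exact: open_gt.
move=> k; elim: k r => [|k IH] r.
  move=> x x0; apply: differentiable_continuous; apply/derivable1_diffP.
  by have := is_derive1_powR r x0 => -[].
split=> [x x0|v] /=.
  by apply/derivable1_diffP; have := is_derive1_powR r x0 => -[].
have H := CkM oI (Ck_cst k _ (v * r)) (IH (r - 1)).
apply: Ck_eq oI _ H => x /set_mem x0 /=.
by have [dgx E] := is_derive1_powR r x0; rewrite derive_real // E mulrA.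
Qed.

End SmoothComp.

(** * Restriction of functions of two variables to coordinate lines *)

Section Slices.
Variable R : realType.
Implicit Types (f : R * R -> R) (t u : R).

Notation e1 := ((1 : R), (0 : R)).
Notation e2 := ((0 : R), (1 : R)).

(** Both difference quotients are the same function of [h], so the limits agree whether or not they
    exist. *)
Lemma derive_slice1 f t u : 'D_1 (fun t => f (t, u)) t = 'D_e1 f (t, u).
Proof.
have E : (fun h : R => h^-1 *: (((fun x => f (x, u)) \o shift t) (h *: (1 : R)) - f (t, u))) =
    (fun h : R => h^-1 *: ((f \o shift (t, u)) (h *: e1) - f (t, u))).
  apply/funext => h; congr (_ *: (f _ - _)).
  by congr (_, _); rewrite /= scaler0 add0r.
exact: (congr1 (fun g : R -> R => lim (g @ (0 : R)^')) E).
Qed.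

Lemma derive_slice2 f t u : 'D_1 (fun u => f (t, u)) u = 'D_e2 f (t, u).
Proof.
have E : (fun h : R => h^-1 *: (((fun x => f (t, x)) \o shift u) (h *: (1 : R)) - f (t, u))) =
    (fun h : R => h^-1 *: ((f \o shift (t, u)) (h *: e2) - f (t, u))).
  apply/funext => h; congr (_ *: (f _ - _)).
  by congr (_, _); rewrite /= scaler0 add0r.
exact: (congr1 (fun g : R -> R => lim (g @ (0 : R)^')) E).
Qed.

Lemma is_diff_slice1 u t : is_diff t (fun t => (t, u)) (fun h => (h, 0 : R)).
Proof. by apply: is_diff_pair; exact: is_diff_id. Qed.

Lemma is_diff_slice2 t u : is_diff u (fun u => (t, u)) (fun h => (0 : R, h)).
Proof. by apply: is_diff_pair; exact: is_diff_cst. Qed.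

Lemma open_slice1 (U : set (R * R)) u : open U -> open [set t | U (t, u)].
Proof.
move=> oU; apply: (@open_comp _ _ (fun t => (t, u)) U) => // t _.
by apply: differentiable_continuous; have [] := is_diff_slice1 u t.
Qed.

Lemma open_slice2 (U : set (R * R)) t : open U -> open [set u | U (t, u)].
Proof.
move=> oU; apply: (@open_comp _ _ (fun u => (t, u)) U) => // u _.
by apply: differentiable_continuous; have [] := is_diff_slice2 t u.
Qed.

Lemma smooth_slice1 (U : set (R * R)) f u :
  open U -> smooth U f -> smooth [set t | U (t, u)] (fun t => f (t, u)).
Proof.
move=> oU sF.
exact: (smooth_comp_affine (open_slice1 oU) (is_diff_slice1 u) (fun _ H => H) sF).
Qed.

Lemma smooth_slice2 (U : set (R * R)) f t :
  open U -> smooth U f -> smooth [set u | U (t, u)] (fun u => f (t, u)).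
Proof.
move=> oU sF.
exact: (smooth_comp_affine (open_slice2 oU) (is_diff_slice2 t) (fun _ H => H) sF).
Qed.

End Slices.

(** * Complex and matrix valued maps *)

Section ComplexParts.
Variable R : rcfType.
Implicit Types z w : R[i].

Lemma complexRe_add z w : complex.Re (z + w) = complex.Re z + complex.Re w.
Proof. by case: z; case: w. Qed.
Lemma complexIm_add z w : complex.Im (z + w) = complex.Im z + complex.Im w.
Proof. by case: z; case: w. Qed.
Lemma complexRe_mul z w :
  complex.Re (z * w) = complex.Re z * complex.Re w - complex.Im z * complex.Im w.
Proof. by case: z; case: w. Qed.
Lemma complexIm_mul z w :
  complex.Im (z * w) = complex.Re z * complex.Im w + complex.Im z * complex.Re w.
Proof. by case: z; case: w. Qed.
Lemma complexRe_conj z : complex.Re (conjc z) = complex.Re z.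
Proof. by case: z. Qed.
Lemma complexIm_conj z : complex.Im (conjc z) = - complex.Im z.
Proof. by case: z. Qed.
Lemma complexRe_inv z :
  complex.Re z^-1 = complex.Re z * (complex.Re z ^+ 2 + complex.Im z ^+ 2)^-1.
Proof. by case: z. Qed.
Lemma complexIm_inv z :
  complex.Im z^-1 = - complex.Im z * (complex.Re z ^+ 2 + complex.Im z ^+ 2)^-1.
Proof. by case: z => a b; rewrite /= mulNr. Qed.
Lemma complex_sqnorm_gt0 z : z != 0 -> 0 < complex.Re z ^+ 2 + complex.Im z ^+ 2.
Proof.
move=> z0; rewrite lt0r addr_ge0 ?sqr_ge0 // andbT.
apply: contra z0; rewrite paddr_eq0 ?sqr_ge0 // !sqrf_eq0.
by case: z => a b /= /andP[/eqP-> /eqP->].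
Qed.

Lemma conjcD z w : conjc (z + w) = conjc z + conjc w. Proof. exact: rmorphD. Qed.
Lemma conjcN z : conjc (- z) = - conjc z. Proof. exact: rmorphN. Qed.
Lemma conjcM z w : conjc (z * w) = conjc z * conjc w. Proof. exact: rmorphM. Qed.

Lemma conjci : conjc 'i%R = - 'i%R :> R[i].
Proof. by rewrite -complexiE; apply/eqP; rewrite eq_complex /= oppr0 !eqxx. Qed.

Lemma conjcE :
  (forall z w, conjc (z + w) = conjc z + conjc w) *
  (forall z, conjc (- z) = - conjc z) *
  (forall z w, conjc (z * w) = conjc z * conjc w) *
  (conjc 'i%R = - 'i%R :> R[i]) * (forall r : R, conjc r%:C = r%:C) *
  (forall z, conjc (conjc z) = z) * (conjc 0 = 0 :> R[i]) * (conjc 1 = 1 :> R[i]).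
Proof.
do !split; [exact: conjcD|exact: conjcN|exact: conjcM|exact: conjci|
  exact: conjc_real|exact: conjcK|exact: conjc0|exact: conjc1].
Qed.

Definition complexReIm := (complexRe_add, complexIm_add, complexRe_mul,
  complexIm_mul, complexRe_conj, complexIm_conj).

End ComplexParts.

Section CSmooth.
Variables (R : realType) (V : normedModType R).
Local Notation C := R[i].
Implicit Types (U : set V) (f g : V -> C).

Definition csmooth U f :=
  smooth U (fun x => complex.Re (f x)) /\ smooth U (fun x => complex.Im (f x)).

Definition cderive (v : V) f (x : V) : C :=
  'D_v (fun x => complex.Re (f x)) x +i* 'D_v (fun x => complex.Im (f x)) x.

Lemma csmooth_sub U U' f : U' `<=` U -> csmooth U f -> csmooth U' f.
Proof. by move=> UU' [? ?]; split; apply: smooth_sub UU' _. Qed.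

Lemma csmooth_eq U f g : open U -> {in U, f =1 g} -> csmooth U f -> csmooth U g.
Proof.
by move=> oU fg [fr fi]; split; [apply: smooth_eq oU _ fr|apply: smooth_eq oU _ fi] => x Ux /=; rewrite fg.
Qed.

Lemma csmooth_cst U (c : C) : csmooth U (fun=> c).
Proof. by split; exact: smooth_cst. Qed.

Lemma csmooth_real U (r : V -> R) : smooth U r -> csmooth U (fun x => (r x)%:C).
Proof. by move=> H; split => //=; exact: smooth_cst. Qed.

Lemma csmoothD U f g : open U -> csmooth U f -> csmooth U g ->
  csmooth U (fun x => f x + g x).
Proof.
move=> oU [fr fi] [gr gi]; split.
  by under eq_fun do rewrite complexRe_add; exact: smoothD.
by under eq_fun do rewrite complexIm_add; exact: smoothD.
Qed.

Lemma csmoothM U f g : open U -> csmooth U f -> csmooth U g ->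
  csmooth U (fun x => f x * g x).
Proof.
move=> oU [fr fi] [gr gi]; split.
  by under eq_fun do rewrite complexRe_mul; apply: smoothB => //; exact: smoothM.
by under eq_fun do rewrite complexIm_mul; apply: smoothD => //; exact: smoothM.
Qed.

Lemma csmoothN U f : open U -> csmooth U f -> csmooth U (fun x => - f x).
Proof.
move=> oU Hf; under eq_fun do rewrite -mulN1r.
by apply: csmoothM => //; exact: csmooth_cst.
Qed.

Lemma csmoothB U f g : open U -> csmooth U f -> csmooth U g ->
  csmooth U (fun x => f x - g x).
Proof. by move=> oU Hf Hg; apply: csmoothD => //; exact: csmoothN. Qed.

Lemma csmooth_conj U f : open U -> csmooth U f -> csmooth U (fun x => conjc (f x)).
Proof.
move=> oU [fr fi]; split.
  by under eq_fun do rewrite complexRe_conj.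
by under eq_fun do rewrite complexIm_conj; exact: smoothN.
Qed.

Lemma csmooth_sqnorm U f : open U -> csmooth U f ->
  smooth U (fun x => complex.Re (f x) ^+ 2 + complex.Im (f x) ^+ 2).
Proof. by move=> oU [fr fi]; apply: smoothD => //; apply: smoothM. Qed.

Lemma csmoothV U f : open U -> (forall x, U x -> f x != 0) -> csmooth U f ->
  csmooth U (fun x => (f x)^-1).
Proof.
move=> oU f0 Hf; have [fr fi] := Hf.
have H : smooth U (fun x => (complex.Re (f x) ^+ 2 + complex.Im (f x) ^+ 2)^-1).
  apply: (smooth_comp oU _ (@smooth_inv R) (csmooth_sqnorm oU Hf)) => x Ux /=.
  by rewrite gt_eqF // complex_sqnorm_gt0 ?f0.
split.
  by under eq_fun do rewrite complexRe_inv; exact: smoothM.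
by under eq_fun do rewrite complexIm_inv; apply: smoothM => //; exact: smoothN.
Qed.

Lemma csmooth_sum U I (r : seq I) (P : pred I) (F : I -> V -> C) : open U ->
  (forall i, csmooth U (F i)) -> csmooth U (fun x => \sum_(i <- r | P i) F i x).
Proof.
move=> oU HF; elim: r => [|i r IH].
  by under eq_fun do rewrite big_nil; exact: csmooth_cst.
under eq_fun do rewrite big_cons; case: (P i) => //.
exact: csmoothD.
Qed.

Lemma csmooth_prod U I (r : seq I) (P : pred I) (F : I -> V -> C) : open U ->
  (forall i, csmooth U (F i)) -> csmooth U (fun x => \prod_(i <- r | P i) F i x).
Proof.
move=> oU HF; elim: r => [|i r IH].
  by under eq_fun do rewrite big_nil; exact: csmooth_cst.
under eq_fun do rewrite big_cons; case: (P i) => //.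
exact: csmoothM.
Qed.

Lemma csmooth_derive U v f : csmooth U f -> csmooth U (cderive v f).
Proof. by move=> [fr fi]; split; exact: smooth_derive. Qed.

Lemma cderive_near v f g x : (\near x, f x = g x) -> cderive v f x = cderive v g x.
Proof.
by move=> fg; congr (_ +i* _); apply: near_eq_derive; apply: filterS fg => y ->.
Qed.

Lemma cderive_cst v (c : C) x : cderive v (fun=> c) x = 0.
Proof. by rewrite /cderive !derive_cst. Qed.

Section Rules.
Variables (U : set V) (f g : V -> C) (v x : V).
Hypotheses (sf : csmooth U f) (sg : csmooth U g) (Ux : U x).

Let dfr : derivable (fun x => complex.Re (f x)) x v.
Proof. by case: sf => H _; apply: smooth_derivable H Ux. Qed.
Let dfi : derivable (fun x => complex.Im (f x)) x v.
Proof. by case: sf => _ H; apply: smooth_derivable H Ux. Qed.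
Let dgr : derivable (fun x => complex.Re (g x)) x v.
Proof. by case: sg => H _; apply: smooth_derivable H Ux. Qed.
Let dgi : derivable (fun x => complex.Im (g x)) x v.
Proof. by case: sg => _ H; apply: smooth_derivable H Ux. Qed.

Lemma cderiveD : cderive v (fun x => f x + g x) x = cderive v f x + cderive v g x.
Proof.
rewrite /cderive; under [X in 'D_v X x +i* _]eq_fun do rewrite complexRe_add.
under [X in _ +i* 'D_v X x]eq_fun do rewrite complexIm_add.
by rewrite (derive_add dfr dgr) (derive_add dfi dgi).
Qed.

Lemma cderiveM : cderive v (fun x => f x * g x) x =
  cderive v f x * g x + f x * cderive v g x.
Proof.
rewrite /cderive; under [X in 'D_v X x +i* _]eq_fun do rewrite complexRe_mul.
under [X in _ +i* 'D_v X x]eq_fun do rewrite complexIm_mul.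
rewrite (derive_sub (derivable_mul dfr dgr) (derivable_mul dfi dgi)).
rewrite (derive_add (derivable_mul dfr dgi) (derivable_mul dfi dgr)).
rewrite (derive_mul dfr dgr) (derive_mul dfi dgi) (derive_mul dfr dgi).
rewrite (derive_mul dfi dgr).
move: ('D_v _ x) ('D_v _ x) ('D_v _ x) ('D_v _ x) => a b c d.
by case: (f x) => p q; case: (g x) => r s; apply/eqP; rewrite eq_complex /=; apply/andP; split; apply/eqP; ring.
Qed.

Lemma cderive_conj : cderive v (fun x => conjc (f x)) x = conjc (cderive v f x).
Proof.
rewrite /cderive; under [X in 'D_v X x +i* _]eq_fun do rewrite complexRe_conj.
under [X in _ +i* 'D_v X x]eq_fun do rewrite complexIm_conj.
by rewrite (derive_opp dfi).
Qed.

Lemma cderive_real (r : V -> R) : cderive v (fun x => (r x)%:C) x = ('D_v r x)%:C.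
Proof. by rewrite /cderive /= derive_cst. Qed.

End Rules.

Lemma cderiveN U f v x : csmooth U f -> U x ->
  cderive v (fun x => - f x) x = - cderive v f x.
Proof.
move=> sf Ux; under [X in cderive v X]eq_fun do rewrite -mulN1r.
by rewrite (cderiveM _ (csmooth_cst U _) sf Ux) cderive_cst mul0r add0r mulN1r.
Qed.

Lemma cderiveB U f g v x : open U -> csmooth U f -> csmooth U g -> U x ->
  cderive v (fun x => f x - g x) x = cderive v f x - cderive v g x.
Proof.
by move=> oU sf sg Ux; rewrite (cderiveD _ sf (csmoothN oU sg) Ux) (cderiveN _ sg Ux).
Qed.

Lemma cderive_sum U I (r : seq I) (P : pred I) (F : I -> V -> C) v x : open U ->
  (forall i, csmooth U (F i)) -> U x ->
  cderive v (fun x => \sum_(i <- r | P i) F i x) x =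
  \sum_(i <- r | P i) cderive v (F i) x.
Proof.
move=> oU HF Ux; elim: r => [|i r IH].
  by rewrite big_nil; under eq_fun do rewrite big_nil; rewrite cderive_cst.
rewrite big_cons; under eq_fun do rewrite big_cons; case: (P i) => //.
by rewrite (@cderiveD U) //; [rewrite IH|exact: csmooth_sum].
Qed.

End CSmooth.

Lemma csmooth_comp_affine (R : realType) (V V' : normedModType R)
    (U' : set V') (U : set V) (f : V -> R[i]) (p : V' -> V) (l : V' -> V) :
  open U' -> (forall x, is_diff x p l) -> (forall x, U' x -> U (p x)) ->
  csmooth U f -> csmooth U' (f \o p).
Proof.
move=> oU' dp pU [fr fi]; split.
  exact: (smooth_comp_affine oU' dp pU fr).
exact: (smooth_comp_affine oU' dp pU fi).
Qed.

Section MatrixSmooth.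
Variables (R : realType) (V : normedModType R) (U : set V).
Hypothesis oU : open U.
Local Notation C := R[i].

Definition mxD (v : V) m n (F : V -> 'M[C]_(m, n)) (x : V) : 'M[C]_(m, n) :=
  \matrix_(i, j) cderive v (fun y => F y i j) x.

Lemma mxsmooth_eq m n (F G : V -> 'M[C]_(m, n)) :
  {in U, F =1 G} -> mxsmooth U F -> mxsmooth U G.
Proof.
by move=> FG sF i j; apply: (csmooth_eq oU _ (sF i j)) => x Ux /=; rewrite FG.
Qed.

Lemma mxsmooth_cst m n (A : 'M[C]_(m, n)) : mxsmooth U (fun=> A).
Proof. by move=> i j; exact: (csmooth_cst U (A i j)). Qed.

Lemma mxsmoothD m n (F G : V -> 'M[C]_(m, n)) :
  mxsmooth U F -> mxsmooth U G -> mxsmooth U (fun x => F x + G x).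
Proof.
move=> sF sG i j; rewrite -/(csmooth U (fun x => (F x + G x) i j)).
by under eq_fun do rewrite mxE; exact: (csmoothD oU (sF i j) (sG i j)).
Qed.

Lemma mxsmoothZ m n (c : V -> C) (F : V -> 'M[C]_(m, n)) :
  csmooth U c -> mxsmooth U F -> mxsmooth U (fun x => c x *: F x).
Proof.
move=> sc sF i j; rewrite -/(csmooth U (fun x => (c x *: F x) i j)).
by under eq_fun do rewrite mxE; exact: (csmoothM oU sc (sF i j)).
Qed.

Lemma mxsmoothN m n (F : V -> 'M[C]_(m, n)) :
  mxsmooth U F -> mxsmooth U (fun x => - F x).
Proof.
move=> sF i j; rewrite -/(csmooth U (fun x => (- F x) i j)).
by under eq_fun do rewrite mxE; exact: (csmoothN oU (sF i j)).
Qed.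

Lemma mxsmoothB m n (F G : V -> 'M[C]_(m, n)) :
  mxsmooth U F -> mxsmooth U G -> mxsmooth U (fun x => F x - G x).
Proof. by move=> sF sG; apply: mxsmoothD => //; exact: mxsmoothN. Qed.

Lemma mxsmoothM m n p (F : V -> 'M[C]_(m, n)) (G : V -> 'M[C]_(n, p)) :
  mxsmooth U F -> mxsmooth U G -> mxsmooth U (fun x => F x *m G x).
Proof.
move=> sF sG i j; rewrite -/(csmooth U (fun x => (F x *m G x) i j)).
under eq_fun do rewrite mxE; apply: csmooth_sum => // k.
exact: (csmoothM oU (sF i k) (sG k j)).
Qed.

Lemma mxsmooth_conjT m n (F : V -> 'M[C]_(m, n)) :
  mxsmooth U F -> mxsmooth U (fun x => conjT (F x)).
Proof.
move=> sF i j; rewrite -/(csmooth U (fun x => conjT (F x) i j)).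
by under eq_fun do rewrite !mxE; exact: (csmooth_conj oU (sF j i)).
Qed.

Lemma mxsmooth_D v m n (F : V -> 'M[C]_(m, n)) :
  mxsmooth U F -> mxsmooth U (mxD v F).
Proof.
move=> sF i j; rewrite -/(csmooth U (fun x => mxD v F x i j)).
by under eq_fun do rewrite !mxE; exact: (csmooth_derive v (sF i j)).
Qed.

Lemma csmooth_det n (F : V -> 'M[C]_n) :
  mxsmooth U F -> csmooth U (fun x => \det (F x)).
Proof.
move=> sF; rewrite /determinant; apply: csmooth_sum => // s.
apply: csmoothM => //; first exact: csmooth_cst.
by apply: csmooth_prod => // i; exact: sF.
Qed.

Lemma mxsmooth_col m n (F : V -> 'M[C]_(m, n)) j :
  mxsmooth U F -> mxsmooth U (fun x => col j (F x)).
Proof.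
move=> sF i k; rewrite -/(csmooth U (fun x => col j (F x) i k)).
by under eq_fun do rewrite mxE; exact: (sF i j).
Qed.

Lemma mxsmooth_row_mx m n p (F : V -> 'M[C]_(m, n)) (G : V -> 'M[C]_(m, p)) :
  mxsmooth U F -> mxsmooth U G -> mxsmooth U (fun x => row_mx (F x) (G x)).
Proof.
move=> sF sG i j; rewrite -/(csmooth U (fun x => row_mx (F x) (G x) i j)).
under eq_fun do rewrite mxE; case: (fintype.split j) => k; [exact: sF|exact: sG].
Qed.

Lemma mxsmooth_mx3 (F G H : V -> 'cV[C]_3) :
  mxsmooth U F -> mxsmooth U G -> mxsmooth U H ->
  mxsmooth U (fun x => mx3 (F x) (G x) (H x)).
Proof.
by move=> sF sG sH; exact: (mxsmooth_row_mx sF (mxsmooth_row_mx sG sH)).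
Qed.

Lemma csmooth_herm (Y Z : V -> 'cV[C]_3) :
  mxsmooth U Y -> mxsmooth U Z -> csmooth U (fun x => herm (Y x) (Z x)).
Proof.
move=> sY sZ; apply: (mxsmoothM (mxsmoothM (mxsmooth_conjT sY) _) sZ 0 0).
exact: mxsmooth_cst.
Qed.

Section Rules.
Variables (v x : V).
Hypothesis Ux : U x.

Lemma mxD_near m n (F G : V -> 'M[C]_(m, n)) :
  {in U, F =1 G} -> mxD v F x = mxD v G x.
Proof.
move=> FG; apply/matrixP=> i j; rewrite !mxE; apply: cderive_near.
by apply: filterS (open_nbhs_nbhs (conj oU Ux)) => y Uy; rewrite FG // inE.
Qed.

Lemma mxD_cst m n (A : 'M[C]_(m, n)) : mxD v (fun=> A) x = 0.
Proof. by apply/matrixP=> i j; rewrite !mxE cderive_cst. Qed.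

Lemma mxD_add m n (F G : V -> 'M[C]_(m, n)) :
  mxsmooth U F -> mxsmooth U G ->
  mxD v (fun x => F x + G x) x = mxD v F x + mxD v G x.
Proof.
move=> sF sG; apply/matrixP=> i j; rewrite !mxE.
under [X in cderive v X]eq_fun do rewrite mxE.
exact: (cderiveD v (sF i j) (sG i j) Ux).
Qed.

Lemma mxD_scale m n (c : V -> C) (F : V -> 'M[C]_(m, n)) :
  csmooth U c -> mxsmooth U F ->
  mxD v (fun x => c x *: F x) x = cderive v c x *: F x + c x *: mxD v F x.
Proof.
move=> sc sF; apply/matrixP=> i j; rewrite !mxE.
under [X in cderive v X]eq_fun do rewrite mxE.
exact: (cderiveM v sc (sF i j) Ux).
Qed.

Lemma mxD_mul m n p (F : V -> 'M[C]_(m, n)) (G : V -> 'M[C]_(n, p)) :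
  mxsmooth U F -> mxsmooth U G ->
  mxD v (fun x => F x *m G x) x = mxD v F x *m G x + F x *m mxD v G x.
Proof.
move=> sF sG; apply/matrixP=> i j; rewrite !mxE -big_split /=.
under [X in cderive v X]eq_fun do rewrite mxE.
rewrite (@cderive_sum _ _ U) //; last first.
  by move=> k; exact: (csmoothM oU (sF i k) (sG k j)).
apply: eq_bigr => k _; rewrite !mxE.
exact: (cderiveM v (sF i k) (sG k j) Ux).
Qed.

Lemma mxD_conjT m n (F : V -> 'M[C]_(m, n)) :
  mxsmooth U F -> mxD v (fun x => conjT (F x)) x = conjT (mxD v F x).
Proof.
move=> sF; apply/matrixP=> i j; rewrite !mxE.
under [X in cderive v X]eq_fun do rewrite !mxE.
exact: (cderive_conj v (sF j i) Ux).
Qed.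

Lemma mxD_row_mx m n p (F : V -> 'M[C]_(m, n)) (G : V -> 'M[C]_(m, p)) :
  mxD v (fun x => row_mx (F x) (G x)) x = row_mx (mxD v F x) (mxD v G x).
Proof.
apply/matrixP=> i j; rewrite !mxE.
under [X in cderive v X]eq_fun do rewrite !mxE.
by case: (fintype.split j) => k; rewrite mxE.
Qed.

Lemma mxD_mx3 (F G H : V -> 'cV[C]_3) :
  mxD v (fun x => mx3 (F x) (G x) (H x)) x =
  mx3 (mxD v F x) (mxD v G x) (mxD v H x).
Proof.
transitivity (row_mx (mxD v F x) (mxD v (fun x => row_mx (G x) (H x)) x)).
  exact: (@mxD_row_mx 3 1 (1 + 1) F (fun x => row_mx (G x) (H x))).
by rewrite mxD_row_mx.
Qed.

Lemma mxD_col m n (F : V -> 'M[C]_(m, n)) j :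
  mxD v (fun x => col j (F x)) x = col j (mxD v F x).
Proof.
by apply/matrixP=> i k; rewrite !mxE; under [X in cderive v X]eq_fun do rewrite !mxE.
Qed.

Lemma cderive_herm (Y Z : V -> 'cV[C]_3) : mxsmooth U Y -> mxsmooth U Z ->
  cderive v (fun x => herm (Y x) (Z x)) x =
  herm (mxD v Y x) (Z x) + herm (Y x) (mxD v Z x).
Proof.
move=> sY sZ; have sH := mxsmooth_cst (@hmx R).
have := mxD_mul (mxsmoothM (mxsmooth_conjT sY) sH) sZ.
rewrite (mxD_mul (mxsmooth_conjT sY) sH) mxD_cst mulmx0 addr0 mxD_conjT //.
by move=> /matrixP/(_ 0 0); rewrite [LHS]mxE [RHS]mxE.
Qed.

End Rules.
End MatrixSmooth.

Lemma mxsmooth_sub (R : realType) (V : normedModType R) (U U' : set V) m n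
  (F : V -> 'M[R[i]]_(m, n)) : U' `<=` U -> mxsmooth U F -> mxsmooth U' F.
Proof. by move=> UU' sF i j; apply: (csmooth_sub UU' (sF i j)). Qed.

Lemma mxsmooth_comp_affine (R : realType) (V V' : normedModType R)
    (U' : set V') (U : set V) m n (F : V -> 'M[R[i]]_(m, n)) (p l : V' -> V) :
  open U' -> (forall x, is_diff x p l) -> (forall x, U' x -> U (p x)) ->
  mxsmooth U F -> mxsmooth U' (F \o p).
Proof.
by move=> oU' dp pU sF i j; exact: (csmooth_comp_affine oU' dp pU (sF i j)).
Qed.

Lemma mxderiveE (R : realType) m n (F : R -> 'M[R[i]]_(m, n)) :
  mxderive F = mxD (1 : R) F.
Proof.
by apply/funext => t; apply/matrixP => i j; rewrite !mxE !derive1E.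
Qed.

(** * The Hermitian form *)

Local Notation o0 := (@Ordinal 3 0 isT).
Local Notation o1 := (@Ordinal 3 1 isT).
Local Notation o2 := (@Ordinal 3 2 isT).

Lemma ord3P (P : 'I_3 -> Prop) : P o0 -> P o1 -> P o2 -> forall i, P i.
Proof.
move=> P0 P1 P2 [[|[|[|//]]] Hi].
- by rewrite (_ : Ordinal Hi = o0) //; exact: val_inj.
- by rewrite (_ : Ordinal Hi = o1) //; exact: val_inj.
- by rewrite (_ : Ordinal Hi = o2) //; exact: val_inj.
Qed.

Lemma ord3_0 : 0 = o0 :> 'I_3. Proof. exact: val_inj. Qed.

Lemma sum_ord3 (M : nmodType) (F : 'I_3 -> M) : \sum_(i < 3) F i = F o0 + F o1 + F o2.
Proof.
rewrite !big_ord_recl big_ord0 addr0 addrA.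
by congr (F _ + F _ + F _); apply: val_inj.
Qed.

Section Mx3.
Variable R : realType.
Local Notation C := R[i].
Implicit Types (u v w : 'cV[C]_3) (A B : 'M[C]_3).

Lemma cV3P u v : u o0 0 = v o0 0 -> u o1 0 = v o1 0 -> u o2 0 = v o2 0 -> u = v.
Proof.
move=> *; apply/matrixP=> i j; rewrite (ord1 j); move: i; exact: ord3P.
Qed.

Lemma mx3E0 u v w i : mx3 u v w i o0 = u i 0.
Proof.
rewrite /mx3 (_ : o0 = @lshift 1 2 ord0); last exact: val_inj.
by rewrite (row_mxEl u).
Qed.

Lemma mx3E1 u v w i : mx3 u v w i o1 = v i 0.
Proof.
rewrite /mx3 (_ : o1 = @rshift 1 2 (@lshift 1 1 ord0)); last exact: val_inj.
by rewrite (row_mxEr u) (row_mxEl v).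
Qed.

Lemma mx3E2 u v w i : mx3 u v w i o2 = w i 0.
Proof.
rewrite /mx3 (_ : o2 = @rshift 1 2 (@rshift 1 1 ord0)); last exact: val_inj.
by rewrite (row_mxEr u) (row_mxEr v).
Qed.

Definition mx3E := (mx3E0, mx3E1, mx3E2).

Lemma mx33P A B : col o0 A = col o0 B -> col o1 A = col o1 B ->
  col o2 A = col o2 B -> A = B.
Proof.
move=> H0 H1 H2; apply/matrixP=> i; apply: ord3P.
- by have /matrixP/(_ i 0) := H0; rewrite !mxE.
- by have /matrixP/(_ i 0) := H1; rewrite !mxE.
- by have /matrixP/(_ i 0) := H2; rewrite !mxE.
Qed.

Lemma col_mx3 u v w : [/\ col o0 (mx3 u v w) = u, col o1 (mx3 u v w) = v &
  col o2 (mx3 u v w) = w].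
Proof. by split; apply/matrixP=> i j; rewrite (ord1 j) mxE mx3E. Qed.

Lemma mx3_col A : mx3 (col o0 A) (col o1 A) (col o2 A) = A.
Proof.
have [H0 H1 H2] := col_mx3 (col o0 A) (col o1 A) (col o2 A).
exact: mx33P.
Qed.

Lemma mx3_mul_mx33 u v w a b c d e f g h i :
  mx3 u v w *m mx33 [:: [:: a; b; c]; [:: d; e; f]; [:: g; h; i]] =
  mx3 (a *: u + d *: v + g *: w) (b *: u + e *: v + h *: w)
      (c *: u + f *: v + i *: w).
Proof.
apply/matrixP=> p; apply: ord3P; rewrite mxE sum_ord3 !mx3E !mxE /=; ring.
Qed.

Lemma col_mulmx m n p (A : 'M[C]_(m, n)) (B : 'M[C]_(n, p)) j : col j (A *m B) = A *m col j B.
Proof. by apply/matrixP=> q r; rewrite !mxE; apply: eq_bigr => k _; rewrite mxE. Qed.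

Lemma det_mx3E A : \det A =
  A o0 o0 * (A o1 o1 * A o2 o2 - A o1 o2 * A o2 o1)
  - A o0 o1 * (A o1 o0 * A o2 o2 - A o1 o2 * A o2 o0)
  + A o0 o2 * (A o1 o0 * A o2 o1 - A o1 o1 * A o2 o0).
Proof.
have det2 (B : 'M[C]_2) : \det B = B 0 0 * B 1 1 - B 0 1 * B 1 0.
  rewrite (expand_det_row B 0) !big_ord_recl big_ord0 /cofactor !det_mx11 !mxE /=.
  have L1 : lift 0 0 = 1 :> 'I_2 by exact: val_inj.
  have L2 : lift 1 0 = 0 :> 'I_2 by exact: val_inj.
  by rewrite !L1 !L2 /= expr0 expr1; ring.
rewrite (expand_det_row A o0) sum_ord3 /cofactor !det2 !mxE /=.
have [L00 L01] : lift o0 (0 : 'I_2) = o1 /\ lift o0 (1 : 'I_2) = o2.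
  by split; exact: val_inj.
have [L10 L11] : lift o1 (0 : 'I_2) = o0 /\ lift o1 (1 : 'I_2) = o2.
  by split; exact: val_inj.
have [L30 L31] : lift o2 (0 : 'I_2) = o0 /\ lift o2 (1 : 'I_2) = o1.
  by split; exact: val_inj.
rewrite !(L00, L01, L10, L11, L30, L31).
rewrite !addn0 !add0n expr0 expr1 expr2; ring.
Qed.

Lemma mul_i_i : 'i%R * 'i%R = -1 :> C. Proof. by rewrite -complexiE -expr2 sqr_i. Qed.

Lemma conjT_mul m n p (X : 'M[C]_(m, n)) (Y : 'M[C]_(n, p)) :
  conjT (X *m Y) = conjT Y *m conjT X.
Proof. by rewrite /conjT map_mxM trmx_mul. Qed.

Lemma conjT_scale m n c (X : 'M[C]_(m, n)) : conjT (c *: X) = conjc c *: conjT X.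
Proof. by apply/matrixP=> i j; rewrite !mxE conjcM. Qed.

Lemma hmx_sqr : hmx R *m hmx R = 1%:M.
Proof.
apply/matrixP; apply: ord3P; apply: ord3P; rewrite !mxE sum_ord3 !mxE /=.
all: rewrite ?complexiE; ring: (mul_i_i).
Qed.

Lemma det_hmx : \det (hmx R) = -1.
Proof.
rewrite det_mx3E !mxE /= complexiE; ring: mul_i_i.
Qed.

Lemma det_conjT A : \det (conjT A) = conjc (\det A).
Proof. by rewrite /conjT det_tr det_map_mx. Qed.

Lemma hermE u v : herm u v =
  'i * conjc (u o0 0) * v o2 0 + conjc (u o1 0) * v o1 0 - 'i * conjc (u o2 0) * v o0 0.
Proof.
rewrite /herm !mxE sum_ord3 !mxE !sum_ord3 !mxE /= complexiE; ring.
Qed.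

Lemma hermDl u v w : herm (u + v) w = herm u w + herm v w.
Proof. rewrite !hermE !mxE !conjcE; ring. Qed.
Lemma hermDr u v w : herm u (v + w) = herm u v + herm u w.
Proof. rewrite !hermE !mxE; ring. Qed.
Lemma hermZl c u v : herm (c *: u) v = conjc c * herm u v.
Proof. rewrite !hermE !mxE !conjcE; ring. Qed.
Lemma hermZr c u v : herm u (c *: v) = c * herm u v.
Proof. rewrite !hermE !mxE; ring. Qed.
Lemma hermNl u v : herm (- u) v = - herm u v.
Proof. by rewrite -scaleN1r hermZl conjcE conjc1 mulN1r. Qed.
Lemma hermNr u v : herm u (- v) = - herm u v.
Proof. by rewrite -scaleN1r hermZr mulN1r. Qed.
Lemma herm_conj u v : conjc (herm u v) = herm v u.
Proof.
by rewrite !hermE !conjcE; ring.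
Qed.

Definition hermlin := (hermDl, hermDr, hermZl, hermZr, hermNl, hermNr).

Lemma gramE m p (A : 'M[C]_(3, m)) (B : 'M[C]_(3, p)) i j : (conjT A *m hmx R *m B) i j = herm (col i A) (col j B).
Proof.
rewrite hermE !mxE sum_ord3 !mxE !sum_ord3 !mxE /= complexiE; ring.
Qed.

(* [F^-1 F'] for a frame [F] over a transversal curve in an arbitrary parameter:
   [a] is the strain and [b] is the twist times [a]. *)
Definition Pmx (z y a b : C) : 'M[C]_3 :=
  mx33 [:: [:: z; - ('i * a); b]; [:: 0; y; a]; [:: a; 0; z]].

Lemma KmxE kappa tau s : Kmx kappa tau s =
  Pmx ('i * (kappa s)%:C) (- (2%:R * 'i * (kappa s)%:C)) 1 (tau s)%:C.
Proof. by rewrite /Kmx /Pmx mulr1. Qed.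

(* The inverse of a matrix of U(2,1). *)
Definition uinv A : 'M[C]_3 := hmx R *m conjT A *m hmx R.

Definition in_U A := conjT A *m hmx R *m A = hmx R.

Lemma uinvl A : in_U A -> uinv A *m A = 1%:M.
Proof. by move=> UA; rewrite /uinv -!mulmxA (mulmxA (conjT A)) UA hmx_sqr. Qed.

Lemma uinvr A : in_U A -> A *m uinv A = 1%:M.
Proof. by move=> /uinvl/mulmx1C. Qed.

Lemma in_U_det A : in_U A -> conjc (\det A) * \det A = 1.
Proof.
move=> /(congr1 determinant); rewrite !det_mulmx det_conjT det_hmx => H.
by apply: oppr_inj; rewrite -[RHS]H; ring.
Qed.

Lemma in_U_scale c A : conjc c * c = 1 -> in_U A -> in_U (c *: A).
Proof.
rewrite /in_U conjT_scale => cc UA; rewrite -!scalemxAl -scalemxAr scalerA.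
by rewrite cc scale1r.
Qed.

End Mx3.

(** * Adapted frames *)

Lemma conjc_fixedE (R : realType) (z : R[i]) : conjc z = z -> z = (complex.Re z)%:C.
Proof.
case: z => x y /eqP; rewrite eq_complex /= => /andP[_ /eqP yy].
by apply/eqP; rewrite eq_complex /= eqxx /=; apply/eqP; lra.
Qed.

Lemma real_complexM (R : realType) (x y : R) : (x * y)%:C = x%:C * y%:C.
Proof. exact: rmorphM. Qed.
Lemma real_complexX (R : realType) (x : R) n : (x ^+ n)%:C = x%:C ^+ n.
Proof. exact: rmorphXn. Qed.
Lemma real_complexV (R : realType) (x : R) : (x^-1)%:C = (x%:C)^-1.
Proof. exact: fmorphV. Qed.

Lemma conjc_mulE (R : realType) (z : R[i]) :
  conjc z * z = (complex.Re z ^+ 2 + complex.Im z ^+ 2)%:C.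
Proof.
by case: z => x y; apply/eqP; rewrite eq_complex /=; apply/andP; split; apply/eqP; ring.
Qed.

Lemma gtc0_real (R : realType) (z : R[i]) :
  0 < z -> 0 < complex.Re z /\ z = (complex.Re z)%:C.
Proof.
case: z => x y; rewrite ltcE /= => /andP[/eqP -> ->]; split=> //.
Qed.

Section FrameExpansion.
Variable R : realType.
Local Notation C := R[i].

(** The coefficients are the entries of [uinv F *m w]; the factors [i] and [-i] are the corner
    entries of the left factor [hmx] in [uinv]. *)
Lemma frame_expand (F : 'M[C]_3) (w : 'cV[C]_3) : in_U F ->
  w = ('i%R * herm (col o2 F) w) *: col o0 F + herm (col o1 F) w *: col o1 F
      - ('i%R * herm (col o0 F) w) *: col o2 F.
Proof.
move=> UF; rewrite -[LHS]mul1mx -(uinvr UF) -mulmxA.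
have E i : (conjT F *m hmx R *m w) i 0 = herm (col i F) w.
  by rewrite gramE (_ : col 0 w = w) //; apply/matrixP=> p q; rewrite (ord1 q) mxE.
have {}E i : (uinv F *m w) i 0 = \sum_k hmx R i k * herm (col k F) w.
  rewrite /uinv -!mulmxA mxE; apply: eq_bigr => k _; rewrite -E -!mulmxA.
  by [].
apply/matrixP=> i j; rewrite (ord1 j) [LHS]mxE sum_ord3 !E !sum_ord3 !mxE /=.
move: (herm (col o0 F) w) (herm (col o1 F) w) (herm (col o2 F) w) => p q r.
by rewrite complexiE; ring.
Qed.

End FrameExpansion.

Section Frames.
Variables (R : realType) (V : normedModType R) (v : V) (U : set V).
Hypothesis oU : open U.
Local Notation C := R[i].

(* The frames are only in U(2,1): normalizing their determinant needs a cube root,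
   while strain and twist do not see the phase. *)
Definition adapted (F : V -> 'M[C]_3) (k : V -> R) (y : V -> C) (a b : V -> R) :=
  [/\ mxsmooth U F, smooth U k /\ csmooth U y, smooth U a, smooth U b &
    forall x, U x -> [/\ 0 < a x, in_U (F x) &
      mxD v F x = F x *m Pmx ('i%R * (k x)%:C) (y x) (a x)%:C (b x)%:C]].

Definition oscD (Z : V -> 'cV[C]_3) (x : V) : C :=
  \det (mx3 (Z x) (mxD v Z x) (mxD v (mxD v Z) x)).

Lemma csmooth_oscD Z : mxsmooth U Z -> csmooth U (oscD Z).
Proof.
move=> sZ; apply: csmooth_det => //; have sD := mxsmooth_D v sZ.
by apply: mxsmooth_mx3 => //; exact: mxsmooth_D.
Qed.

(** By the product rule the osculating matrix of [c Z] is that of [Z] times an upper triangular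
    matrix with diagonal [c, c, c]. *)
Lemma oscD_scale (c : V -> C) Z x : csmooth U c -> mxsmooth U Z -> U x ->
  oscD (fun x => c x *: Z x) x = c x ^+ 3 * oscD Z x.
Proof.
move=> sc sZ Ux; have sD := mxsmooth_D v sZ; have sdc := csmooth_derive v sc.
have E2 : mxD v (mxD v (fun x => c x *: Z x)) x =
    cderive v (cderive v c) x *: Z x + (2%:R * cderive v c x) *: mxD v Z x
    + c x *: mxD v (mxD v Z) x.
  transitivity (mxD v (fun x => cderive v c x *: Z x + c x *: mxD v Z x) x).
    by apply: (mxD_near oU _ Ux) => t /set_mem Ut; exact: (mxD_scale _ Ut sc sZ).
  rewrite (mxD_add _ Ux (mxsmoothZ oU sdc sZ) (mxsmoothZ oU sc sD)).
  rewrite (mxD_scale _ Ux sdc sZ) (mxD_scale _ Ux sc sD).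
  by apply/matrixP=> i j; rewrite !mxE; ring.
rewrite /oscD E2 (mxD_scale _ Ux sc sZ).
set c1 := cderive v c x; set c2 := cderive v _ x.
transitivity (\det (mx3 (Z x) (mxD v Z x) (mxD v (mxD v Z) x) *m
  mx33 [:: [:: c x; c1; c2]; [:: 0; c x; 2%:R * c1]; [:: 0; 0; c x]])).
  by rewrite mx3_mul_mx33 !scale0r !addr0.
by rewrite det_mulmx mulrC; congr (_ * _); rewrite det_mx3E !mxE /=; ring.
Qed.

Section Normalized.
Variables (G : V -> 'cV[C]_3) (a : V -> R).
Hypotheses (sG : mxsmooth U G) (sa : smooth U a).
Hypothesis HG : forall x, U x -> [/\ 0 < a x, herm (G x) (G x) = 0,
  herm (G x) (mxD v G x) = 'i%R * (a x)%:C &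
  conjc (oscD G x) * oscD G x = (a x)%:C ^+ 6].

Let a0 x : U x -> (a x)%:C != 0.
Proof. by move=> /HG[H _ _ _]; rewrite -(rmorph0 (real_complex R)) (inj_eq (@complexI R)) gt_eqF. Qed.

Let sac : csmooth U (fun x => (a x)%:C). Proof. exact: csmooth_real. Qed.
Let siac : csmooth U (fun x => ((a x)%:C)^-1). Proof. exact: csmoothV. Qed.

Variables (k b : V -> R) (F2 F3 : V -> 'cV[C]_3).
Let z x : C := 'i%R * (k x)%:C.
Local Notation D1 := (mxD v G).
Local Notation D2 := (mxD v F2).
Local Notation D3 := (mxD v F3).
Hypotheses (sk : smooth U k) (sb : smooth U b).
Hypotheses (sF2 : mxsmooth U F2) (sF3 : mxsmooth U F3).
Hypothesis E1 : forall x, U x -> D1 x = z x *: G x + (a x)%:C *: F3 x.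
Hypothesis E3 : forall x, U x ->
  D3 x = (b x)%:C *: G x + (a x)%:C *: F2 x + z x *: F3 x.
Hypothesis kE : forall x, U x -> herm (D1 x) (D1 x) = 2%:R * (a x)%:C * (k x)%:C.
Hypothesis bE : forall x, U x -> (b x)%:C = 'i%R * herm (F3 x) (D3 x).

Let F x := mx3 (G x) (F2 x) (F3 x).
Let y x := herm (F2 x) (D2 x).

Let sD1 : mxsmooth U D1. Proof. exact: mxsmooth_D. Qed.
Let sz : csmooth U z.
Proof. by apply: csmoothM => //; [exact: csmooth_cst|exact: csmooth_real]. Qed.
Let sD3 : mxsmooth U D3. Proof. exact: mxsmooth_D. Qed.
Let sD2 : mxsmooth U D2. Proof. exact: mxsmooth_D. Qed.
Let conjz x : conjc (z x) = - z x.
Proof. by rewrite /z !conjcE mulNr. Qed.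

Let h13 x : U x -> herm (G x) (F3 x) = 'i%R.
Proof.
move=> Ux; have [_ h11 h1D _] := HG Ux; move: h1D.
rewrite -/(D1 x) (E1 Ux) !hermlin h11 mulr0 add0r mulrC => /(mulIf (a0 Ux)).
exact.
Qed.
Let h31 x : U x -> herm (F3 x) (G x) = - 'i%R.
Proof. by move=> Ux; rewrite -herm_conj h13 // conjci. Qed.
(** With [z = i k] the expansion of [D1] gives [<D1, D1> = 2 a k + a^2 <F3, F3>], so the choice of
    [k] recorded in [kE] says exactly that [F3] is null. *)
Lemma frame_h33 x : U x -> herm (F3 x) (F3 x) = 0.
Proof.
move=> Ux; have [_ h11 _ _] := HG Ux.
have := kE Ux; rewrite (E1 Ux) !hermlin h11 h13 // h31 // conjz conjc_real /z => H.
have : (a x)%:C * ((a x)%:C * herm (F3 x) (F3 x)) = 0.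
  rewrite -[RHS](subrr (2%:R * (a x)%:C * (k x)%:C)) -[X in _ = X - _]H.
  by ring: (mul_i_i R).
by move=> /eqP; rewrite !mulf_eq0 (negbTE (a0 Ux)) /= => /eqP.
Qed.

Let b_herm x : U x -> herm (F3 x) (D3 x) = - ('i%R * (b x)%:C).
Proof.
move=> Ux; rewrite (bE Ux). by ring: (mul_i_i R).
Qed.

Let h1D3 x : U x -> herm (G x) (D3 x) = - (k x)%:C.
Proof.
move=> Ux; have E : herm (D1 x) (F3 x) + herm (G x) (D3 x) = 0.
  rewrite -(cderive_herm oU v Ux sG sF3) -[RHS](cderive_cst v 'i%R x).
  apply: cderive_near; apply: filterS (open_nbhs_nbhs (conj oU Ux)).
  exact: h13.
move: E; rewrite {1}(E1 Ux) !hermlin h13 // frame_h33 // conjz => E.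
rewrite -[LHS](addrK (- z x * 'i%R + conjc (a x)%:C * 0)) addrC.
by rewrite [in X in _ + X]addrC E addr0 /z; ring: (mul_i_i R).
Qed.

(** No choice is involved here: [<G, D3> = - k] comes from differentiating [<G, F3> = i], and the
    [F3] component of [D3] already accounts for it. *)
Let h12 x : U x -> herm (G x) (F2 x) = 0.
Proof.
move=> Ux; have [_ h11 _ _] := HG Ux; have := h1D3 Ux.
rewrite (E3 Ux) !hermlin h11 h13 // /z => H.
have : (a x)%:C * herm (G x) (F2 x) = 0.
  by rewrite -[RHS](subrr (- (k x)%:C)) -[X in _ = X - _]H; ring: (mul_i_i R).
by move=> /eqP; rewrite mulf_eq0 (negbTE (a0 Ux)) => /eqP.
Qed.

(** Since [<F3, D3> = - i b + a <F3, F2>], the choice of [b] recorded in [bE] amounts to this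
    orthogonality. *)
Let h32 x : U x -> herm (F3 x) (F2 x) = 0.
Proof.
move=> Ux; have := b_herm Ux; rewrite (E3 Ux) !hermlin h31 // frame_h33 // => H.
have : (a x)%:C * herm (F3 x) (F2 x) = 0.
  by rewrite -[RHS](subrr (- ('i%R * (b x)%:C))) -[X in _ = X - _]H; ring.
by move=> /eqP; rewrite mulf_eq0 (negbTE (a0 Ux)) => /eqP.
Qed.

Let gramF x : U x -> conjT (F x) *m hmx R *m F x =
  mx33 [:: [:: 0; 0; 'i%R]; [:: 0; herm (F2 x) (F2 x); 0]; [:: - 'i%R; 0; 0]].
Proof.
move=> Ux; have [_ h11 _ _] := HG Ux; have [c0 c1 c2] := col_mx3 (G x) (F2 x) (F3 x).
apply/matrixP; apply: ord3P; apply: ord3P; rewrite gramE /F ?c0 ?c1 ?c2 mxE /= //.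
- exact: h12.
- exact: h13.
- by rewrite -herm_conj h12 // conjc0.
- by rewrite -herm_conj h32 // conjc0.
- exact: h31.
- exact: h32.
- exact: frame_h33.
Qed.

(** The Gram matrix is now known up to [<F2, F2>], and taking determinants expresses this last entry
    through [det F]. *)
Let det_F x : U x -> herm (F2 x) (F2 x) = conjc (\det (F x)) * \det (F x).
Proof.
move=> /gramF/(congr1 determinant); rewrite !det_mulmx det_conjT det_hmx => H.
apply: oppr_inj; transitivity (conjc (\det (F x)) * -1 * \det (F x)); last by ring.
by rewrite H det_mx3E !mxE /=; ring: (mul_i_i R).
Qed.

(** The coefficients of [G, G', G''] in the frame form a matrix of determinant [- a^3]. This
    explains the exponent 6 in the normalization of [G]: it says [|det F| = 1], which is the missing
    condition for unitarity. *)
Lemma oscD_frame x : U x -> oscD G x = - (\det (F x) * (a x)%:C ^+ 3).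
Proof.
move=> Ux; rewrite /oscD -/D1.
have -> : mxD v D1 x =
    (cderive v z x + z x ^+ 2 + (a x)%:C * (b x)%:C) *: G x
    + (a x)%:C ^+ 2 *: F2 x
    + (2%:R * z x * (a x)%:C + cderive v (fun x => (a x)%:C) x) *: F3 x.
  transitivity (mxD v (fun x => z x *: G x + (a x)%:C *: F3 x) x).
    by apply: (mxD_near oU _ Ux) => t /set_mem Ut; exact: E1.
  rewrite (mxD_add _ Ux (mxsmoothZ oU sz sG) (mxsmoothZ oU sac sF3)).
  rewrite (mxD_scale _ Ux sz sG) (mxD_scale _ Ux sac sF3) -/D1 -/D3.
  rewrite (E1 Ux) (E3 Ux); move: (G x) (F2 x) (F3 x) => A B W.
  move: (cderive v z x) (z x) (cderive v _ x) (a x)%:C (b x)%:C => ? ? ? ? ?.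
  by apply/matrixP=> i j; rewrite !mxE; ring.
rewrite [in X in mx3 _ X _](E1 Ux).
set c0 := cderive v z x + _ + _; set c2 := _ + cderive v _ x.
transitivity (\det (F x *m
  mx33 [:: [:: 1; z x; c0]; [:: 0; 0; (a x)%:C ^+ 2]; [:: 0; (a x)%:C; c2]])).
  by rewrite /F mx3_mul_mx33 !scale0r !addr0 scale1r.
by rewrite det_mulmx -mulrN; congr (_ * _); rewrite det_mx3E !mxE /=; ring.
Qed.

Let UF x : U x -> in_U (F x).
Proof.
move=> Ux; rewrite /in_U gramF //; have [_ _ _] := HG Ux.
rewrite oscD_frame // !conjcE.
move=> H; have : conjc (\det (F x)) * \det (F x) * (a x)%:C ^+ 6 = 1 * (a x)%:C ^+ 6.
  by rewrite mul1r -[RHS]H; ring.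
move/(mulIf (expf_neq0 _ (a0 Ux))); rewrite -det_F // => ->.
by rewrite /hmx complexiE.
Qed.

Lemma adapted_mx3 : adapted F k y a b.
Proof.
split=> //; first exact: mxsmooth_mx3.
  by split=> //; exact: csmooth_herm.
move=> x Ux; split; [by have [] := HG Ux|exact: UF|].
(* The frame is unitary, so [F2'] is determined by its products with the frame. Two of them follow
   from differentiating [<G, F2> = 0] and [<F3, F2> = 0]; the third is [y] by definition. *)
have HD2 : D2 x = (- ('i%R * (a x)%:C)) *: G x + y x *: F2 x.
  rewrite [LHS](frame_expand _ (UF Ux)).
  have [-> -> ->] := col_mx3 (G x) (F2 x) (F3 x).
  have e1 : herm (D1 x) (F2 x) + herm (G x) (D2 x) = 0.
    rewrite -(cderive_herm oU v Ux sG sF2) -[RHS](cderive_cst v 0 x).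
    apply: cderive_near; apply: filterS (open_nbhs_nbhs (conj oU Ux)).
    exact: h12.
  have e3 : herm (D3 x) (F2 x) + herm (F3 x) (D2 x) = 0.
    rewrite -(cderive_herm oU v Ux sF3 sF2) -[RHS](cderive_cst v 0 x).
    apply: cderive_near; apply: filterS (open_nbhs_nbhs (conj oU Ux)).
    exact: h32.
  have n2 : herm (F2 x) (F2 x) = 1.
    by have := UF Ux; rewrite /in_U gramF // => /matrixP/(_ o1 o1); rewrite !mxE.
  move: e1 e3; rewrite {1}(E1 Ux) {1}(E3 Ux) !hermlin h12 // h32 // n2 !conjcE.
  rewrite !mulr0 !add0r mulr1 addr0 => -> /eqP; rewrite addrC addr_eq0 => /eqP ->.
  by rewrite mulr0 scale0r subr0 mulrN.
rewrite /F (mxD_mx3 v) -/D1 -/D2 -/D3 (E1 Ux) (E3 Ux) HD2.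
by rewrite /Pmx mx3_mul_mx33 !scale0r !addr0.
Qed.

End Normalized.

Lemma normalized_frame (G : V -> 'cV[C]_3) (a : V -> R) :
  mxsmooth U G -> smooth U a ->
  (forall x, U x -> [/\ 0 < a x, herm (G x) (G x) = 0,
    herm (G x) (mxD v G x) = 'i%R * (a x)%:C &
    conjc (oscD G x) * oscD G x = (a x)%:C ^+ 6]) ->
  exists F k y b, adapted F k y a b /\ forall x, col 0 (F x) = G x.
Proof.
move=> sG sa HG.
have a0 x : U x -> (a x)%:C != 0.
  by move=> /HG[H _ _ _]; rewrite -(rmorph0 (real_complex R)) (inj_eq (@complexI R)) gt_eqF.
have siac : csmooth U (fun x => ((a x)%:C)^-1).
  by apply: csmoothV => //; exact: csmooth_real.
pose D1 := mxD v G; have sD1 : mxsmooth U D1 by exact: mxsmooth_D.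
(* The value for which [F3], defined below by solving [D1 = i k G + a F3], comes out null. The
   number is already real. *)
pose k x := complex.Re (herm (D1 x) (D1 x) * (2%:R^-1 * ((a x)%:C)^-1)).
have kE x : U x -> herm (D1 x) (D1 x) = 2%:R * (a x)%:C * (k x)%:C.
  move=> Ux; rewrite /k -conjc_fixedE; last first.
    rewrite conjcM herm_conj; congr (_ * _).
    by rewrite conjcM !conjc_inv conjc_real conjc_nat.
  by have := a0 _ Ux; move: (a x)%:C (herm _ _) => A W A0; field.
have sk : smooth U k.
  by have [] := csmoothM oU (csmooth_herm oU sD1 sD1)
    (csmoothM oU (csmooth_cst U 2%:R^-1) siac).
have sz : csmooth U (fun x => 'i%R * (k x)%:C).
  by apply: csmoothM => //; [exact: csmooth_cst|exact: csmooth_real].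
have [F3 sF3 F3E] : exists2 F3, mxsmooth U F3 &
    forall x, F3 x = ((a x)%:C)^-1 *: (D1 x - ('i%R * (k x)%:C) *: G x).
  exists (fun x => ((a x)%:C)^-1 *: (D1 x - ('i%R * (k x)%:C) *: G x)) => //.
  exact: (mxsmoothZ oU siac (mxsmoothB oU sD1 (mxsmoothZ oU sz sG))).
pose D3 := mxD v F3; have sD3 : mxsmooth U D3 by exact: mxsmooth_D.
pose b x := complex.Re ('i%R * herm (F3 x) (D3 x)).
have sb : smooth U b.
  by have [] := csmoothM oU (csmooth_cst U 'i%R) (csmooth_herm oU sF3 sD3).
have [F2 sF2 F2E] : exists2 F2, mxsmooth U F2 &
    forall x, F2 x = ((a x)%:C)^-1 *:
      (D3 x - (b x)%:C *: G x - ('i%R * (k x)%:C) *: F3 x).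
  exists (fun x => ((a x)%:C)^-1 *:
    (D3 x - (b x)%:C *: G x - ('i%R * (k x)%:C) *: F3 x)) => //.
  exact: (mxsmoothZ oU siac (mxsmoothB oU (mxsmoothB oU sD3
    (mxsmoothZ oU (csmooth_real sb) sG)) (mxsmoothZ oU sz sF3))).
have E1 x : U x -> D1 x = ('i%R * (k x)%:C) *: G x + (a x)%:C *: F3 x.
  by move=> Ux; rewrite F3E scalerA divff ?a0 // scale1r addrC subrK.
have E3 x : U x ->
    D3 x = (b x)%:C *: G x + (a x)%:C *: F2 x + ('i%R * (k x)%:C) *: F3 x.
  move=> Ux; rewrite F2E scalerA divff ?a0 // scale1r.
  by rewrite -addrA subrK addrC subrK.
have h33 := frame_h33 HG E1 kE.
(* Differentiating [<F3, F3> = 0] shows that [<F3, D3>] is imaginary, so the real part in the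
   definition of [b] loses nothing. *)
have bE x : U x -> (b x)%:C = 'i%R * herm (F3 x) (D3 x).
  move=> Ux; have E : herm (D3 x) (F3 x) + herm (F3 x) (D3 x) = 0.
    rewrite -(cderive_herm oU v Ux sF3 sF3) -[RHS](cderive_cst v 0 x).
    apply: cderive_near; apply: filterS (open_nbhs_nbhs (conj oU Ux)).
    exact: h33.
  rewrite /b -conjc_fixedE // conjcM conjci herm_conj.
  by rewrite -(addr0_eq E) mulNr mulrN.
exists (fun x => mx3 (G x) (F2 x) (F3 x)), k, (fun x => herm (F2 x) (mxD v F2 x)), b.
split; first exact: (adapted_mx3 sG sa HG sk sb sF2 sF3 E1 E3 kE bE).
by move=> x; rewrite ord3_0; have [] := col_mx3 (G x) (F2 x) (F3 x).
Qed.

(** A positive real factor [m] suffices, because U(2,1) constrains only the modulus of the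
    osculating determinant; and a real sixth root of a positive smooth function is smooth. *)
Lemma lift_frame (Z : V -> 'cV[C]_3) : mxsmooth U Z ->
  (forall x, U x -> [/\ herm (Z x) (Z x) = 0,
    0 < - 'i%R * herm (Z x) (mxD v Z x) & oscD Z x != 0]) ->
  exists F k y a b m, [/\ adapted F k y a b, forall x, U x -> 0 < m x :> R &
    forall x, col 0 (F x) = (m x)%:C *: Z x].
Proof.
move=> sZ HZ; have sDZ := mxsmooth_D v sZ.
pose p x := complex.Re (- 'i%R * herm (Z x) (mxD v Z x)).
have p0 x : U x -> 0 < p x by move=> /HZ[_ /gtc0_real[]].
have pE x : U x -> herm (Z x) (mxD v Z x) = 'i%R * (p x)%:C.
  move=> /HZ[_ /gtc0_real[_ E] _]; rewrite -E mulrA mulrN.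
  by rewrite mul_i_i opprK mul1r.
have sp : smooth U p.
  by have [] := csmoothM oU (csmooth_cst U (- 'i%R)) (csmooth_herm oU sZ sDZ).
pose q x := complex.Re (oscD Z x) ^+ 2 + complex.Im (oscD Z x) ^+ 2.
have q0 x : U x -> 0 < q x by move=> /HZ[_ _ /complex_sqnorm_gt0].
have sq : smooth U q by apply: csmooth_sqnorm => //; exact: csmooth_oscD.
have [r sr [r0 rE]] : exists2 r, smooth U r &
    (forall x, U x -> 0 < r x) /\ (forall x, U x -> r x ^+ 6 = q x).
  exists (fun x => q x `^ 6%:R^-1).
    exact: (smooth_comp oU q0 (@smooth_powR R 6%:R^-1) sq).
  split=> x Ux; first exact/powR_gt0/q0.
  by rewrite -powR_mulrn ?powR_ge0 // -powRrM mulVf ?powRr1 ?pnatr_eq0 // ltW // q0.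
have sip : smooth U (fun x => (p x)^-1).
  by apply: (smooth_comp oU _ (@smooth_inv R) sp) => x Ux /=; rewrite gt_eqF ?p0.
(* Scaling by [m] turns [p] into [m^2 p], which must be [a], and [q] into [m^6 q], which must be
   [a^6 = m^12 p^6]. Hence [m = q^(1/6) / p]. *)
pose m x := r x * (p x)^-1; pose a x := r x * r x * (p x)^-1.
have sm : smooth U m by exact: smoothM.
have sa : smooth U a by apply: smoothM => //; exact: smoothM.
have smc := csmooth_real sm.
have sG := mxsmoothZ oU smc sZ.
have pC x : U x -> (p x)%:C != 0.
  by move=> /p0 H; rewrite -(rmorph0 (real_complex R)) (inj_eq (@complexI R)) gt_eqF.
have [|F [k [y [b [AF FG]]]]] := normalized_frame sG sa; last first.
  exists F, k, y, a, b, m; split=> // x Ux.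
  by rewrite /m divr_gt0 ?r0 ?p0.
move=> x Ux; have [h0 _ _] := HZ x Ux.
split.
- by rewrite /a divr_gt0 ?p0 // mulr_gt0 ?r0.
- by rewrite !hermlin h0 !mulr0.
- rewrite (mxD_scale _ Ux smc sZ) !hermlin h0 pE // conjc_real /m /a.
  rewrite !(real_complexM, real_complexV).
  have P0 := pC x Ux; rewrite mulr0 add0r.
  by move: (r x)%:C (p x)%:C P0 => r' P P0; field.
- rewrite (oscD_scale smc sZ Ux).
  have cm : conjc ((m x)%:C ^+ 3) = (m x)%:C ^+ 3 by rewrite -real_complexX conjc_real.
  rewrite conjcM cm.
  transitivity ((m x)%:C ^+ 6 * (conjc (oscD Z x) * oscD Z x)); first by ring.
  rewrite conjc_mulE -/(q x) -rE // /m /a !(real_complexM, real_complexV, real_complexX).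
  have P0 := pC x Ux.
  by move: (r x)%:C (p x)%:C P0 => r' P P0; field.
Qed.

End Frames.

(** * Uniqueness of adapted frames up to a phase *)

Section Uniqueness.
Variables (R : realType) (V : normedModType R) (v : V) (U : set V).
Hypothesis oU : open U.
Local Notation C := R[i].

Lemma cderive_eq0 (f : V -> C) (c : C) x : (forall t, U t -> f t = c) -> U x ->
  cderive v f x = 0.
Proof.
move=> fc Ux; rewrite -(cderive_cst v c x); apply: cderive_near.
exact: filterS (open_nbhs_nbhs (conj oU Ux)).
Qed.

Lemma frame_change (F G : V -> 'M[C]_3) : mxsmooth U F -> mxsmooth U G ->
  (forall x, U x -> in_U (F x)) -> (forall x, U x -> in_U (G x)) ->
  exists2 M, mxsmooth U M & forall x, U x -> G x = F x *m M x /\ in_U (M x).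
Proof.
move=> sF sG UF UG; exists (fun x => uinv (F x) *m G x) => [|x Ux].
  apply: mxsmoothM => //; apply: mxsmoothM => //; last exact: mxsmooth_cst.
  by apply: mxsmoothM => //; [exact: mxsmooth_cst|exact: mxsmooth_conjT].
have E : F x *m (uinv (F x) *m G x) = G x by rewrite mulmxA (uinvr (UF x Ux)) mul1mx.
split=> //; rewrite /in_U; have := UG x Ux; rewrite /in_U -{1 2}E conjT_mul.
set M := uinv _ *m _ => H; rewrite -[RHS]H -!mulmxA; congr (_ *m _).
by rewrite -[in LHS](UF x Ux) -!mulmxA.
Qed.

Lemma in_U_gram (M : 'M[C]_3) i j : in_U M ->
  'i%R * conjc (M o0 i) * M o2 j + conjc (M o1 i) * M o1 j
  - 'i%R * conjc (M o2 i) * M o0 j = hmx R i j.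
Proof. by move=> <-; rewrite gramE hermE !mxE. Qed.

Section TwoFrames.
Variables (F G : V -> 'M[C]_3) (k k' : V -> R) (y y' : V -> C) (a a' b b' : V -> R).
Hypotheses (AF : adapted v U F k y a b) (AG : adapted v U G k' y' a' b').
Hypothesis FG : forall x, U x -> exists c, col 0 (G x) = c *: col 0 (F x).

(** The transition matrix [M = F^-1 G] is unitary and fixes the first coordinate line. The zeros and
    the repeated entries in the shape of [P] then force it to be a scalar of modulus one, step by
    step. *)
Lemma adapted_unique x : U x -> [/\ a' x = a x, b' x = b x &
  exists c, conjc c * c = 1 /\ G x = c *: F x].
Proof.
have [sF [sk sy] sa sb HF] := AF; have [sG [sk' sy'] sa' sb' HG] := AG.
have UF t : U t -> in_U (F t) by case/HF.
have UG t : U t -> in_U (G t) by case/HG.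
have [M sM GE] := frame_change sF sG UF UG.
(* Differentiating [G = F M] and cancelling [F] gives the gauge transformation law. Its entries are
   used one at a time below. *)
have E t : U t -> M t *m Pmx ('i%R * (k' t)%:C) (y' t) (a' t)%:C (b' t)%:C =
    Pmx ('i%R * (k t)%:C) (y t) (a t)%:C (b t)%:C *m M t + mxD v M t.
  move=> Ut; have [_ _ DF] := HF t Ut; have [_ _ DG] := HG t Ut.
  have : mxD v G t = mxD v (fun t => F t *m M t) t.
    by apply: (mxD_near oU v Ut) => s /set_mem /GE[].
  rewrite (mxD_mul oU v Ut sF sM) DF DG {1}(GE t Ut).1 -!mulmxA -mulmxDr.
  by move/(congr1 (mulmx (uinv (F t)))); rewrite !mulmxA (uinvl (UF t Ut)) !mul1mx.
have MU i j t : U t -> _ := fun Ut => in_U_gram i j (GE t Ut).2.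
have Mc0 t : U t -> M t o1 o0 = 0 /\ M t o2 o0 = 0.
  move=> Ut; have [c] := FG Ut; rewrite (GE t Ut).1 col_mulmx.
  move/(congr1 (mulmx (uinv (F t)))); rewrite mulmxA -scalemxAr.
  rewrite -[uinv (F t) *m col 0 (F t)]col_mulmx (uinvl (UF t Ut)) mul1mx => /matrixP H.
  by have := H o1 0; have := H o2 0; rewrite !mxE ord3_0 /= !mulr0 => -> ->.
have cd t : U t -> conjc (M t o0 o0) * M t o2 o2 = 1.
  move=> Ut; have := MU o0 o2 t Ut; have [-> ->] := Mc0 t Ut.
  rewrite conjc0 !mxE /= complexiE => H.
  transitivity (- 'i%R * ('i%R * conjc (M t o0 o0) * M t o2 o2 + 0 * M t o1 o2 - 'i%R * 0 * M t o0 o2) : C).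
    by ring: (mul_i_i R).
  by rewrite H; ring: (mul_i_i R).
have c0 t : U t -> (conjc (M t o0 o0) != 0) /\ (M t o2 o2 != 0).
  move=> Ut; have := oner_neq0 C; rewrite -(cd t Ut) mulf_eq0 negb_or.
  by move/andP.
have g0 t : U t -> M t o2 o1 = 0.
  move=> Ut; have := MU o0 o1 t Ut; have [-> ->] := Mc0 t Ut.
  rewrite conjc0 !mxE /= mul0r mulr0 mul0r subr0 addr0 => /eqP.
  by rewrite !mulf_eq0 (negbTE (c0 t Ut).1) (negbTE (neq0Ci _)) /= => /eqP.
have aC t : U t -> (a t)%:C != 0.
  move=> Ut; have [a0 _ _] := HF t Ut.
  by rewrite -(rmorph0 (real_complex R)) (inj_eq (@complexI R)) gt_eqF.
have aC' t : U t -> (a' t)%:C != 0.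
  move=> Ut; have [a0 _ _] := HG t Ut.
  by rewrite -(rmorph0 (real_complex R)) (inj_eq (@complexI R)) gt_eqF.
(* Entry (1, 0) of the gauge law: [M_10] vanishes identically, hence so does its derivative, and
   [a M_12] alone would have to balance it through the zero of [P] in that place. *)
have f0 t : U t -> M t o1 o2 = 0.
  move=> Ut; have [a0 _ _] := HF t Ut; have [a0' _ _] := HG t Ut.
  have /matrixP/(_ o1 o0) := E t Ut; have [M1 M2] := Mc0 t Ut.
  rewrite !mxE !sum_ord3 !mxE /= (cderive_eq0 (fun s Us => (Mc0 s Us).1) Ut).
  rewrite M1 M2 !mulr0 !mul0r !addr0 !add0r => /eqP.
  by rewrite mulf_eq0 (negbTE (aC' t Ut)) orbF => /eqP.
have p0 t : U t -> M t o0 o1 = 0.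
  move=> Ut; have := MU o1 o2 t Ut; rewrite g0 // f0 // conjc0 !mxE /=.
  rewrite !mulr0 mul0r addr0 subr0 => /eqP.
  rewrite !mulf_eq0 conjc_eq0 (negbTE (c0 t Ut).2) (negbTE (neq0Ci _)) orbF /=.
  by move/eqP.
have e1 t : U t -> conjc (M t o1 o1) * M t o1 o1 = 1.
  move=> Ut; have := MU o1 o1 t Ut; rewrite g0 // conjc0 !mxE /=.
  by rewrite !mulr0 mul0r add0r subr0.
have aa t : U t -> (a' t)%:C * M t o2 o2 = (a t)%:C * M t o0 o0.
  move=> Ut; have /matrixP/(_ o2 o0) := E t Ut; have [M1 M2] := Mc0 t Ut.
  rewrite !mxE !sum_ord3 !mxE /= (cderive_eq0 (fun s Us => (Mc0 s Us).2) Ut).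
  by rewrite g0 // M1 M2 !mulr0 !mul0r !addr0 !add0r mulrC.
have ea t : U t -> M t o1 o1 * (a' t)%:C = (a t)%:C * M t o2 o2.
  move=> Ut; have /matrixP/(_ o1 o2) := E t Ut; have [M1 M2] := Mc0 t Ut.
  rewrite !mxE !sum_ord3 !mxE /= (cderive_eq0 f0 Ut).
  by rewrite f0 // M1 !mulr0 !mul0r !addr0 !add0r.
(* With [n = |M_00|^2], entry (2, 0) gives [a' = a n] and entry (1, 2) gives [a'^2 n = a^2].
   Together [n^3 = 1], and [n] is positive. *)
have cc t : U t -> conjc (M t o0 o0) * M t o0 o0 = 1 /\ a' t = a t.
  move=> Ut; have [a0 _ _] := HF t Ut; have [a0' _ _] := HG t Ut.
  have h1 : (a' t)%:C = (a t)%:C * (conjc (M t o0 o0) * M t o0 o0).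
    by rewrite -[LHS]mulr1 -(cd t Ut) mulrCA aa // mulrCA.
  move: h1; rewrite conjc_mulE; set n := _ + _ => h1.
  have {}h1 : a' t = a t * n by apply: complexI; rewrite real_complexM.
  have n0 : 0 < n by rewrite -(pmulr_rgt0 _ a0) -h1.
  have h2 : (a' t)%:C ^+ 2 * n%:C = (a t)%:C ^+ 2.
    rewrite -[RHS]mulr1 -[X in _ = _ * X](mulr1 1) -{1}conjc1 -(cd t Ut) !conjcE.
    rewrite /n -conjc_mulE.
    transitivity (conjc (M t o1 o1 * (a' t)%:C) * (M t o1 o1 * (a' t)%:C) * (conjc (M t o0 o0) * M t o0 o0)).
      rewrite conjcM conjc_real -[LHS]mul1r -(e1 t Ut); ring.
    rewrite ea // conjcM conjc_real; ring.
  have {}h2 : a' t ^+ 2 * n = a t ^+ 2.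
    by apply: complexI; rewrite real_complexM !real_complexX.
  have h3 : n ^+ 3 = 1.
    have A0 : a t ^+ 2 != 0 by rewrite expf_neq0 // gt_eqF.
    by apply: (mulfI A0); rewrite mulr1 -[RHS]h2 h1; ring.
  have n1 : n = 1 by apply/eqP; rewrite -(@pexpr_eq1 _ n 3) ?h3 // ltW.
  by rewrite n1 h1 n1 mulr1.
have dc t : U t -> M t o2 o2 = M t o0 o0.
  move=> Ut; have [C1 _] := cc t Ut; have [Cn _] := c0 t Ut.
  by apply: (mulfI Cn); rewrite cd // C1.
have ec t : U t -> M t o1 o1 = M t o0 o0.
  move=> Ut; have [_ A] := cc t Ut; have [a0 _ _] := HF t Ut.
  by apply: (mulIf (aC t Ut)); rewrite -{1}A ea // dc // mulrC.
(* Entries (0, 0) and (2, 2) of the gauge law have the same derivative term, as [M_00 = M_22], and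
   [P] repeats its corner entry on the diagonal. Their difference is [2 a M_02 = 0]. *)
have m0 t : U t -> M t o0 o2 = 0.
  move=> Ut; have [C1 A] := cc t Ut; have [M1 M2] := Mc0 t Ut.
  have /matrixP/(_ o0 o0) := E t Ut; have /matrixP/(_ o2 o2) := E t Ut.
  rewrite !mxE !sum_ord3 !mxE /=.
  have -> : cderive v (fun t => M t o2 o2) t = cderive v (fun t => M t o0 o0) t.
    apply: cderive_near; apply: filterS (open_nbhs_nbhs (conj oU Ut)); exact: dc.
  rewrite g0 // f0 // p0 // M1 M2 dc // A.
  move: (cderive _ _ _) ('i%R * (k t)%:C) ('i%R * (k' t)%:C) (M t o0 o0) (M t o0 o2) => D z z' c m.
  move: (aC t Ut); move: (y t) (y' t) (a t)%:C (b t)%:C (b' t)%:C => Y Y' AA B B' A0 h1 h2.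
  have : AA * (2%:R * m) = 0 :> C.
    transitivity ((c * z' + 0 * 0 + m * AA) - (0 * B' + 0 * AA + c * z') + AA * m : C); first by ring.
    by rewrite h1 h2; ring.
  by move/eqP; rewrite !mulf_eq0 (negbTE A0) pnatr_eq0 => /eqP.
move=> Ux; have [C1 A] := cc x Ux; have [M1 M2] := Mc0 x Ux.
have M0 : M x o0 o0 != 0 by rewrite -dc //; have [] := c0 x Ux.
split=> //.
  have /matrixP/(_ o0 o2) := E x Ux.
  rewrite !mxE !sum_ord3 !mxE /= (cderive_eq0 m0 Ux) m0 // f0 // p0 // dc //.
  rewrite !mulr0 !mul0r !addr0 !add0r mulrC => /(mulIf M0) H; exact: complexI.
exists (M x o0 o0); split=> //; rewrite (GE x Ux).1 -mul_mx_scalar; congr (_ *m _).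
apply/matrixP; apply: ord3P; apply: ord3P; rewrite [RHS]mxE /= ?mulr1n ?mulr0n.
all: by rewrite ?(p0 x Ux, m0 x Ux, ec x Ux, f0 x Ux, g0 x Ux, dc x Ux, M1, M2).
Qed.

End TwoFrames.
End Uniqueness.

(** * Structure equations and the Lax matrix *)

Section Schwarz.
Variables (R : realType) (V : normedModType R).
Implicit Types (f : V -> R) (U : set V).

Lemma is_derive_line f (c v : V) (s : R) : differentiable f (c + s *: v) ->
  is_derive s 1 (fun s => f (c + s *: v)) ('D_v f (c + s *: v)).
Proof.
move=> df; pose p (s : R) := c + s *: v.
have dp : is_diff s p (fun h => h *: v).
  by apply: is_diff_eq; rewrite /p; apply/funext => h /=; rewrite add0r.
have dps : differentiable p s by [].
apply: DeriveDef.
  by apply/derivable1_diffP; exact: (@differentiable_comp _ _ _ _ p f).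
rewrite deriveE; last exact: (@differentiable_comp _ _ _ _ p f).
rewrite (_ : (fun _ => _) = f \o p) // (diff_comp dps df) /= deriveE //.
have E : 'd p s 1 = v by rewrite diff_val scale1r.
by rewrite E.
Qed.

(** The mean value theorem is applied twice, once along each direction. The point is that the second
    difference on the left is symmetric in [v] and [w], while the right side is not visibly so. *)
Lemma second_difference f U (x v w : V) (h : R) : 0 < h ->
  (forall s t : R, s \in `[0, h] -> t \in `[0, h] -> U (x + s *: v + t *: w)) ->
  smooth U f -> exists s t : R, [/\ s \in `[0, h], t \in `[0, h] &
    f (x + h *: v + h *: w) - f (x + h *: v) - (f (x + h *: w) - f x) =
    'D_w ('D_v f) (x + s *: v + t *: w) * h ^+ 2].
Proof.
move=> h0 box sf.
have h00 : 0 \in `[0, h] by rewrite in_itv /= lexx ltW.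
have hh : h \in `[0, h] by rewrite in_itv /= lexx ltW.
pose g s := f (x + h *: w + s *: v) - f (x + s *: v).
have dg (s : R) : s \in `[0, h] -> is_derive s 1 g
    ('D_v f (x + h *: w + s *: v) - 'D_v f (x + s *: v)).
  move=> hs; apply: is_deriveB; apply: is_derive_line.
    by rewrite addrAC; apply: smooth_differentiable sf (box _ _ hs hh).
  by have := box _ _ hs h00; rewrite scale0r addr0; exact: smooth_differentiable sf.
pose g' (s : R) := 'D_v f (x + h *: w + s *: v) - 'D_v f (x + s *: v).
have [s hs Es] : exists2 s : R, s \in `[0, h] & g h - g 0 = g' s * (h - 0).
  have cg : {within `[0, h], continuous g}.
    by apply: derivable_within_continuous => s hs; have [] := dg s hs.
  have dg' (s : R) : s \in `]0, h[ -> is_derive s 1 g (g' s).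
    by move=> /subset_itv_oo_cc; exact: dg.
  exact: (@MVT_segment R g g' 0 h (ltW h0) dg' cg).
pose k t := 'D_v f (x + s *: v + t *: w).
have dk (t : R) : t \in `[0, h] -> is_derive t 1 k ('D_w ('D_v f) (x + s *: v + t *: w)).
  move=> ht; apply: is_derive_line.
  exact: smooth_differentiable (smooth_derive v sf) (box _ _ hs ht).
pose k' (t : R) := 'D_w ('D_v f) (x + s *: v + t *: w).
have [t ht Et] : exists2 t : R, t \in `[0, h] & k h - k 0 = k' t * (h - 0).
  have ck : {within `[0, h], continuous k}.
    by apply: derivable_within_continuous => t ht; have [] := dk t ht.
  have dk' (t : R) : t \in `]0, h[ -> is_derive t 1 k (k' t).
    by move=> /subset_itv_oo_cc; exact: dk.
  exact: (@MVT_segment R k k' 0 h (ltW h0) dk' ck).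
exists s, t; split=> //.
move: Es Et; rewrite /g /k /g' /k' !subr0 !scale0r !addr0 => Es Et.
rewrite expr2 mulrA -Et -[x + s *: v + h *: w]addrAC -Es.
by rewrite -[x + h *: v + h *: w]addrAC; ring.
Qed.

Lemma derive_comm f U (x v w : V) : open U -> U x -> smooth U f ->
  'D_w ('D_v f) x = 'D_v ('D_w f) x.
Proof.
move=> oU Ux sf.
have [A AE cA] : exists2 A : V -> R, A = 'D_w ('D_v f) & {for x, continuous A}.
  exists ('D_w ('D_v f)); first reflexivity.
  exact: smooth_continuous (smooth_derive w (smooth_derive v sf)) Ux.
have [B BE cB] : exists2 B : V -> R, B = 'D_v ('D_w f) & {for x, continuous B}.
  exists ('D_v ('D_w f)); first reflexivity.
  exact: smooth_continuous (smooth_derive v (smooth_derive w sf)) Ux.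
suff : A x = B x by rewrite AE BE.
apply/eqP; apply: contraT => AB.
pose e : R := `|A x - B x| / 2.
have e0 : 0 < e by rewrite divr_gt0 // normr_gt0 subr_eq0.
have nU : \forall y \near x, U y by exact: open_nbhs_nbhs.
have nA : \forall y \near x, `|A x - A y| < e.
  by move/cvgrPdist_lt : cA => /(_ e e0).
have nB : \forall y \near x, `|B x - B y| < e.
  by move/cvgrPdist_lt : cB => /(_ e e0).
have : \forall y \near x, [/\ U y, `|A x - A y| < e & `|B x - B y| < e].
  by apply: filterS3 nU nA nB => y ? ? ?; split.
move=> /nbhs_ballP[r /= r0 rN].
(* Small enough for the parallelogram to stay in the ball of radius [r]; the summand 1 covers the
   case where [v] and [w] both vanish. *)
pose h := r / (`|v| + `|w| + 1).
have vw0 : 0 < `|v| + `|w| + 1 by rewrite ltr_wpDl // addr_ge0.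
have h0 : 0 < h by rewrite divr_gt0.
have box (s t : R) : s \in `[0, h] -> t \in `[0, h] -> ball x r (x + s *: v + t *: w).
  rewrite !in_itv /= => /andP[s0 sh] /andP[t0 th].
  rewrite -ball_normE /ball_ /= -addrA opprD addrA subrr sub0r normrN.
  apply: (le_lt_trans (ler_normD _ _)); rewrite !normrZ !ger0_norm //.
  apply: (@le_lt_trans _ _ (h * (`|v| + `|w|))).
    by rewrite mulrDr lerD // ler_wpM2r.
  by rewrite /h mulrAC ltr_pdivrMr // ltr_pM2l // ltrDl.
have box' (t s : R) : t \in `[0, h] -> s \in `[0, h] -> ball x r (x + t *: w + s *: v).
  by move=> ht' hs'; rewrite addrAC; exact: box.
have [s [t [hs ht E1]]] : exists s t : R, [/\ s \in `[0, h], t \in `[0, h] &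
    f (x + h *: v + h *: w) - f (x + h *: v) - (f (x + h *: w) - f x) =
    A (x + s *: v + t *: w) * h ^+ 2].
  rewrite AE; apply: (@second_difference f U) => // s t hs ht.
  by have [] := rN _ (box s t hs ht).
have [t' [s' [ht' hs' E2]]] : exists t s : R, [/\ t \in `[0, h], s \in `[0, h] &
    f (x + h *: w + h *: v) - f (x + h *: w) - (f (x + h *: v) - f x) =
    B (x + t *: w + s *: v) * h ^+ 2].
  rewrite BE; apply: (@second_difference f U) => // s' t' hs' ht'.
  by have [] := rN _ (box' s' t' hs' ht').
have E : A (x + s *: v + t *: w) = B (x + t' *: w + s' *: v).
  have hh : h ^+ 2 != 0 by rewrite expf_neq0 // gt_eqF.
  apply: (mulIf hh); rewrite -E1 -E2 [x + h *: w + h *: v]addrAC; ring.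
have [_ H1 _] := rN _ (box s t hs ht); have [_ _ H2] := rN _ (box' t' s' ht' hs').
have : `|A x - B x| < e + e.
  rewrite -(subrKA (A (x + s *: v + t *: w))) {2}E.
  by apply: (le_lt_trans (ler_normD _ _)); rewrite ltrD // distrC.
by rewrite /e -splitr ltxx.
Unshelve. all: end_near. Qed.

End Schwarz.

Lemma cderive_comm (R : realType) (V : normedModType R) (U : set V)
    (f : V -> R[i]) (x v w : V) : open U -> U x -> csmooth U f ->
  cderive w (cderive v f) x = cderive v (cderive w f) x.
Proof.
move=> oU Ux [sr si]; have Er := derive_comm v w oU Ux sr.
have Ei := derive_comm v w oU Ux si; exact: (f_equal2 (@Complex R) Er Ei).
Qed.

Lemma mxD_comm (R : realType) (V : normedModType R) (U : set V) m n
    (F : V -> 'M[R[i]]_(m, n)) (x v w : V) : open U -> U x -> mxsmooth U F ->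
  mxD w (mxD v F) x = mxD v (mxD w F) x.
Proof.
move=> oU Ux sF; apply/matrixP=> i j.
have E (u : V) G : (fun y => mxD u G y i j) = cderive u (fun y => G y i j).
  by apply/funext => y; exact: mxE.
have L u (G : V -> 'M[R[i]]_(m, n)) : mxD u G x i j = cderive u (fun y => G y i j) x.
  exact: mxE.
apply: (etrans (L w (mxD v F))); apply: (etrans _ (esym (L v (mxD w F)))).
have := cderive_comm v w oU Ux (sF i j); rewrite -(E v F) -(E w F); exact: id.
Qed.

(** * The compatibility condition of a two-parameter frame *)

Section Structure.
Variables (R : realType) (V : normedModType R) (v1 v2 : V) (U : set V).
Hypothesis oU : open U.
Local Notation C := R[i].

Definition Lform (t al be : C) : 'M[C]_3 :=
  mx33 [:: [:: 0; al; 2%:R * 'i%R * t]; [:: t; 0; be];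
           [:: 3%:R * 'i%R; - ('i%R * t); 0]].

Lemma mxtr3 (A : 'M[C]_3) : \tr A = A o0 o0 + A o1 o1 + A o2 o2.
Proof. by rewrite /mxtrace sum_ord3. Qed.

(** [al] and [be] meet zeros of the second matrix, and the terms in [t] are
    [2 i t a - i t a - i t a = 0]. All entries are arbitrary complex numbers, so the identity also
    applies to derivatives of such matrices. *)
Lemma tr_Lform_Pmx t al be z y a b :
  \tr (Lform t al be *m Pmx z y a b) = 3%:R * 'i%R * b.
Proof.
rewrite mxtr3 !mxE !sum_ord3 !mxE /=; ring: (mul_i_i R).
Qed.

Lemma mxsmooth_mx33 (a b c d e f g h i : V -> C) :
  csmooth U a -> csmooth U b -> csmooth U c ->
  csmooth U d -> csmooth U e -> csmooth U f ->
  csmooth U g -> csmooth U h -> csmooth U i ->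
  mxsmooth U (fun x => mx33 [:: [:: a x; b x; c x]; [:: d x; e x; f x];
                              [:: g x; h x; i x]]).
Proof.
move=> *; apply: ord3P; apply: ord3P; rewrite -/(csmooth _ _);
by under eq_fun do rewrite mxE /=.
Qed.

Lemma mxD_mx33 v (a b c d e f g h i : V -> C) x :
  mxD v (fun x => mx33 [:: [:: a x; b x; c x]; [:: d x; e x; f x];
                         [:: g x; h x; i x]]) x =
  mx33 [:: [:: cderive v a x; cderive v b x; cderive v c x];
           [:: cderive v d x; cderive v e x; cderive v f x];
           [:: cderive v g x; cderive v h x; cderive v i x]].
Proof.
apply/matrixP; apply: ord3P; apply: ord3P; rewrite [LHS]mxE [RHS]mxE /=;
by under [X in cderive v X]eq_fun do rewrite mxE /=.
Qed.

Variables (F : V -> 'M[C]_3) (k : V -> R) (y : V -> C) (a b : V -> R).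
Hypothesis AF : adapted v1 U F k y a b.

Let P x := Pmx ('i%R * (k x)%:C) (y x) (a x)%:C (b x)%:C.
Let Q x := uinv (F x) *m mxD v2 F x.

Let sF : mxsmooth U F. Proof. by case: AF. Qed.

Lemma mxsmooth_uinv : mxsmooth U (fun x => uinv (F x)).
Proof.
apply: mxsmoothM => //; last exact: mxsmooth_cst.
by apply: mxsmoothM => //; [exact: mxsmooth_cst|exact: mxsmooth_conjT].
Qed.

Lemma mxsmooth_connection : mxsmooth U Q.
Proof. by apply: mxsmoothM => //; [exact: mxsmooth_uinv|exact: mxsmooth_D]. Qed.

Let sik : csmooth U (fun x => 'i%R * (k x)%:C).
Proof.
by case: AF => _ [sk _] _ _ _; apply: csmoothM => //; [exact: csmooth_cst|exact: csmooth_real].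
Qed.
Let sbc : csmooth U (fun x => (b x)%:C).
Proof. by case: AF => _ _ _ sb _; exact: csmooth_real. Qed.
Let sac : csmooth U (fun x => (a x)%:C).
Proof. by case: AF => _ _ sa _ _; exact: csmooth_real. Qed.
Let sy : csmooth U y. Proof. by case: AF => _ [_ sy] _ _ _. Qed.

Lemma mxsmooth_Pmx : mxsmooth U P.
Proof.
have s0 := csmooth_cst U (0 : C).
apply: mxsmooth_mx33 => //.
have := csmoothM oU (csmooth_cst U (- 'i%R : C)) sac.
by under eq_fun do rewrite mulNr.
Qed.

Lemma mxD_Pmx v x : U x -> mxD v P x =
  Pmx (cderive v (fun x => 'i%R * (k x)%:C) x) (cderive v y x)
      (cderive v (fun x => (a x)%:C) x) ('D_v b x)%:C.
Proof.
move=> Ux; rewrite [LHS]mxD_mx33 /Pmx !cderive_cst cderive_real.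
congr (mx33 [:: [:: _; _; _]; [:: _; _; _]; [:: _; _; _]]).
have : cderive v (fun x => (- 'i%R : C) * (a x)%:C) x = - ('i%R * cderive v (fun x => (a x)%:C) x).
  rewrite (cderiveM v (csmooth_cst U _) sac Ux) cderive_cst mul0r add0r.
  by rewrite mulNr.
by under eq_fun do rewrite mulNr.
Qed.

Let in_U_cancel (f p q dp dq : 'M[C]_3) : in_U f ->
  f *m q *m p + f *m dp = f *m p *m q + f *m dq -> dp = dq + p *m q - q *m p.
Proof.
move=> Uf; have K (X : 'M[C]_3) : uinv f *m (f *m X) = X.
  by rewrite mulmxA (uinvl Uf) mul1mx.
rewrite -!mulmxA -!mulmxDr => /(congr1 (mulmx (uinv f))).
by rewrite !K [dq + _]addrC => <-; rewrite addrC addKr.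
Qed.

(** Cross-differentiating [D_v1 F = F P] and [D_v2 F = F Q], the mixed derivatives of [F] agree, and
    [F] cancels. *)
Lemma structure_equation x : U x ->
  mxD v2 P x = mxD v1 Q x + P x *m Q x - Q x *m P x.
Proof.
move=> Ux; have [_ _ _ _ HF] := AF.
have UF t : U t -> in_U (F t) by case/HF.
have E1 : {in U, mxD v1 F =1 (fun x => F x *m P x)} by move=> t /set_mem /HF[].
have E2 : {in U, mxD v2 F =1 (fun x => F x *m Q x)}.
  by move=> t /set_mem Ut; rewrite /Q mulmxA (uinvr (UF t Ut)) mul1mx.
have := mxD_comm v1 v2 oU Ux sF.
rewrite (mxD_near oU v2 Ux E1) (mxD_near oU v1 Ux E2).
rewrite (mxD_mul oU v2 Ux sF mxsmooth_Pmx) (mxD_mul oU v1 Ux sF mxsmooth_connection).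
rewrite E1 ?E2 ?inE //; exact: in_U_cancel (UF x Ux).
Qed.

Let antiherm_cancel (f q : 'M[C]_3) : in_U f ->
  conjT (f *m q) *m hmx R *m f + conjT f *m hmx R *m (f *m q) = 0 ->
  conjT q *m hmx R + hmx R *m q = 0.
Proof.
move=> Uf; rewrite conjT_mul -(mulmxA (conjT q) (conjT f)).
by rewrite -(mulmxA (conjT q) _ f) Uf (mulmxA (conjT f *m hmx R) f q) Uf.
Qed.

(** Differentiating the unitarity relation places [Q] in the Lie algebra of U(2,1). *)
Lemma connection_antiherm x : U x -> conjT (Q x) *m hmx R + hmx R *m Q x = 0.
Proof.
move=> Ux; have [_ _ _ _ HF] := AF.
have UF t : U t -> in_U (F t) by case/HF.
have E2 : mxD v2 F x = F x *m Q x.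
  by rewrite /Q mulmxA (uinvr (UF x Ux)) mul1mx.
have sC := mxsmooth_conjT oU sF; have sH := mxsmooth_cst U (hmx R).
have : mxD v2 (fun x => conjT (F x) *m hmx R *m F x) x = 0.
  rewrite -(mxD_cst v2 x (hmx R)); apply: (mxD_near oU v2 Ux) => t /set_mem Ut.
  exact: UF.
rewrite (mxD_mul oU v2 Ux (mxsmoothM oU sC sH) sF) (mxD_mul oU v2 Ux sC sH).
rewrite mxD_cst mulmx0 addr0 (mxD_conjT v2 Ux sF) E2.
exact: antiherm_cancel (UF x Ux).
Qed.

Lemma connection_entry21 x : U x -> Q x o2 o1 = 'i%R * conjc (Q x o1 o0).
Proof.
move=> Ux; have := connection_antiherm Ux; move: (Q x) => q /matrixP/(_ o0 o1).
rewrite !mxE !sum_ord3 !mxE /= complexiE => H.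
transitivity ('i%R * conjc (q o1 o0) - 'i%R * (conjc (q o0 o0) * 0 + conjc (q o1 o0) * 1 +
   conjc (q o2 o0) * 0 + (0 * q o0 o1 + 0 * q o1 o1 + 'i%R * q o2 o1))); first by ring: (mul_i_i R).
by rewrite H; ring.
Qed.

End Structure.

(** * Reduction of the Lax equation to one complex equation *)

Section LaxMatrix.
Variables (R : realType) (J : set R) (kappa tau : R -> R).
Hypotheses (oJ : open J) (sk : smooth J kappa) (st : smooth J tau).
Local Notation C := R[i].

(** This value of the entry (1, 2) of [L] is forced: entry (1, 0) of [[L, K]] equals that entry
    minus [3 i (1 - tau kappa)], and it has to match [tau']. *)
Definition lax_beta (s : R) : C :=
  ('D_1 tau s)%:C + 3%:R * 'i%R * (1 - (tau s)%:C * (kappa s)%:C).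

(* The only independent entry of [L' - [L, K]]. *)
Definition lax_defect (s : R) : C :=
  cderive (1 : R) lax_beta s - (tau s)%:C ^+ 2
  - 3%:R * 'i%R * (kappa s)%:C * lax_beta s.

Let stC : csmooth J (fun s => (tau s)%:C). Proof. exact: csmooth_real. Qed.
Let skC : csmooth J (fun s => (kappa s)%:C). Proof. exact: csmooth_real. Qed.

Lemma csmooth_lax_beta : csmooth J lax_beta.
Proof.
apply: csmoothD => //; first by apply: csmooth_real; exact: smooth_derive.
apply: csmoothM => //; first exact: csmooth_cst.
by apply: csmoothB => //; [exact: csmooth_cst|exact: csmoothM].
Qed.

Lemma csmooth_lax_defect : csmooth J lax_defect.
Proof.
apply: csmoothB => //; last first.
  apply: csmoothM => //; last exact: csmooth_lax_beta.
  by apply: csmoothM => //; exact: csmooth_cst.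
apply: csmoothB => //; first exact/csmooth_derive/csmooth_lax_beta.
by under eq_fun do rewrite expr2; exact: csmoothM.
Qed.

(** This form displays that [L] is self-adjoint for the Hermitian form. [K] is anti-self-adjoint, so
    [L' - [L, K]] is self-adjoint as well, which is why its surviving entries come as the pair [w]
    and [i conj w]. *)
Lemma LmxE s : Lmx kappa tau s =
  Lform (tau s)%:C ('i%R * conjc (lax_beta s)) (lax_beta s).
Proof.
rewrite /Lmx /Lform /lax_beta derive1E.
have -> : conjc (('D_1 tau s)%:C + 3%:R * 'i%R * (1 - (tau s)%:C * (kappa s)%:C)) =
    ('D_1 tau s)%:C - 3%:R * 'i%R * (1 - (tau s)%:C * (kappa s)%:C) :> C.
  by rewrite !conjcE; ring.
congr (mx33 [:: [:: _; _; _]; [:: _; _; _]; [:: _; _; _]]).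
by ring: (mul_i_i R).
Qed.

Lemma mxsmooth_Lmx : mxsmooth J (Lmx kappa tau).
Proof.
have sb := csmooth_lax_beta; have s0 := csmooth_cst J (0 : C).
apply: (@mxsmooth_eq _ _ _ oJ _ _ (fun s => Lform (tau s)%:C ('i%R * conjc (lax_beta s)) (lax_beta s))).
  by move=> s _; rewrite LmxE.
apply: mxsmooth_mx33 => //.
- by apply: csmoothM => //; [exact: csmooth_cst|exact: csmooth_conj].
- by apply: csmoothM => //; exact: csmooth_cst.
- exact: csmooth_cst.
- by apply: csmoothN => //; apply: csmoothM => //; exact: csmooth_cst.
Qed.

Lemma lax_equation s : J s ->
  mxderive (Lmx kappa tau) s -
    (Lmx kappa tau s *m Kmx kappa tau s - Kmx kappa tau s *m Lmx kappa tau s) =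
  mx33 [:: [:: 0; 'i%R * conjc (lax_defect s); 0]; [:: 0; 0; lax_defect s];
           [:: 0; 0; 0]].
Proof.
move=> Js; have sb := csmooth_lax_beta.
have i0 := csmooth_cst J ('i%R : C).
rewrite mxderiveE.
have -> : mxD (1 : R) (Lmx kappa tau) s =
    mx33 [:: [:: 0; 'i%R * conjc (cderive (1 : R) lax_beta s); 2%:R * 'i%R * ('D_1 tau s)%:C];
             [:: ('D_1 tau s)%:C; 0; cderive (1 : R) lax_beta s];
             [:: 0; - ('i%R * ('D_1 tau s)%:C); 0]].
  transitivity (mxD (1 : R) (fun s => Lform (tau s)%:C ('i%R * conjc (lax_beta s)) (lax_beta s)) s).
    by apply: (mxD_near oJ _ Js) => t _; rewrite LmxE.
  rewrite [LHS]mxD_mx33 !cderive_cst.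
  rewrite (cderiveM _ i0 (csmooth_conj oJ sb) Js) (cderive_conj _ sb Js).
  rewrite (cderiveM _ (csmooth_cst J (2%:R * 'i%R : C)) stC Js).
  rewrite (cderiveN _ (csmoothM oJ i0 stC) Js) (cderiveM _ i0 stC Js).
  by rewrite !cderive_cst !mul0r !add0r !cderive_real.
have E1 : complex.Re (lax_beta s) = 'D_1 tau s.
  by rewrite /lax_beta -complexiE !complexReIm /=; ring.
have E2 : lax_beta s = ('D_1 tau s)%:C + 3%:R * 'i%R * (1 - (tau s)%:C * (kappa s)%:C).
  by [].
rewrite LmxE /lax_defect; move: (cderive _ _ _) => db.
have -> : conjc (db - (tau s)%:C ^+ 2 - 3%:R * 'i%R * (kappa s)%:C * lax_beta s) =
    conjc db - (tau s)%:C ^+ 2 + 3%:R * 'i%R * (kappa s)%:C * conjc (lax_beta s).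
  by rewrite !conjcE; ring.
have -> : conjc (lax_beta s) = ('D_1 tau s)%:C - 3%:R * 'i%R * (1 - (tau s)%:C * (kappa s)%:C).
  by rewrite E2 !conjcE; ring.
rewrite E2; apply/matrixP; apply: ord3P; apply: ord3P;
  rewrite !mxE !sum_ord3 !mxE /= ?complexiE; ring: (mul_i_i R).
Qed.

End LaxMatrix.

Section Slices.
Variable R : realType.
Implicit Types (f : R * R -> R) (t u : R).

Notation e1 := ((1 : R), (0 : R)).
Notation e2 := ((0 : R), (1 : R)).

Lemma mxD_slice1 m n (F : R * R -> 'M[R[i]]_(m, n)) t u :
  mxD (1 : R) (fun t => F (t, u)) t = mxD e1 F (t, u).
Proof.
apply/matrixP=> i j; rewrite [LHS]mxE [RHS]mxE /cderive.
by rewrite -(derive_slice1 (fun p => complex.Re (F p i j))) -(derive_slice1 (fun p => complex.Im (F p i j))).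
Qed.

Lemma mxsmooth_slice1 (U : set (R * R)) m n (F : R * R -> 'M[R[i]]_(m, n)) u :
  open U -> mxsmooth U F -> mxsmooth [set t | U (t, u)] (fun t => F (t, u)).
Proof.
move=> oU sF.
exact: (mxsmooth_comp_affine (open_slice1 oU) (is_diff_slice1 u) (fun _ H => H) sF).
Qed.

Lemma csmooth_slice1 (U : set (R * R)) (f : R * R -> R[i]) u :
  open U -> csmooth U f -> csmooth [set t | U (t, u)] (fun t => f (t, u)).
Proof.
move=> oU sF.
exact: (csmooth_comp_affine (open_slice1 oU) (is_diff_slice1 u) (fun _ H => H) sF).
Qed.

Lemma adapted_slice1 (U : set (R * R)) F k y a b u : open U ->
  adapted e1 U F k y a b ->
  adapted (1 : R) [set t | U (t, u)] (fun t => F (t, u)) (fun t => k (t, u))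
    (fun t => y (t, u)) (fun t => a (t, u)) (fun t => b (t, u)).
Proof.
move=> oU [sF [sk sy] sa sb HF]; split.
- exact: mxsmooth_slice1.
- by split; [exact: smooth_slice1|exact: csmooth_slice1].
- exact: smooth_slice1.
- exact: smooth_slice1.
- by move=> t Ut; rewrite mxD_slice1; exact: HF.
Qed.

Lemma adapted_sub (V : normedModType R) (v : V) (U U' : set V) F k y a b :
  U' `<=` U -> adapted v U F k y a b -> adapted v U' F k y a b.
Proof.
move=> UU' [sF [sk sy] sa sb HF]; split.
- exact: mxsmooth_sub sF.
- by split; [exact: smooth_sub sk|exact: csmooth_sub sy].
- exact: smooth_sub sa.
- exact: smooth_sub sb.
- by move=> x /UU'; exact: HF.
Qed.

End Slices.

(** * Derivative of the pairing [Im tr (L Q)] along the curve *)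

Section FirstVariation.
Variables (R : realType) (J : set R) (kappa tau : R -> R) (F0 : R -> 'M[R[i]]_3).
Hypotheses (oJ : open J) (sk : smooth J kappa) (st : smooth J tau).
Hypothesis sF0 : mxsmooth J F0.
Hypothesis HF0 : forall t, J t ->
  in_U (F0 t) /\ mxD (1 : R) F0 t = F0 t *m Kmx kappa tau t.
Local Notation C := R[i].
Local Notation e1 := ((1 : R), (0 : R)).
Local Notation e2 := ((0 : R), (1 : R)).

Lemma adapted_natural : adapted (1 : R) J F0 kappa
  (fun t => - (2%:R * 'i%R * (kappa t)%:C)) (fun=> 1) tau.
Proof.
split=> //; [split=> //|exact: smooth_cst|].
  apply: csmoothN => //; apply: csmoothM => //; first exact: csmooth_cst.
  exact: csmooth_real.
by move=> t Jt; have [UF DF] := HF0 Jt; split=> //; rewrite DF KmxE.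
Qed.

Variables (U : set (R * R)) (F : R * R -> 'M[C]_3).
Variables (k : R * R -> R) (y : R * R -> C) (a b : R * R -> R).
Hypotheses (oU : open U) (AF : adapted e1 U F k y a b).
Hypothesis UJ : forall t, U (t, 0) -> J t.
Hypothesis FF0 : forall t, U (t, 0) -> exists c, col 0 (F (t, 0)) = c *: col 0 (F0 t).

Definition variation_mx (F : R * R -> 'M[C]_3) (t : R) :=
  uinv (F (t, 0)) *m mxD e2 F (t, 0).

Definition lax_pairing (F : R * R -> 'M[C]_3) (t : R) : R :=
  complex.Im (\tr (Lmx kappa tau t *m variation_mx F t)).

Let T := [set t | U (t, 0)].
Let oT : open T. Proof. exact: open_slice1. Qed.
Let AS := adapted_slice1 0 oU AF.
Let A0 : adapted (1 : R) T F0 kappa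
  (fun t => - (2%:R * 'i%R * (kappa t)%:C)) (fun=> 1) tau.
Proof. by apply: adapted_sub adapted_natural. Qed.

Lemma natural_slice t : T t -> [/\ a (t, 0) = 1, b (t, 0) = tau t &
  exists c, conjc c * c = 1 /\ F (t, 0) = c *: F0 t].
Proof. exact: (adapted_unique oT A0 AS FF0). Qed.

(** At [u = 0] the frame is a phase [c] times the Wilczynski frame, and multiplying by [c] changes
    the logarithmic derivative only by a scalar. *)
Lemma natural_slice_Pmx t : T t -> exists l : C,
  Pmx ('i%R * (k (t, 0))%:C) (y (t, 0)) (a (t, 0))%:C (b (t, 0))%:C =
  Kmx kappa tau t + l%:M.
Proof.
move=> Tt; have [sFs _ _ _ HFs] := AS; have [sF0s _ _ _ HF0s] := A0.
have [M sM ME] := frame_change oT sF0s sFs (fun t Tt => let: And3 _ H _ := HF0s t Tt in H)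
  (fun t Tt => let: And3 _ H _ := HFs t Tt in H).
have Mc s : T s -> M s = (M s o0 o0)%:M /\ conjc (M s o0 o0) * M s o0 o0 = 1.
  move=> Ts; have [_ _ [c [cc Ec]]] := natural_slice Ts.
  have [_ U0 _] := HF0s s Ts.
  have -> : M s = c%:M.
    have := (ME s Ts).1; rewrite Ec -mul_mx_scalar => /(congr1 (mulmx (uinv (F0 s)))).
    by rewrite !mulmxA (uinvl U0) !mul1mx => ->.
  by rewrite mxE mulr1n.
have [_ U1 D1] := HFs t Tt; have [_ U0 D0] := HF0s t Tt.
pose c s := M s o0 o0; have sc : csmooth T c by exact: sM.
(* The logarithmic derivative of the phase, as [conj c] is the inverse of [c]. *)
exists (conjc (c t) * cderive (1 : R) c t).
have [Mt cc] := Mc t Tt.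
have Fc : F (t, 0) = c t *: F0 t by rewrite (ME t Tt).1 Mt mul_mx_scalar.
have : mxD (1 : R) (fun t => F (t, 0)) t = mxD (1 : R) (fun s => c s *: F0 s) t.
  apply: (mxD_near oT _ Tt) => s /set_mem Ts.
  by rewrite (ME s Ts).1 {1}(Mc s Ts).1 mul_mx_scalar.
rewrite (mxD_scale _ Tt sc sF0s) D1 D0 -KmxE => E.
move: (congr1 (mulmx (uinv (F (t, 0)))) E).
have -> : cderive (1 : R) c t *: F0 t + c t *: (F0 t *m Kmx kappa tau t) =
    F (t, 0) *m (Kmx kappa tau t + (conjc (c t) * cderive (1 : R) c t)%:M).
  rewrite Fc mulmxDr -!scalemxAl mul_mx_scalar scalerA mulrA [c t * _]mulrC cc mul1r.
  by rewrite addrC.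
by rewrite !mulmxA (uinvl U1) !mul1mx.
Qed.

(** The trace is [i conj w Q_10 + w Q_21]. By the hypothesis on [Q_21] the two products are [i]
    times conjugate numbers. *)
Lemma tr_lax_defect w (Q : 'M[C]_3) : Q o2 o1 = 'i%R * conjc (Q o1 o0) ->
  complex.Im (\tr (mx33 [:: [:: 0; 'i%R * conjc w; 0]; [:: 0; 0; w]; [:: 0; 0; 0]] *m Q)) =
  2%:R * complex.Re (conjc w * Q o1 o0).
Proof.
move=> Q21; rewrite mxtr3 !mxE !sum_ord3 !mxE /= Q21 -complexiE.
by case: w => w1 w2; case: (Q o1 o0) => q1 q2; rewrite !complexReIm /=; ring.
Qed.

(** The scalar part commutes with [q] and drops out; cyclicity of the trace moves the commutator
    from [q] to [L]. *)
Lemma trace_lax (L K DL q Dq DP : 'M[C]_3) l :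
  DP = Dq + (K + l%:M) *m q - q *m (K + l%:M) ->
  \tr (DL *m q + L *m Dq) =
  \tr (L *m DP) + \tr ((DL - (L *m K - K *m L)) *m q).
Proof.
move=> E; have -> : Dq = DP - K *m q + q *m K.
  rewrite E mulmxDl mulmxDr mul_scalar_mx mul_mx_scalar.
  move: (K *m q) (q *m K) => A B; apply/matrixP => i j; rewrite !mxE; ring.
rewrite !mulmxBl mulmxDr mulmxBr -!mulmxA !mxtraceD.
rewrite (mxtrace_mulC L (q *m K)) -mulmxA (mxtrace_mulC q (K *m L)).
rewrite opprB mxtraceD -!mulmxA.
by move: (\tr _) (\tr _) (\tr _) (\tr _) => *; ring.
Qed.

Lemma is_derive_lax_pairing t : T t -> is_derive t 1 (lax_pairing F)
  (3%:R * 'D_e2 b (t, 0)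
   + 2%:R * complex.Re (conjc (lax_defect kappa tau t) * variation_mx F t o1 o0)).
Proof.
move=> Tt; have Jt := UJ Tt.
pose Q p := uinv (F p) *m mxD e2 F p.
have sQ : mxsmooth U Q by exact: (mxsmooth_connection e2 oU AF).
have sQs : mxsmooth T (fun t => Q (t, 0)) by exact: mxsmooth_slice1.
have sL : mxsmooth T (Lmx kappa tau).
  by apply: mxsmooth_sub (mxsmooth_Lmx oJ sk st).
have sLQ := mxsmoothM oT sL sQs.
pose X s := \tr (Lmx kappa tau s *m Q (s, 0)).
have sX : csmooth T X.
  rewrite /X /mxtrace; apply: csmooth_sum => // i; exact: (sLQ i i).
have XE : cderive (1 : R) X t = 3%:R * 'i%R * ('D_e2 b (t, 0))%:C +
    \tr ((mxderive (Lmx kappa tau) t -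
    (Lmx kappa tau t *m Kmx kappa tau t - Kmx kappa tau t *m Lmx kappa tau t)) *m Q (t, 0)).
  have -> : cderive (1 : R) X t = \tr (mxD (1 : R) (fun s => Lmx kappa tau s *m Q (s, 0)) t).
    pose f i s := (Lmx kappa tau s *m Q (s, 0)) i i.
    have := @cderive_sum _ _ T _ (index_enum 'I_3) xpredT f 1 t oT (fun i => sLQ i i) Tt.
    move=> E; apply: (etrans E); apply: eq_bigr => i _; rewrite mxE; exact: erefl.
  rewrite (mxD_mul oT _ Tt sL sQs) mxD_slice1 -/Q mxderiveE.
  (* [P_u] has again the shape of [P], with derivatives as entries, so the trace identity turns
     [tr (L P_u)] into [3 i b_u]. *)
  have := structure_equation e2 oU AF Tt; rewrite -/Q (mxD_Pmx AF _ Tt).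
  have [l ->] := natural_slice_Pmx Tt => /trace_lax ->.
  by rewrite {1}LmxE tr_Lform_Pmx.
move: XE; rewrite (lax_equation oJ sk st Jt) => XE.
have [sXr sXi] := sX.
have -> : lax_pairing F = (fun s => complex.Im (X s)) by [].
apply: DeriveDef; first exact: smooth_derivable sXi Tt.
have -> : 'D_1 (fun s => complex.Im (X s)) t = complex.Im (cderive (1 : R) X t) by [].
rewrite XE complexIm_add tr_lax_defect; last exact: (connection_entry21 e2 oU AF Tt).
congr (_ + _); rewrite -complexiE !complexReIm /=; ring.
Qed.

End FirstVariation.

(** * Strain and twist in adapted frames *)

Section Lines.
Variable R : realType.
Local Notation C := R[i].
Implicit Types z w : 'cV[C]_3.

Lemma sqnorm_gt0 z : z != 0 -> 0 < (conjT z *m z) 0 0.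
Proof.
move=> z0; rewrite mxE sum_ord3 !mxE !conjc_mulE -!rmorphD /= ltcR.
have S i : 0 <= complex.Re (z i 0) ^+ 2 + complex.Im (z i 0) ^+ 2.
  by rewrite addr_ge0 ?sqr_ge0.
have P i : z i 0 != 0 -> 0 < complex.Re (z i 0) ^+ 2 + complex.Im (z i 0) ^+ 2.
  exact: complex_sqnorm_gt0.
have [E0|/P H] := eqVneq (z o0 0) 0; last by rewrite -addrA ltr_wpDr // addr_ge0.
have [E1|/P H] := eqVneq (z o1 0) 0; last by rewrite ltr_wpDr // ltr_wpDl.
have [E2|/P H] := eqVneq (z o2 0) 0; last by rewrite ltr_wpDl // addr_ge0.
by move: z0; rewrite (_ : z = 0) ?eqxx //; apply: cV3P; rewrite ?mxE.
Qed.

Lemma eq_lineP z w : (<[z]> = <[w]>)%VS -> exists c, z = c *: w.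
Proof. by move=> E; apply/vlineP; rewrite -E memv_line. Qed.

Lemma line_scale (c : C) z : c != 0 -> (<[c *: z]> = <[z]>)%VS.
Proof.
move=> c0; apply/eqP; rewrite eqEsubv -!memvE.
apply/andP; split; first by rewrite memvZ // memv_line.
by rewrite -[X in X \in _](scalerK c0 z) memvZ // memv_line.
Qed.

(** The factor is smooth because it is the projection coefficient for the positive definite
    Hermitian product, a quotient of smooth functions with nowhere zero denominator. *)
Lemma proportional_lifts (V : normedModType R) (U : set V) (Z Y : V -> 'cV[C]_3) :
  open U -> mxsmooth U Z -> mxsmooth U Y ->
  (forall x, U x -> [/\ Z x != 0, Y x != 0 & (<[Z x]> = <[Y x]>)%VS]) ->
  exists2 c, csmooth U c & forall x, U x -> c x != 0 /\ Z x = c x *: Y x.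
Proof.
move=> oU sZ sY H.
have n0 x : U x -> (conjT (Y x) *m Y x) 0 0 != 0.
  by move=> /H[_ Y0 _]; rewrite gt_eqF // sqnorm_gt0.
exists (fun x => (conjT (Y x) *m Z x) 0 0 * ((conjT (Y x) *m Y x) 0 0)^-1).
  apply: csmoothM => //; first exact: (mxsmoothM oU (mxsmooth_conjT oU sY) sZ 0 0).
  apply: csmoothV => //; exact: (mxsmoothM oU (mxsmooth_conjT oU sY) sY 0 0).
move=> x Ux; have [Z0 Y0 /eq_lineP[c E]] := H x Ux.
have -> : (conjT (Y x) *m Z x) 0 0 / (conjT (Y x) *m Y x) 0 0 = c.
  by rewrite E -scalemxAr mxE mulfK // n0.
by split=> //; apply: contraNneq Z0 => c0; rewrite E c0 scale0r.
Qed.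

Lemma in_U_unit (F : 'M[C]_3) : in_U F -> F \in unitmx.
Proof. by move=> /uinvr/mulmx1_unit[]. Qed.

Lemma in_U_col_neq0 (F : 'M[C]_3) j : in_U F -> col j F != 0.
Proof.
move=> UF; apply/eqP => E; have := uinvl UF => /(congr1 (col j)).
rewrite col_mulmx E mulmx0 => /matrixP/(_ j 0); rewrite !mxE eqxx => /eqP.
by rewrite eq_sym oner_eq0.
Qed.

Lemma in_U_herm (F : 'M[C]_3) i j : in_U F -> herm (col i F) (col j F) = hmx R i j.
Proof. by move=> <-; rewrite gramE. Qed.

End Lines.

Section TwistDensity.
Variable R : realType.
Local Notation C := R[i].

Lemma col0_mul_Pmx (F : 'M[C]_3) z y a b :
  col o0 (F *m Pmx z y a b) = z *: col o0 F + a *: col o2 F.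
Proof. by apply/matrixP=> i j; rewrite !mxE sum_ord3 !mxE /=; ring. Qed.

Lemma col2_mul_Pmx (F : 'M[C]_3) z y a b :
  col o2 (F *m Pmx z y a b) = b *: col o0 F + a *: col o1 F + z *: col o2 F.
Proof. by apply/matrixP=> i j; rewrite !mxE sum_ord3 !mxE /=; ring. Qed.

Lemma oscD_near (V : normedModType R) (v : V) (U : set V) (G H : V -> 'cV[C]_3) x :
  open U -> U x -> {in U, G =1 H} -> oscD v G x = oscD v H x.
Proof.
move=> oU Ux GH.
have E : mxD v (mxD v G) x = mxD v (mxD v H) x.
  by apply: (mxD_near oU v Ux) => t /set_mem Ut; exact: (mxD_near oU v Ut GH).
by rewrite /oscD (GH x (mem_set Ux)) (mxD_near oU v Ux GH) E.
Qed.

Section AdaptedLift.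
Variables (V : normedModType R) (v : V) (U : set V).
Variables (F : V -> 'M[C]_3) (k : V -> R) (y : V -> C) (a b : V -> R).
Hypotheses (oU : open U) (AF : adapted v U F k y a b).

Lemma adapted_cols x : U x ->
  mxD v (fun x => col o0 (F x)) x = ('i%R * (k x)%:C) *: col o0 (F x) + (a x)%:C *: col o2 (F x) /\
  mxD v (fun x => col o2 (F x)) x = (b x)%:C *: col o0 (F x) + (a x)%:C *: col o1 (F x)
     + ('i%R * (k x)%:C) *: col o2 (F x).
Proof.
move=> Ux; have [_ _ _ _ /(_ x Ux)[_ _ D]] := AF; rewrite !mxD_col D.
by rewrite col0_mul_Pmx col2_mul_Pmx.
Qed.

Lemma oscD_adapted x : U x ->
  oscD v (fun x => col o0 (F x)) x = - (\det (F x) * (a x)%:C ^+ 3).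
Proof.
move=> Ux; have [sF [sk _] sa sb _] := AF.
rewrite (@oscD_frame _ _ v U oU (fun x => col o0 (F x)) a _ sa k b
  (fun x => col o1 (F x)) (fun x => col o2 (F x)) sk) ?mx3_col //.
- by apply: mxsmooth_col.
- by apply: mxsmooth_col.
- by move=> t /adapted_cols[].
- by move=> t /adapted_cols[].
Qed.

Lemma herm_adapted x : U x ->
  herm (col o0 (F x)) (mxD v (fun x => col o0 (F x)) x) = 'i%R * (a x)%:C.
Proof.
move=> Ux; have [_ _ _ _ /(_ x Ux)[_ UF _]] := AF.
rewrite (adapted_cols Ux).1 hermDr !hermZr !in_U_herm // !mxE /= complexiE.
by rewrite mulr0 add0r mulrC.
Qed.

(** A Wilczynski lift is [c] times the first column of the frame. Taking moduli in [osc = -1] gives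
    [|c|^2 a^2 = 1], hence [<G, G'> = i |c|^2 a = i / a]. *)
Lemma strain_adapted (G : V -> 'cV[C]_3) (al : R) x : mxsmooth U G -> U x ->
  (forall t, U t -> G t != 0 /\ (<[G t]> = <[col o0 (F t)]>)%VS) ->
  oscD v G x = -1 -> al%:C = 'i%R * (herm (G x) (mxD v G x))^-1 -> al = a x.
Proof.
move=> sG Ux HG osc1 alE; have [sF [sk _] sa sb HF] := AF.
have sF1 := mxsmooth_col o0 sF.
have [|c sc cE] := proportional_lifts oU sG sF1.
  move=> t Ut; have [G0 GE] := HG t Ut; have [_ UF _] := HF t Ut; split=> //.
  exact: in_U_col_neq0.
have Ec : {in U, G =1 (fun t => c t *: col o0 (F t))} by move=> t /set_mem /cE[].
have oE : oscD v G x = c x ^+ 3 * oscD v (fun t => col o0 (F t)) x.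
  by rewrite (oscD_near v oU Ux Ec); exact: (oscD_scale v oU sc sF1 Ux).
have [a0 UF _] := HF x Ux.
have hE : herm (G x) (mxD v G x) = conjc (c x) * c x * ('i%R * (a x)%:C).
  rewrite (mxD_near oU v Ux Ec) (mxD_scale v Ux sc sF1) (Ec x (mem_set Ux)).
  rewrite !hermlin (herm_adapted Ux) in_U_herm // !mxE /=; ring.
move: oE; rewrite osc1 oscD_adapted // => oE.
have [] : conjc (c x) * c x = (complex.Re (c x) ^+ 2 + complex.Im (c x) ^+ 2)%:C /\ true.
  by rewrite conjc_mulE.
set n := _ + _ => nE _; rewrite nE in hE.
have n0 : 0 < n by apply: complex_sqnorm_gt0; case: (cE x Ux).
have A3 : (a x)%:C ^+ 3 = (a x ^+ 3)%:C by rewrite real_complexX.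
(* The phases of [c] and of [det F] disappear when [osc = -1] is multiplied by its conjugate. *)
have na : (n * a x ^+ 2) ^+ 3 = 1.
  apply: complexI; rewrite real_complexX real_complexM real_complexX -nE.
  transitivity (conjc (c x ^+ 3 * - (\det (F x) * (a x)%:C ^+ 3)) *
     (c x ^+ 3 * - (\det (F x) * (a x)%:C ^+ 3))).
    rewrite A3 !conjcE -A3.
    transitivity ((conjc (c x) * c x * (a x)%:C ^+ 2) ^+ 3 * (conjc (\det (F x)) * \det (F x))).
      by rewrite in_U_det // mulr1.
    by ring.
  by rewrite -oE conjcN conjc1 mulrNN mulr1.
have {}na : n * a x ^+ 2 = 1.
  apply/eqP; rewrite -(@pexpr_eq1 _ _ 3) ?na //.
  by rewrite mulr_ge0 ?sqr_ge0 // ltW.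
apply: complexI; rewrite alE hE.
have N0 : n%:C * (a x)%:C != 0.
  by rewrite -real_complexM -(rmorph0 (real_complex R)) (inj_eq (@complexI R)) gt_eqF // mulr_gt0.
have nA : n%:C * (a x)%:C * (a x)%:C = 1.
  by rewrite -mulrA -expr2 -real_complexX -real_complexM na.
have i0 : 'i%R != 0 :> C by rewrite neq0Ci.
apply: (mulfI N0); rewrite nA.
move: N0 i0; rewrite mulf_eq0 negb_or => /andP[N0 A0] i0.
by move: ('i%R) i0 n%:C N0 (a x)%:C A0 => I I0 N N0 A A0; field; rewrite N0 A0 I0.
Qed.

End AdaptedLift.

Section Reparametrization.
Variables (J I : set R) (sigma : R -> R).
Hypotheses (oJ : open J) (ss : smooth J sigma) (sI : forall t, J t -> I (sigma t)).

Lemma csmooth_reparam (f : R -> C) : csmooth I f -> csmooth J (fun t => f (sigma t)).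
Proof.
move=> [fr fi]; split.
  exact: (smooth_comp oJ sI fr ss).
exact: (smooth_comp oJ sI fi ss).
Qed.

Lemma mxsmooth_reparam m n (F : R -> 'M[C]_(m, n)) :
  mxsmooth I F -> mxsmooth J (fun t => F (sigma t)).
Proof. by move=> sF i j; exact: (csmooth_reparam (sF i j)). Qed.

Lemma cderive_reparam (f : R -> C) t : csmooth I f -> J t ->
  cderive (1 : R) (fun t => f (sigma t)) t =
  ('D_1 sigma t)%:C * cderive (1 : R) f (sigma t).
Proof.
move=> [fr fi] Jt; have ds := smooth_differentiable ss Jt.
have Er := derive_comp (1 : R) ds (smooth_derivable (v := (1 : R)) fr (sI Jt)).
have Ei := derive_comp (1 : R) ds (smooth_derivable (v := (1 : R)) fi (sI Jt)).
apply: (etrans (f_equal2 (@Complex R) Er Ei)).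
by apply/eqP; rewrite eq_complex /=; apply/andP; split; apply/eqP; ring.
Qed.

Lemma mxD_reparam m n (F : R -> 'M[C]_(m, n)) t : mxsmooth I F -> J t ->
  mxD (1 : R) (fun t => F (sigma t)) t =
  ('D_1 sigma t)%:C *: mxD (1 : R) F (sigma t).
Proof.
move=> sF Jt; apply/matrixP=> i j; rewrite [LHS]mxE [RHS]mxE [in RHS]mxE.
exact: (cderive_reparam (sF i j) Jt).
Qed.

End Reparametrization.

Lemma wilczynski_frame_D (J : set R) g kappa tau F t :
  wilczynski_frame J g kappa tau F -> J t ->
  in_U (F t) /\ mxD (1 : R) F t = F t *m Kmx kappa tau t.
Proof.
move=> [sF FG _ FK] Jt; have [_ UF] := FG t Jt; split=> //.
by rewrite -(FK t Jt) mulKVmx ?mxderiveE // in_U_unit.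
Qed.

Lemma oscD1 (G : R -> 'cV[C]_3) : osc_det G = oscD (1 : R) G.
Proof.
apply/funext => t; rewrite /osc_det (mxderiveE (mxderive G)) (mxderiveE G).
reflexivity.
Qed.

(** The Wilczynski frame of the natural reparametrization is pulled back by [sigma]. The chain rule
    multiplies [K] by [sigma'], which becomes the entry [a]. *)
Lemma twist_frame (J : set R) g tau : open J -> twist J g tau ->
  exists G k y a b, [/\ adapted (1 : R) J G k y a b,
    forall t, J t -> g t = <[col o0 (G t)]>%VS &
    forall t, J t -> b t = tau t * a t].
Proof.
move=> oJ [sigma [d [kappa0 [tau0 [[ss s0 _ _ gd] [sk0 st0 [F0 WF]] tauE]]]]].
have sI t : J t -> (sigma @` J) (sigma t) by exact: imageP.
have [sF0 FG [[_ FL] _] _] := WF.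
have ss' := smooth_derive (1 : R) ss.
have sks : smooth J (fun t => 'D_1 sigma t * kappa0 (sigma t)).
  by apply: smoothM => //; exact: (smooth_comp oJ sI sk0 ss).
exists (fun t => F0 (sigma t)), (fun t => 'D_1 sigma t * kappa0 (sigma t)),
  (fun t => - (2%:R * 'i%R * ('D_1 sigma t * kappa0 (sigma t))%:C)),
  ('D_1 sigma), (fun t => 'D_1 sigma t * tau0 (sigma t)).
split.
- split=> //; first exact: mxsmooth_reparam oJ ss sI _ _ _ sF0.
  + split=> //; apply: csmoothN => //; apply: csmoothM => //; first exact: csmooth_cst.
    exact: csmooth_real.
  + by apply: smoothM => //; exact: (smooth_comp oJ sI st0 ss).
  + move=> t Jt; have [UF DF] := wilczynski_frame_D WF (sI t Jt).
    split=> //; first by rewrite -derive1E; exact: s0.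
    rewrite (mxD_reparam ss sI sF0 Jt) DF KmxE scalemxAr; congr (_ *m _).
    rewrite /Pmx !real_complexM; apply/matrixP; apply: ord3P; apply: ord3P;
      by rewrite !mxE /=; ring.
- move=> t Jt; rewrite gd //; have [_ _] := FL _ (sI t Jt).
  by rewrite ord3_0.
- by move=> t Jt; rewrite tauE // mulrC.
Qed.

(** Strain and twist are given by separate existential data. The strain is compared through the
    scaling of lifts, the twist through uniqueness of adapted frames, so any local frame computes
    the integrand of [W] as its entry [b]. *)
Lemma twist_density (J : set R) g al tau (U : set R) F k y a b :
  open J -> strain J g al -> twist J g tau -> open U -> U `<=` J ->
  adapted (1 : R) U F k y a b ->
  (forall t, U t -> g t = <[col o0 (F t)]>%VS) ->
  forall t, U t -> [/\ al t = a t & tau t * al t = b t].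
Proof.
move=> oJ [Gam [[[sG LG] oG] alE]] Htw oU UJ AF gF t Ut.
have E1 : al t = a t.
  apply: (strain_adapted oU AF (mxsmooth_sub UJ sG) Ut).
  - move=> s Us; have [G0 _ E] := LG s (UJ s Us); split=> //.
    by rewrite -E; exact: gF.
  - by rewrite -oscD1; exact/oG/UJ.
  - by rewrite -mxderiveE; exact/alE/UJ.
split=> //; have [G [k' [y' [a' [b' [AG gG bE]]]]]] := twist_frame oJ Htw.
have AGU := adapted_sub UJ AG.
have [|aa bb _] := adapted_unique oU AGU AF _ Ut.
  move=> s Us; rewrite ord3_0; apply: eq_lineP.
  by rewrite -gF // gG //; exact: UJ.
by rewrite E1 aa bb bE //; exact: UJ.
Qed.

End TwistDensity.

(** * Real analysis *)

Section Integrals.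
Variable R : realType.
Notation mu := (@lebesgue_measure R).
Implicit Types (f F : R -> R) (a b : R).

Lemma segment_continuous_integrable f a b :
  (forall x, x \in `[a, b] -> {for x, continuous f}) ->
  mu.-integrable `[a, b] (EFin \o f).
Proof.
move=> cf; apply: continuous_compact_integrable; first exact: segment_compact.
by apply: continuous_in_subspaceT => x /set_mem; exact: cf.
Qed.

Lemma Rintegral_FTC f F a b : a <= b ->
  (forall x, x \in `[a, b] -> {for x, continuous f}) ->
  (forall x, x \in `[a, b] -> is_derive x 1 F (f x)) ->
  \int[mu]_(x in `[a, b]) f x = F b - F a.
Proof.
rewrite le_eqVlt => /predU1P[<- _ _|ab cf dF].
  by rewrite set_itv1 Rintegral_set1 subrr.
have cF x : x \in `[a, b] -> {for x, continuous F}.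
  move=> xab; apply: differentiable_continuous; apply/derivable1_diffP.
  by have [] := dF x xab.
have wf : {within `[a, b], continuous f}.
  by apply: continuous_in_subspaceT => x /set_mem; exact: cf.
have wF : {within `[a, b], continuous F}.
  by apply: continuous_in_subspaceT => x /set_mem; exact: cF.
have LR : derivable_oo_LRcontinuous F a b.
  split.
  - by move=> x /subset_itv_oo_cc xab; have [] := dF x xab.
  - by have /continuous_within_itvP -/(_ ab)[] := wF.
  - by have /continuous_within_itvP -/(_ ab)[] := wF.
rewrite /Rintegral (continuous_FTC2 ab wf LR) //.
by move=> x /subset_itv_oo_cc xab; rewrite derive1E; have [] := dF x xab.
Qed.

Variable J : set R.
Hypotheses (oJ : open J) (iJ : is_interval J).

Lemma sub_interval a b : J a -> J b -> `[a, b] `<=` J.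
Proof. by move=> Ja Jb x; rewrite /= in_itv /=; exact: iJ. Qed.

Lemma open_interval_bounds x y : J x -> J y ->
  exists c d, [/\ J c, J d, c < x, c < y & x < d /\ y < d].
Proof.
move=> Jx Jy.
have lower z : J z -> exists2 c, J c & c < z.
  move=> Jz; have /nbhs_ballP[e /= e0 eJ] : nbhs z J by exact: open_nbhs_nbhs.
  exists (z - e / 2); last by rewrite ltrBlDr ltrDl divr_gt0.
  apply: eJ; rewrite -ball_normE /ball_ /= opprB addrCA subrr addr0.
  by rewrite gtr0_norm ?divr_gt0 // ltr_pdivrMr // ltr_pMr // ltr1n.
have upper z : J z -> exists2 c, J c & z < c.
  move=> Jz; have /nbhs_ballP[e /= e0 eJ] : nbhs z J by exact: open_nbhs_nbhs.
  exists (z + e / 2); last by rewrite ltrDl divr_gt0.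
  apply: eJ; rewrite -ball_normE /ball_ /= opprD addrA subrr sub0r normrN.
  by rewrite gtr0_norm ?divr_gt0 // ltr_pdivrMr // ltr_pMr // ltr1n.
have [xy|/ltW yx] := leP x y.
  have [c Jc cx] := lower x Jx; have [d Jd yd] := upper y Jy.
  exists c, d; split=> //; first exact: lt_le_trans cx xy.
  by split=> //; exact: le_lt_trans xy yd.
have [c Jc cy] := lower y Jy; have [d Jd xd] := upper x Jx.
exists c, d; split=> //; first exact: lt_le_trans cy yx.
by split=> //; exact: le_lt_trans yx xd.
Qed.

(** Integrals over segments carry no orientation, so the primitive based at [t0] is defined by cases
    with a sign. *)
Lemma exists_primitive f : J !=set0 -> (forall x, J x -> {for x, continuous f}) ->
  exists F, forall x, J x -> is_derive x 1 F (f x).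
Proof.
move=> [t0 Jt0] cf.
pose F x := if t0 <= x then \int[mu]_(t in `[t0, x]) f t
            else - \int[mu]_(t in `[x, t0]) f t.
exists F => x Jx.
have [c [d [Jc Jd cx ct [xd td]]]] := open_interval_bounds Jx Jt0.
have cdJ := sub_interval Jc Jd.
have intf p q : c <= p -> q <= d -> mu.-integrable `[p, q] (EFin \o f).
  move=> cp qd; apply: segment_continuous_integrable => z.
  rewrite in_itv /= => /andP[pz zq]; apply/cf/cdJ.
  by rewrite /= in_itv /= (le_trans cp pz) (le_trans zq qd).
(* Near [x] the two cases merge into one formula: [c] lies to the left of both [x] and [t0], and
   [F y = G y - G t0]. *)
pose G y := \int[mu]_(t in `[c, y]) f t.
have split_int p q : c <= p -> p <= q -> q <= d ->
    G q - G p = \int[mu]_(t in `[p, q]) f t.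
  move=> cp pq qd; rewrite /G Rintegral_itvB ?bnd_simp //; last exact: intf.
  rewrite Rintegral_itv_obnd_cbnd //.
  apply: integrableS (intf p q cp qd) => //.
  by move=> z; rewrite /= !in_itv /= => /andP[/ltW -> ->].
have [dG GE] := @continuous_FTC1_closed R f c x d xd (intf c d (lexx _) (lexx _)) cx (cf x Jx).
apply: (@near_eq_is_derive _ _ _ (fun y => G y - G t0)).
  have : \forall y \near x, c < y < d.
    by apply: near_in_itvoo; rewrite in_itv /= cx xd.
  apply: filterS => y /andP[cy yd]; rewrite /F.
  have [ty|yt] := leP t0 y.
    by rewrite split_int // ltW.
  by rewrite -split_int ?opprB // ltW.
have dG' : is_derive x 1 G (f x).
  by apply: DeriveDef; [exact: dG|rewrite -derive1E; exact: GE].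
have := @is_deriveB _ _ _ G (cst (G t0)) x 1 (f x) 0 dG' (is_derive_cst _ _ _).
by rewrite subr0.
Qed.

Lemma is_derive0_constant (f : R -> R) : (forall x, J x -> is_derive x 1 f 0) ->
  forall x y, J x -> J y -> f x = f y.
Proof.
move=> df.
suff H x y : x <= y -> J x -> J y -> f x = f y.
  by move=> x y Jx Jy; have [/H|/ltW /H] := leP x y; [exact|move=> ->].
move=> xy Jx Jy; have xyJ := sub_interval Jx Jy.
have : \int[mu]_(t in `[x, y]) (cst 0 t) = f y - f x.
  apply: Rintegral_FTC => // t txy; first exact: cst_continuous.
  by apply/df/xyJ.
rewrite Rintegral_cst //= mul0r => /esym/eqP; rewrite subr_eq0 => /eqP //.
Qed.

Lemma pos_derive_increasing (f f' : R -> R) :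
  (forall x, J x -> is_derive x 1 f (f' x)) -> (forall x, J x -> 0 < f' x) ->
  forall x y, J x -> J y -> x < y -> f x < f y.
Proof.
move=> df f0 x y Jx Jy xy; have xyJ := sub_interval Jx Jy.
have [||c cxy] := @MVT R f f' x y xy.
- by move=> t /subset_itv_oo_cc txy; apply/df/xyJ.
- apply: derivable_within_continuous => t txy.
  by have [] := df t (xyJ t txy).
rewrite -subr_gt0 => ->; rewrite mulr_gt0 ?subr_gt0 //; apply/f0/xyJ.
exact: subset_itv_oo_cc cxy.
Qed.

End Integrals.

Section SmoothFunctions.
Variable R : realType.

Lemma Ck_sin_cos k : Ck k [set: R] (@sin R) /\ Ck k [set: R] (@cos R).
Proof.
have oT : open [set: R] by exact: openT.
elim: k => [|k [Hs Hc]].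
  by split=> x _; [exact: continuous_sin|exact: continuous_cos].
split; split=> [x _|v] /=.
- by apply/derivable1_diffP; have [] := is_derive_sin x.
- apply: Ck_eq oT _ (CkM oT (Ck_cst k _ v) Hc) => x _ /=.
  by have [d E] := is_derive_sin x; rewrite derive_real // E.
- by apply/derivable1_diffP; have [] := is_derive_cos x.
- apply: Ck_eq oT _ (CkM oT (Ck_cst k _ (- v)) Hs) => x _ /=.
  by have [d E] := is_derive_cos x; rewrite derive_real // E mulNr mulrN.
Qed.

Lemma smooth_sin : smooth [set: R] (@sin R).
Proof. by move=> k; have [] := Ck_sin_cos k. Qed.

Lemma smooth_cos : smooth [set: R] (@cos R).
Proof. by move=> k; have [] := Ck_sin_cos k. Qed.

(** * The inverse of a function with positive derivative *)

Section Inverse.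
Variables (J : set R) (s : R -> R).
Hypotheses (oJ : open J) (iJ : is_interval J) (ss : smooth J s).
Hypothesis s0 : forall x, J x -> 0 < 'D_1 s x.

Lemma smooth_inverse : exists r : R -> R,
  [/\ open (s @` J), is_interval (s @` J), smooth (s @` J) r,
      forall x, J x -> r (s x) = x &
      forall y, (s @` J) y -> [/\ J (r y), s (r y) = y & 'D_1 r y = ('D_1 s (r y))^-1]].
Proof.
have ds x : J x -> is_derive x 1 s ('D_1 s x).
  by move=> Jx; apply: DeriveDef => //; exact: smooth_derivable ss Jx.
have incr := pos_derive_increasing iJ ds s0.
have inj x y : J x -> J y -> s x = s y -> x = y.
  move=> Jx Jy E; have [xy|yx|//] := ltgtP x y.
    by have := incr _ _ Jx Jy xy; rewrite E ltxx.
  by have := incr _ _ Jy Jx yx; rewrite E ltxx.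
have [r rE] : {r : R -> R & forall y, (s @` J) y -> J (r y) /\ s (r y) = y}.
  apply: (@choice _ _ (fun y x => (s @` J) y -> J x /\ s x = y)) => y.
  have [[x Jx <-]|nJ] := pselect ((s @` J) y).
    by exists x.
  by exists 0 => /nJ.
have rK x : J x -> r (s x) = x.
  by move=> Jx; have [J1 E] := rE (s x) (imageP s Jx); exact: inj.
have near_J x : J x -> \near x, J x by move=> Jx; exact: open_nbhs_nbhs.
have nK x : J x -> {near x, cancel s r}.
  by move=> Jx; apply: filterS (near_J x Jx) => y; exact: rK.
have nC x : J x -> {near x, continuous s}.
  by move=> Jx; apply: filterS (near_J x Jx) => y Jy; exact: smooth_continuous ss Jy.
have dr x : J x -> is_derive (s x) 1 r ('D_1 s x)^-1.
  move=> Jx; apply: (is_derive_inverse (nK x Jx) (nC x Jx) (ds x Jx)).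
  by rewrite gt_eqF // s0.
have oI : open (s @` J).
  rewrite openE => _ [x Jx <-]; rewrite /interior.
  have cr : {for s x, continuous r}.
    by apply: differentiable_continuous; apply/derivable1_diffP; have [] := dr x Jx.
  have nJ : \forall y \near s x, J (r y).
    by apply: cr; rewrite rK //; exact: near_J.
  (* A continuous local left inverse is also a right inverse near [s x], so every nearby [y] is the
     value of [s] at [r y]; this gives openness of the image. *)
  have nS := near_continuous_can_sym (nC x Jx) (nK x Jx).
  by apply: filterS2 nJ nS => y Jy E; exists (r y).
have dI y : (s @` J) y -> is_derive y 1 r ('D_1 s (r y))^-1.
  by move=> Iy; have [Jr E] := rE y Iy; rewrite -{1}E; exact: dr.
exists r; split=> //.
- move=> _ _ [x1 J1 <-] [x2 J2 <-] y /andP[xy yx].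
  have [E|E12] := eqVneq (s x1) y; first by rewrite -E; exact: imageP.
  have x12 : x1 <= x2.
    rewrite leNgt; apply/negP => /(incr _ _ J2 J1).
    by rewrite ltNge (le_trans xy yx).
  have sub := sub_interval iJ J1 J2.
  have cs : {within `[x1, x2], continuous s}.
    apply: derivable_within_continuous => t /sub Jt.
    exact: smooth_derivable ss Jt.
  have [|t tx <-] := IVT x12 cs (v := y); last by apply: imageP; exact: sub.
  by rewrite min_l ?max_r ?xy ?yx // (le_trans xy).
- elim=> [|k IH].
    move=> y Iy; apply: differentiable_continuous; apply/derivable1_diffP.
    by have [] := dI y Iy.
  split=> [y Iy|v] /=; first by apply/derivable1_diffP; have [] := dI y Iy.
  (* Bootstrapping: [r' = (1 / s') \o r] is as regular as [r], so [r] gains one order. *)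
  have si : smooth J (fun x => ('D_1 s x)^-1).
    apply: (smooth_comp oJ _ (@smooth_inv R) (smooth_derive (1 : R) ss)) => x Jx /=.
    by rewrite gt_eqF // s0.
  have H := CkM oI (Ck_cst k _ v) (Ck_comp oI (fun y Iy => (rE y Iy).1) si IH).
  apply: Ck_eq oI _ H => y /set_mem Iy /=.
  by have [d <-] := dI y Iy; rewrite -derive_real.
- by move=> y Iy; have [Jr E] := rE y Iy; have [_ D] := dI y Iy; split.
Qed.

End Inverse.

(* The successive derivatives of [exp (- 1 / x)] are combinations of these. *)
Definition flat (n : nat) (x : R) : R :=
  if 0 < x then x^-1 ^+ n * expR (- x^-1) else 0.

(** With [y = 1 / x], the term of degree [n + 2] in the exponential series bounds [y^n exp (- y)] by
    [(n + 2)! / y^2]. Two powers of [x] are wanted so that the difference quotient at 0 still tends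
    to 0. *)
Lemma flat_bound n x : `|flat n x| <= n.+2`!%:R * `|x| * `|x|.
Proof.
rewrite /flat; case: ifPn => [x0|_]; last by rewrite normr0 !mulr_ge0.
have y0 : 0 < x^-1 by rewrite invr_gt0.
rewrite (gtr0_norm x0) ger0_norm; last by rewrite mulr_ge0 ?expR_ge0 ?exprn_ge0 // ltW.
rewrite expRN ler_pdivrMr ?expR_gt0 //.
have E : x^-1 ^+ n = n.+2`!%:R * x * x * (x^-1 ^+ n.+2 / n.+2`!%:R).
  have x1 : x != 0 by rewrite gt_eqF.
  have f0 : n.+2`!%:R != 0 :> R by rewrite pnatr_eq0 -lt0n fact_gt0.
  rewrite !exprS; move: (n.+2)`!%:R f0 (x^-1 ^+ n) => F F0 Y.
  by field; rewrite F0 x1.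
rewrite {1}E ler_wpM2l //; first by rewrite !mulr_ge0 // ltW.
by apply: le_trans (expR_ge1Dxn n.+1 (ltW y0)); rewrite lerDr.
Qed.

Lemma is_derive_flat_pos n (y : R) :
  is_derive y 1 (fun y => y ^+ n * expR (- y))
    (n%:R * y ^+ n.-1 * expR (- y) - y ^+ n * expR (- y)).
Proof.
have d1 : is_derive y 1 (fun y => y ^+ n) (n%:R * y ^+ n.-1).
  apply: DeriveDef; first exact: exprn_derivable.
  by rewrite exp_derive /GRing.scale /= mulr1.
have d2 : is_derive y 1 (fun y => expR (- y)) (expR (- y) * -1).
  exact: (@is_derive1_comp _ expR -%R y (expR (- y)) (-1) (is_derive_expR _) (is_deriveNid _ _)).
have d3 := is_deriveM d1 d2.
apply: (@is_derive_eq _ _ _ _ _ _ _ _ d3).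
by rewrite /GRing.scale /=; ring.
Qed.

Lemma is_derive_flat n (x : R) :
  is_derive x 1 (flat n) (flat n.+2 x - n%:R * flat n.+1 x).
Proof.
have [x0|x0|<-] := ltgtP 0 x.
- apply: (@near_eq_is_derive _ _ _ ((fun y => y ^+ n * expR (- y)) \o (fun x => x^-1))).
    have : \forall y \near x, 0 < y.
      by apply: (@open_nbhs_nbhs _ x [set y | 0 < y]); split; [exact: open_gt|].
    by apply: filterS => y y0; rewrite /flat y0.
  have dV : is_derive x 1 (fun x : R => x^-1) (- x ^- 2).
    have x1 : x != 0 by rewrite gt_eqF.
    have := @is_deriveV R id x 1 1 x1 (is_derive_id x 1).
    by rewrite /GRing.scale /= mulr1.
  have := @is_derive1_comp _ _ _ x _ _ (is_derive_flat_pos n x^-1) dV.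
  move=> D; apply: (@is_derive_eq _ _ _ _ _ _ _ _ D); rewrite /flat x0.
  have -> : x ^- 2 = x^-1 ^+ 2 by rewrite exprVn.
  move: x^-1 => y; case: n {D} => [|n] /=; first by rewrite !mul0r; ring.
  by rewrite !exprS; ring.
- apply: (@near_eq_is_derive _ _ _ (cst 0)).
    have : \forall y \near x, y < 0.
      by apply: (@open_nbhs_nbhs _ x [set y | y < 0]); split; [exact: open_lt|].
    by apply: filterS => y y0; rewrite /flat ltNge (ltW y0).
  by rewrite /flat ltNge (ltW x0) mulr0 subr0; exact: is_derive_cst.
- have F0 m : flat m 0 = 0 by rewrite /flat ltxx.
  rewrite !F0 mulr0 subr0.
  (* At the origin the difference quotient is at most [(n + 2)! |h|]. *)
  have C : h^-1 *: ((flat n \o shift 0) (h *: (1 : R)) - flat n 0) @[h --> (0 : R)^'] --> (0 : R).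
    apply/cvgrPdist_le => e e0.
    have N0 : 0 < n.+2`!%:R :> R by rewrite ltr0n fact_gt0.
    have : \forall h \near (0 : R)^', h != 0 /\ `|h| <= e / n.+2`!%:R.
      near=> h; split; first by near: h; exact: nbhs_dnbhs_neq.
      by near: h; apply: dnbhs0_le; exact: divr_gt0.
    apply: filterS => h [h0 he]; rewrite F0 subr0 sub0r normrN normrZ normfV.
    rewrite ler_pdivrMl ?normr_gt0 // /= addr0 /GRing.scale /= mulr1.
    apply: (le_trans (flat_bound n h)); rewrite mulrC ler_wpM2l //.
    by rewrite mulrC -ler_pdivlMr.
  apply: DeriveDef; first by apply/cvg_ex; exists 0.
  exact: (cvg_lim _ C).
Unshelve. all: end_near. Qed.

Lemma smooth_flat n : smooth [set: R] (flat n).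
Proof.
move=> k; have oT : open [set: R] by exact: openT.
elim: k n => [|k IH] n.
  move=> x _; apply: differentiable_continuous; apply/derivable1_diffP.
  by have [] := is_derive_flat n x.
split=> [x _|v] /=; first by apply/derivable1_diffP; have [] := is_derive_flat n x.
have H := CkD oT (IH n.+2) (CkM oT (Ck_cst k _ (- n%:R)) (IH n.+1)).
apply: Ck_eq oT _ (CkM oT (Ck_cst k _ v) H) => x _ /=.
have [d E] := is_derive_flat n x.
by rewrite mulNr -E -derive_real.
Qed.

Lemma exists_bump (a b : R) : exists phi : R -> R, [/\ smooth [set: R] phi,
  forall x, 0 <= phi x, forall x, a < x < b -> 0 < phi x &
  forall x, ~~ (a < x < b) -> phi x = 0].
Proof.
have oT : open [set: R] by exact: openT.
have dA : forall x : R, is_diff x (fun x => x - a) (fun h => h).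
  by move=> x; apply: is_diff_eq; apply/funext => h; rewrite /= subr0.
have dB : forall x : R, is_diff x (fun x => b - x) (fun h => - h).
  by move=> x; apply: is_diff_eq; apply/funext => h; rewrite /= sub0r.
have f0 x : 0 <= flat 0 x.
  by rewrite /flat; case: ifP => // _; rewrite expr0 mul1r expR_ge0.
have f1 x : 0 < x -> 0 < flat 0 x.
  by move=> x0; rewrite /flat x0 expr0 mul1r expR_gt0.
have f2 x : ~~ (0 < x) -> flat 0 x = 0 by rewrite /flat => /negbTE ->.
exists (fun x => flat 0 (x - a) * flat 0 (b - x)); split.
- apply: smoothM => //.
    exact: (smooth_comp_affine oT dA (fun _ _ => I) (smooth_flat 0)).
  exact: (smooth_comp_affine oT dB (fun _ _ => I) (smooth_flat 0)).
- by move=> x; rewrite mulr_ge0.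
- by move=> x /andP[ax xb]; rewrite mulr_gt0 // f1 // subr_gt0.
- move=> x; rewrite negb_and => /orP[ax|xb].
    by rewrite f2 ?mul0r // subr_gt0.
  by rewrite [X in _ * X]f2 ?mulr0 // subr_gt0.
Qed.

End SmoothFunctions.

(** * Differentiation under the integral for locally smooth integrands *)

Section DifferentiationUnderIntegral.
Variable R : realType.
Notation mu := (@lebesgue_measure R).
Variables (f : R -> R -> R) (a b : R).
Hypothesis floc : forall t, t \in `[a, b] -> exists (U : set (R * R)) (bl : R * R -> R),
  [/\ open U, U (t, 0), smooth U bl & forall s u : R, U (s, u) -> f u s = bl (s, u)].

(** A single integer gives both the bound [n] on the derivative and the radius [1 / (n + 1)] in [u].
    Enlarging it relaxes both requirements, so compactness of the segment yields one value for all
    [t]; the constant [n] is then the dominating function. *)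
Let good (n : nat) (t : R) := forall u : R, `|u| < n.+1%:R^-1 ->
  [/\ derivable (f ^~ t) u 1, `|'D_1 (f ^~ t) u| <= n%:R &
      {for t, continuous (f u)}].

Let good_near : exists n, forall t, t \in `[a, b] -> good n t.
Proof.
have /compact_near_coveringP cov := @segment_compact R a b.
have : \forall n \near \oo, `[a, b] `<=` good n.
  apply: (cov nat \oo good) => t tab.
  have [U [bl [oU Ut sbl E]]] := floc tab.
  pose e2 : R * R := (0, 1).
  have cD : {for (t, 0), continuous ('D_e2 bl)}.
    exact: smooth_continuous (smooth_derive e2 sbl) Ut.
  have : \forall p \near (t, 0 : R), U p /\ `|'D_e2 bl p| <= `|'D_e2 bl (t, 0)| + 1.
    apply: filterI; first exact: open_nbhs_nbhs.
    have /cvgr_dist_le/(_ 1 ltr01) := cD.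
    apply: filterS => p; rewrite -lerBlDl => H; apply: le_trans H.
    by rewrite distrC; exact: lerB_dist.
  move=> /nbhs_ballP[r /= r0 rN].
  pose M := `|'D_e2 bl (t, 0)| + 1.
  have noo : \forall n \near \oo, n.+1%:R^-1 < r /\ M <= n%:R.
    near=> n; split; near: n; first exact: near_infty_natSinv_lt (PosNum r0).
    exact: nbhs_infty_ger.
  exists (ball t r, [set n | n.+1%:R^-1 < r /\ M <= n%:R]).
    by split=> //=; exact: nbhsx_ballx.
  move=> [t' n] [/= tt [nr Mn]].
  move=> u un.
  have [Utu Db] : U (t', u) /\ `|'D_e2 bl (t', u)| <= M.
    apply: rN; split=> //=; rewrite -ball_normE /ball_ /= sub0r normrN.
    exact: lt_trans nr.
  have n2u : \forall w \near u, bl (t', w) = f w t'.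
    apply: filterS (open_nbhs_nbhs (conj (open_slice2 oU) Utu)) => w Uw.
    by rewrite E.
  have n1t : \forall s \near t', bl (s, u) = f u s.
    apply: filterS (open_nbhs_nbhs (conj (open_slice1 oU) Utu)) => s Us.
    by rewrite E.
  split.
  - apply: near_eq_derivable n2u _.
    have sm2 : smooth [set w | U (t', w)] (fun w => bl (t', w)) by exact: smooth_slice2.
    exact: smooth_derivable sm2 Utu.
  - by rewrite -(near_eq_derive _ n2u) derive_slice2; exact: le_trans Mn.
  - rewrite /prop_for /continuous_at -(nbhs_singleton n1t).
    have sm1 : smooth [set s | U (s, u)] (fun s => bl (s, u)) by exact: smooth_slice1.
    apply: cvg_trans (smooth_continuous sm1 Utu).
    exact: near_eq_cvg.
move=> [n _ /(_ n (leqnn n)) H]; exists n => t; exact: H.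
Unshelve. all: end_near. Qed.

Lemma is_derive_under_integral :
  is_derive (0 : R) 1 (fun u => \int[mu]_(t in `[a, b]) f u t)
    (\int[mu]_(t in `[a, b]) 'D_1 (f ^~ t) 0).
Proof.
have [n gn] := good_near.
pose d : R := n.+1%:R^-1.
have d0 : 0 < d by rewrite invr_gt0.
pose I : set R := `]- d, d[%classic.
have I0 : I 0 by rewrite /I /= in_itv /= oppr_lt0 d0.
have Iu u : I u -> `|u| < d by rewrite /I /= in_itv /= ltr_norml.
have intf u : I u -> mu.-integrable `[a, b] (EFin \o f u).
  move=> /Iu ud; apply: segment_continuous_integrable => t tab.
  by have [_ _] := gn t tab u ud.
have derf u t : I u -> `[a, b]%classic t -> derivable (f ^~ t) u 1.
  by move=> /Iu ud tab; have [] := gn t tab u ud.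
have G0 (t : R) : 0 <= cst n%:R t :> R by rewrite /= ler0n.
have intG : mu.-integrable `[a, b] (EFin \o (cst n%:R : R -> R)).
  by apply: segment_continuous_integrable => t _; exact: cst_continuous.
have G_ub u t : I u -> `[a, b]%classic t -> `|partial1of2 f u t| <= cst n%:R t.
  by move=> /Iu ud tab; rewrite partial1of2E; have [] := gn t tab u ud.
have mab := @measurable_itv R `[a, b].
have dui := @derivable_under_integral R _ _ mu f `[a, b] mab 0 _ _ I0 intf derf _ G0 intG G_ub.
have dE := @differentiation_under_integral R _ _ mu f `[a, b] mab 0 _ _ I0 intf derf _ G0 intG G_ub.
apply: DeriveDef; first exact: dui.
rewrite -derive1E dE.
by apply: eq_Rintegral => t _; rewrite partial1of2E.
Qed.

End DifferentiationUnderIntegral.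

(** * Existence of the strain and the twist *)

Section LiftConditions.
Variable R : realType.
Local Notation C := R[i].
Variables (J U : set R) (g : R -> {vspace 'cV[C]_3}) (Y : R -> 'cV[C]_3).
Hypotheses (oU : open U) (UJ : U `<=` J) (sY : mxsmooth U Y).
Hypothesis gY : forall t, U t -> Y t != 0 /\ g t = <[Y t]>%VS.

Let rescale Gam : Defs.lift J g Gam ->
  exists2 c, csmooth U c & forall t, U t -> c t != 0 /\ Y t = c t *: Gam t.
Proof.
move=> [sG LG]; apply: (proportional_lifts oU sY (mxsmooth_sub UJ sG)) => t Ut.
have [Y0 gE] := gY Ut; have [G0 _ gE'] := LG t (UJ Ut); split=> //.
by rewrite -gE.
Qed.

(** Transversality and genericity come with two unrelated lifts. Both conditions pass to [Y]: a
    factor [c] multiplies [<Y, Y'>] by [|c|^2], by nullity, and the osculating determinant by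
    [c^3]. *)
Lemma generic_transversal_lift : generic_transversal J g ->
  forall t, U t -> [/\ herm (Y t) (Y t) = 0,
    0 < - 'i%R * herm (Y t) (mxD (1 : R) Y t) & oscD (1 : R) Y t != 0].
Proof.
move=> [_ [G [LG zG]] [H [LH oH]]] t Ut.
have [sG nG] := LG; have [sH nH] := LH.
have {}sG := mxsmooth_sub UJ sG; have {}sH := mxsmooth_sub UJ sH.
have [c sc cE] := rescale LG; have [d sd dE] := rescale LH.
have Ec : {in U, Y =1 (fun t => c t *: G t)} by move=> s /set_mem /cE[].
have Ed : {in U, Y =1 (fun t => d t *: H t)} by move=> s /set_mem /dE[].
have [G0 GG _] := nG t (UJ Ut); have [c0 YcG] := cE t Ut.
split.
- by rewrite YcG !hermlin GG !mulr0.
- rewrite (mxD_near oU (1 : R) Ut Ec) (mxD_scale (1 : R) Ut sc sG) YcG !hermlin GG.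
  have := zG t (UJ Ut); rewrite /zeta mxderiveE pmulr_lgt0; last first.
    by rewrite invr_gt0 sqnorm_gt0.
  move=> z0.
  have -> : - 'i%R * (conjc (c t) * (cderive (1 : R) c t * 0 + c t * herm (G t) (mxD (1 : R) G t))) =
    (conjc (c t) * c t) * (- 'i%R * herm (G t) (mxD (1 : R) G t)) by ring.
  rewrite mulr_gt0 // conjc_mulE -(rmorph0 (real_complex R)) ltcR.
  exact: complex_sqnorm_gt0.
- have [d0 _] := dE t Ut.
  rewrite (oscD_near (1 : R) oU Ut Ed) (oscD_scale (1 : R) oU sd sH Ut) -oscD1.
  by rewrite mulf_neq0 ?expf_neq0 // oH //; exact: UJ.
Qed.

End LiftConditions.

Section Converse.
Variable R : realType.
Local Notation C := R[i].

Lemma generic_transversal_of_lift (J : set R) g (Y : R -> 'cV[C]_3) :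
  open J -> mxsmooth J Y ->
  (forall t, J t -> g t = <[Y t]>%VS) ->
  (forall t, J t -> [/\ Y t != 0, herm (Y t) (Y t) = 0,
    0 < - 'i%R * herm (Y t) (mxD (1 : R) Y t) & oscD (1 : R) Y t != 0]) ->
  generic_transversal J g.
Proof.
move=> oJ sY gY HY.
have LY : Defs.lift J g Y by split=> // t Jt; have [Y0 YY _ _] := HY t Jt; rewrite gY.
split.
- split.
    move=> t Jt; exists J, Y; split=> // s _ Js; split; last exact: gY.
    by have [] := HY s Js.
  move=> t Jt; rewrite gY //; have [Y0 YY _ _] := HY t Jt; split.
    by rewrite dim_vline Y0.
  by move=> z /vlineP[c ->]; rewrite !hermlin YY !mulr0.
- exists Y; split=> // t Jt; have [Y0 _ z0 _] := HY t Jt.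
  by rewrite /zeta mxderiveE divr_gt0 // sqnorm_gt0.
- by exists Y; split=> // t Jt; rewrite oscD1; have [] := HY t Jt.
Qed.

End Converse.

(** * The curve carried by a unitary solution of [F' = F K] of determinant one *)

Section NaturalFrame.
Variable R : realType.
Local Notation C := R[i].
Variables (J : set R) (kappa tau : R -> R) (F : R -> 'M[C]_3) (g : R -> {vspace 'cV[C]_3}).
Hypotheses (oJ : open J) (sk : smooth J kappa) (st : smooth J tau) (sF : mxsmooth J F).
Hypothesis HF : forall t, J t ->
  in_U (F t) /\ mxD (1 : R) F t = F t *m Kmx kappa tau t.
Hypothesis det_F : forall t, J t -> \det (F t) = 1.
Hypothesis gF : forall t, J t -> g t = <[col o0 (F t)]>%VS.

Let AF := adapted_natural oJ sk st sF HF.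
Let sF0 := mxsmooth_col o0 sF.

Let osc t : J t -> oscD (1 : R) (fun t => col o0 (F t)) t = -1.
Proof. by move=> Jt; rewrite (oscD_adapted oJ AF Jt) det_F // expr1n mulr1. Qed.

Let lift_col0 : Defs.lift J g (fun t => col o0 (F t)).
Proof.
split=> // t Jt; have [UF _] := HF Jt.
by rewrite in_U_col_neq0 // in_U_herm // gF // !mxE.
Qed.

Lemma natural_frame_generic_transversal : generic_transversal J g.
Proof.
apply: (generic_transversal_of_lift oJ sF0 gF) => t Jt; have [_ /(_ t Jt)[F0 FF _]] := lift_col0.
split=> //; last by rewrite osc // oppr_eq0 oner_eq0.
by rewrite (herm_adapted AF Jt) mulrA mulNr mul_i_i opprK mul1r ltr01.
Qed.

Let wilczynski_col0 : wilczynski_lift J g (fun t => col o0 (F t)).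
Proof. by split; [exact: lift_col0 | rewrite oscD1; exact: osc]. Qed.

Lemma natural_frame_parameter : natural_parameter J g.
Proof.
exists (fun t => col o0 (F t)); split; first exact: wilczynski_col0.
move=> t Jt; rewrite mxderiveE (herm_adapted AF Jt) /= mulr1.
by rewrite divff // neq0Ci.
Qed.

Lemma natural_frame_bending_twist : bending_twist J g kappa tau.
Proof.
split; [exact: sk | exact: st | exists F; split; first exact: sF].
- by move=> t Jt; split; [exact: det_F | exact: (HF Jt).1].
- by rewrite ord3_0; exact: wilczynski_col0.
- move=> t Jt; have [UF DF] := HF Jt.
  by rewrite mxderiveE DF mulKmx // in_U_unit.
Qed.

End NaturalFrame.

Section DerivativeOfDet.
Variables (R : realType) (V : normedModType R) (v : V) (U : set V) (x : V).
Hypotheses (oU : open U) (Ux : U x).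
Local Notation C := R[i].

Let has_cderive (f : V -> C) (d : C) := csmooth U f /\ cderive v f x = d.

Let hD f g d e : has_cderive f d -> has_cderive g e ->
  has_cderive (fun x => f x + g x) (d + e).
Proof.
by move=> [sf <-] [sg <-]; split; [exact: csmoothD | exact: (cderiveD v sf sg Ux)].
Qed.

Let hB f g d e : has_cderive f d -> has_cderive g e ->
  has_cderive (fun x => f x - g x) (d - e).
Proof.
by move=> [sf <-] [sg <-]; split; [exact: csmoothB | exact: (cderiveB v oU sf sg Ux)].
Qed.

Let hM f g d e : has_cderive f d -> has_cderive g e ->
  has_cderive (fun x => f x * g x) (d * g x + f x * e).
Proof.
by move=> [sf <-] [sg <-]; split; [exact: csmoothM | exact: (cderiveM v sf sg Ux)].
Qed.

(** Liouville's formula, obtained from the explicit expansion; [has_cderive] carries smoothness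
    together with the value so that the rules can be nested. *)
Lemma cderive_det (F : V -> 'M[C]_3) (P : 'M[C]_3) : mxsmooth U F ->
  mxD v F x = F x *m P -> cderive v (fun x => \det (F x)) x = \tr P * \det (F x).
Proof.
move=> sF DF; have h i j : has_cderive (fun x => F x i j) ((F x *m P) i j).
  by split; [exact: sF | rewrite -DF mxE].
have E : (fun x => \det (F x)) = (fun x =>
  F x o0 o0 * (F x o1 o1 * F x o2 o2 - F x o1 o2 * F x o2 o1)
  - F x o0 o1 * (F x o1 o0 * F x o2 o2 - F x o1 o2 * F x o2 o0)
  + F x o0 o2 * (F x o1 o0 * F x o2 o1 - F x o1 o1 * F x o2 o0)).
  by apply/funext => t; exact: det_mx3E.
rewrite E (hD (hB
  (hM (h o0 o0) (hB (hM (h o1 o1) (h o2 o2)) (hM (h o1 o2) (h o2 o1))))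
  (hM (h o0 o1) (hB (hM (h o1 o0) (h o2 o2)) (hM (h o1 o2) (h o2 o0)))))
  (hM (h o0 o2) (hB (hM (h o1 o0) (h o2 o1)) (hM (h o1 o1) (h o2 o0))))).2.
rewrite det_mx3E mxtr3 !mxE !sum_ord3.
by clear DF h E; move: (F x) => A; ring.
Qed.

End DerivativeOfDet.

(** * Normalization of the determinant by a phase *)

Section Phase.
Variable R : realType.
Local Notation C := R[i].

Definition cis (x : R) : C := cos x +i* sin x.

Lemma conjc_cis x : conjc (cis x) * cis x = 1.
Proof. by rewrite conjc_mulE /= cos2Dsin2. Qed.

Lemma csmooth_cis (J : set R) (th : R -> R) : open J -> smooth J th ->
  csmooth J (fun t => cis (th t)).
Proof.
move=> oJ sth; split.
  exact: (smooth_comp oJ (fun _ _ => I) (@smooth_cos R) sth).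
exact: (smooth_comp oJ (fun _ _ => I) (@smooth_sin R) sth).
Qed.

Lemma cderive_cis (J : set R) (th : R -> R) t : smooth J th -> J t ->
  cderive (1 : R) (fun t => cis (th t)) t = 'i%R * ('D_1 th t)%:C * cis (th t).
Proof.
move=> sth Jt; have dth := smooth_differentiable sth Jt.
have Ec := derive_comp (1 : R) dth (@derivable_cos R (th t)).
have Es := derive_comp (1 : R) dth (@derivable_sin R (th t)).
apply: (etrans (f_equal2 (@Complex R) Ec Es)); rewrite !derive_val.
by apply/eqP; rewrite eq_complex /=; apply/andP; split; apply/eqP; ring.
Qed.

Lemma cderive0_constant (J : set R) (f : R -> C) : open J -> is_interval J ->
  csmooth J f -> (forall t, J t -> cderive (1 : R) f t = 0) ->
  forall s t, J s -> J t -> f s = f t.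
Proof.
move=> oJ iJ [fr fi] f0 s t Js Jt.
have E x : J x -> 'D_1 (fun x => complex.Re (f x)) x = 0 /\
                  'D_1 (fun x => complex.Im (f x)) x = 0.
  by move=> /f0 [].
have Hr x : J x -> is_derive x 1 (fun x => complex.Re (f x)) 0.
  by move=> Jx; apply: DeriveDef (E x Jx).1; exact: smooth_derivable fr Jx.
have Hi x : J x -> is_derive x 1 (fun x => complex.Im (f x)) 0.
  by move=> Jx; apply: DeriveDef (E x Jx).2; exact: smooth_derivable fi Jx.
have := is_derive0_constant iJ Hr Js Jt.
have := is_derive0_constant iJ Hi Js Jt.
by case: (f s) (f t) => [p q] [p' q'] /= -> ->.
Qed.

Lemma unit_cube_root (c : C) : conjc c * c = 1 ->
  exists2 r : C, conjc r * r = 1 & r ^+ 3 = c.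
Proof.
move=> c1; exists (3.-root c); last by rewrite rootCK.
set r := 3.-root c; have r3 : r ^+ 3 = c by rewrite rootCK.
have : (conjc r * r) ^+ 3 = 1.
  by rewrite exprMn -rmorphXn r3.
rewrite conjc_mulE -real_complexX => /complexI n1.
congr (_%:C); apply/eqP; rewrite -(@pexpr_eq1 _ _ 3) ?n1 //.
by rewrite addr_ge0 ?sqr_ge0.
Qed.

Variables (J : set R) (F : R -> 'M[C]_3) (k : R -> R) (y : R -> C) (a b : R -> R).
Hypotheses (oJ : open J) (iJ : is_interval J) (J0 : J !=set0).
Hypothesis AF : adapted (1 : R) J F k y a b.

Let phase_rateC (x h : R) : ((2%:R * x + h) * - 3%:R^-1)%:C =
  (2%:R * x%:C + h%:C) * - 3%:R^-1 :> C.
Proof.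
have N z : (- z)%:C = - z%:C :> C := rmorphN (real_complex R) z.
have D z z' : (z + z')%:C = z%:C + z'%:C :> C := rmorphD (real_complex R) z z'.
have T n : n%:R%:C = n%:R :> C := rmorph_nat (real_complex R) n.
by rewrite !(real_complexM, D, N) real_complexV !T.
Qed.

(** In the direction of the curve the connection matrix is [P] itself, so its diagonal entry [y] is
    that of an element of u(2,1). *)
Lemma adapted_imaginary t : J t -> y t = 'i%R * (complex.Im (y t))%:C.
Proof.
move=> Jt; have := connection_antiherm (1 : R) oJ AF Jt.
have [_ _ _ _ /(_ t Jt)[_ UF ->]] := AF.
rewrite mulmxA uinvl // mul1mx => /matrixP/(_ o1 o1).
rewrite !mxE !sum_ord3 !mxE /= !mulr0 !mulr1 !mul0r !mul1r !addr0 !add0r.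
case: (y t) => p q /eqP; rewrite eq_complex /= => /andP[/eqP E _].
have -> : p = 0 by lra.
by apply/eqP; rewrite eq_complex /=; apply/andP; split; apply/eqP; ring.
Qed.

(** A rotation by [exp (i th)] makes the logarithmic derivative traceless, after which the
    determinant is constant. Only a constant cube root is then extracted, and no smooth branch of
    the root has to be chosen. *)
Lemma special_frame : exists G kappa, [/\ mxsmooth J G, smooth J kappa,
  forall t, J t -> [/\ in_U (G t), \det (G t) = 1 & mxD (1 : R) G t =
    G t *m Pmx ('i%R * (kappa t)%:C) (- (2%:R * 'i%R * (kappa t)%:C)) (a t)%:C (b t)%:C] &
  forall t, J t -> exists2 c, c != 0 & G t = c *: F t].
Proof.
have [sF [sk [_ sy]] sa sb HF] := AF.
(* The trace [i (2 k + Im y)] must be cancelled by [3 i th']. *)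
pose th' (t : R) : R := (2%:R * k t + complex.Im (y t)) * - 3%:R^-1.
have thC t : (th' t)%:C = (2%:R * (k t)%:C + (complex.Im (y t))%:C) * - 3%:R^-1.
  exact: phase_rateC.
have sth' : smooth J th'.
  apply: smoothM => //; last exact: smooth_cst.
  by apply: smoothD => //; apply: smoothM => //; exact: smooth_cst.
have [th Dth] := exists_primitive oJ iJ J0 (fun x => smooth_continuous sth').
have sth := smooth_eqderiv oJ Dth sth'.
have dth t : J t -> 'D_1 th t = th' t by move=> /Dth H; exact: derive_val.
pose e t := cis (th t).
have se : csmooth J e by exact: csmooth_cis.
have De t : J t -> cderive (1 : R) e t = 'i%R * (th' t)%:C * e t.
  by move=> Jt; rewrite -dth //; exact: cderive_cis sth Jt.
have sd := csmooth_det oJ sF.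
pose f t := e t * e t * e t * \det (F t).
have see := csmoothM oJ se se; have seee := csmoothM oJ see se.
have sf : csmooth J f by exact: csmoothM.
have Df t : J t -> cderive (1 : R) f t = 0.
  move=> Jt; have [_ _ DF] := HF t Jt.
  rewrite /f (cderiveM (1 : R) seee sd Jt) (cderiveM (1 : R) see se Jt).
  rewrite (cderiveM (1 : R) se se Jt) De // (cderive_det oJ Jt sF DF).
  rewrite mxtr3 !mxE /= (adapted_imaginary Jt).
  rewrite thC.
  by move: (\det _) (_%:C) (_%:C) => D K H; field.
have [t0 Jt0] := J0.
have fE t : J t -> f t = f t0 by move=> Jt; exact: (cderive0_constant oJ iJ sf Df).
have e1 t : conjc (e t) * e t = 1 by exact: conjc_cis.
(* [f] is the determinant of the rotated frame, a constant of modulus one, so the cube of the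
   remaining factor must be its conjugate. *)
have [r r1 r3] : exists2 r : C, conjc r * r = 1 & r ^+ 3 = conjc (f t0).
  apply: unit_cube_root; rewrite conjcK mulrC.
  have [_ /in_U_det D1 _] := HF t0 Jt0; rewrite /f !conjcE.
  transitivity ((conjc (e t0) * e t0) ^+ 3 * (conjc (\det (F t0)) * \det (F t0))).
    by ring.
  by rewrite e1 D1 expr1n mulr1.
exists (fun t => (e t * r) *: F t), (fun t => k t + th' t).
have ser : csmooth J (fun t => e t * r) by apply: csmoothM => //; exact: csmooth_cst.
split.
- exact: mxsmoothZ.
- exact: smoothD.
- move=> t Jt; have [_ UF DF] := HF t Jt.
  have c1 : conjc (e t * r) * (e t * r) = 1.
    by rewrite conjcM mulrACA e1 r1 mulr1.
  split; first exact: in_U_scale.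
    rewrite detZ exprMn r3 -(fE t Jt) /f !conjcE.
    transitivity ((conjc (e t) * e t) ^+ 3 * (conjc (\det (F t)) * \det (F t))).
      by ring.
    by rewrite e1 in_U_det // expr1n mulr1.
  rewrite (mxD_scale (1 : R) Jt ser sF) DF.
  rewrite (cderiveM (1 : R) se (csmooth_cst J r) Jt) De // cderive_cst mulr0 addr0.
  have -> : 'i%R * (th' t)%:C * e t * r = (e t * r) * ('i%R * (th' t)%:C) by ring.
  rewrite -scalerA -scalemxAl -scalerDr; congr (_ *: _).
  rewrite -mul_mx_scalar -mulmxDr; congr (_ *m _).
  have -> : (k t + th' t)%:C = (k t)%:C + (th' t)%:C :> C.
    exact: (rmorphD (real_complex R)).
  have := adapted_imaginary Jt; rewrite thC; set h := complex.Im _ => ->.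
  apply/matrixP; apply: ord3P; apply: ord3P; rewrite !mxE /=;
    move: (k t)%:C h%:C => K H; by field.
- move=> t Jt; exists (e t * r) => //.
  apply/eqP => E0; have : conjc (e t * r) * (e t * r) = 1.
    by rewrite conjcM mulrACA e1 r1 mulr1.
  by rewrite E0 mulr0 => /esym/eqP; rewrite oner_eq0.
Qed.

End Phase.

Section Existence.
Variable R : realType.
Local Notation C := R[i].
Variables (J : set R) (g : R -> {vspace 'cV[C]_3}).
Hypotheses (oJ : open J) (iJ : is_interval J) (J0 : J !=set0).

Lemma special_frame_strain (G : R -> 'M[C]_3) k a b :
  mxsmooth J G -> smooth J k -> smooth J a -> smooth J b ->
  (forall t, J t -> 0 < a t) ->
  (forall t, J t -> [/\ in_U (G t), \det (G t) = 1 & mxD (1 : R) G t =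
    G t *m Pmx ('i%R * (k t)%:C) (- (2%:R * 'i%R * (k t)%:C)) (a t)%:C (b t)%:C]) ->
  (forall t, J t -> g t = <[col o0 (G t)]>%VS) ->
  strain J g a.
Proof.
move=> sG sk sa sb a0 HG gG.
have A : adapted (1 : R) J G k (fun t => - (2%:R * 'i%R * (k t)%:C)) a b.
  split=> //.
    split=> //; apply: csmoothN => //; apply: csmoothM => //; first exact: csmooth_cst.
    exact: csmooth_real.
  by move=> t Jt; have [UG _ DG] := HG t Jt; split=> //; exact: a0.
have aC t : J t -> (a t)%:C != 0 :> C.
  by move=> Jt; rewrite (fmorph_eq0 (real_complex R)) gt_eqF // a0.
(* With [det G = 1] the osculating determinant of the first column is [- a^3], so dividing by [a]
   gives a Wilczynski lift. *)
pose i t := ((a t)%:C)^-1 : C.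
have sG0 := mxsmooth_col o0 sG.
have si : csmooth J i by apply: csmoothV => //; exact: csmooth_real.
have H t : J t -> herm (i t *: col o0 (G t)) (mxD (1 : R) (fun t => i t *: col o0 (G t)) t) = 'i%R * i t.
  move=> Jt; have [UG _ _] := HG t Jt.
  rewrite (mxD_scale (1 : R) Jt si sG0) !hermlin (herm_adapted A Jt) in_U_herm //.
  have -> : conjc (i t) = i t by rewrite /i -real_complexV conjcE.
  rewrite !mxE /= /i; move: (a t)%:C (aC t Jt) => z h; by field.
exists (fun t => i t *: col o0 (G t)); split.
  split.
    split; first exact: mxsmoothZ.
    move=> t Jt; have [UG _ _] := HG t Jt; split.
    - by rewrite scaler_eq0 negb_or invr_eq0 aC // in_U_col_neq0.
    - by rewrite !hermlin in_U_herm // !mxE /= !mulr0.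
    - by rewrite gG // line_scale // invr_eq0 aC.
  move=> t Jt; rewrite oscD1 (oscD_scale (1 : R) oJ si sG0 Jt) (oscD_adapted oJ A Jt).
  have [_ -> _] := HG t Jt; rewrite mul1r mulrN -exprMn /i mulVf ?expr1n //.
  exact: aC.
move=> t Jt; rewrite mxderiveE H // /i.
have i0 : 'i%R != 0 :> C by rewrite neq0Ci.
by rewrite invfM invrK mulrA divff // mul1r.
Qed.

Lemma special_frame_twist (G : R -> 'M[C]_3) k a b :
  mxsmooth J G -> smooth J k -> smooth J a -> smooth J b ->
  (forall t, J t -> 0 < a t) ->
  (forall t, J t -> [/\ in_U (G t), \det (G t) = 1 & mxD (1 : R) G t =
    G t *m Pmx ('i%R * (k t)%:C) (- (2%:R * 'i%R * (k t)%:C)) (a t)%:C (b t)%:C]) ->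
  (forall t, J t -> g t = <[col o0 (G t)]>%VS) ->
  twist J g (fun t => b t * (a t)^-1).
Proof.
move=> sG sk sa sb a0 HG gG.
(* The natural parameter is a primitive of the strain; composing the frame with its inverse divides
   the connection matrix by [a]. *)
have [s Ds] := exists_primitive oJ iJ J0 (fun x => smooth_continuous sa).
have ss := smooth_eqderiv oJ Ds sa.
have ds t : J t -> 'D_1 s t = a t by move=> /Ds H; exact: derive_val.
have s0 t : J t -> 0 < 'D_1 s t by move=> Jt; rewrite ds // a0.
have [r [oI iI sr rs Hr]] := smooth_inverse oJ iJ ss s0.
set I := s @` J in oI iI sr Hr.
have rJ x : I x -> J (r x) by move=> /Hr[].
have sia : smooth J (fun t => (a t)^-1).
  apply: (smooth_comp oJ _ (@smooth_inv R) sa) => t Jt /=.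
  by rewrite gt_eqF // a0.
pose kappa x := k (r x) * (a (r x))^-1; pose tau x := b (r x) * (a (r x))^-1.
have sk' : smooth I kappa.
  exact: (smooth_comp oI rJ (smoothM oJ sk sia) sr).
have st' : smooth I tau.
  exact: (smooth_comp oI rJ (smoothM oJ sb sia) sr).
pose F x := G (r x).
have sF : mxsmooth I F := mxsmooth_reparam oI sr rJ sG.
have HF x : I x -> in_U (F x) /\ mxD (1 : R) F x = F x *m Kmx kappa tau x.
  move=> Ix; have [Jr _ Dr] := Hr x Ix; have [UG _ DG] := HG _ Jr; split=> //.
  rewrite (mxD_reparam sr rJ sG Ix) Dr ds // DG KmxE scalemxAr; congr (_ *m _).
  have aC : (a (r x))%:C != 0 :> C.
    by rewrite (fmorph_eq0 (real_complex R)) gt_eqF // a0.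
  rewrite /Pmx /kappa /tau !real_complexM !real_complexV.
  move: (a (r x))%:C (b (r x))%:C (k (r x))%:C aC => a1 b1 k1 aC.
  by apply/matrixP; apply: ord3P; apply: ord3P; rewrite !mxE /=; field.
have dF x : I x -> \det (F x) = 1 by move=> Ix; have [] := HG _ (rJ x Ix).
have gF x : I x -> g (r x) = <[col o0 (F x)]>%VS by move=> Ix; exact/gG/rJ.
exists s, (fun x => g (r x)), kappa, tau; split.
- split=> //.
  + by move=> t Jt; rewrite derive1E s0.
  + exact: (natural_frame_generic_transversal oI sk' st' sF HF dF gF).
  + exact: (natural_frame_parameter oI sk' st' sF HF dF gF).
  + by move=> t Jt; rewrite rs.
- exact: (natural_frame_bending_twist oI sk' st' sF HF dF gF).
- by move=> t Jt; rewrite /tau rs.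
Qed.

(** Needed to feed a test deformation to the criticality hypothesis, which requires an actual
    function [W] and hence a strain and a twist for each curve. *)
Lemma strain_twist_exist : generic_transversal J g ->
  exists al tau, strain J g al /\ twist J g tau.
Proof.
move=> Hg; have [_ [Y [[sY LY] _]] _] := Hg.
have gY t : J t -> Y t != 0 /\ g t = <[Y t]>%VS by move=> /LY[].
have CY := generic_transversal_lift oJ (@subset_refl _ J) sY gY Hg.
have [F [k [y [a [b [m [AF m0 FY]]]]]]] := lift_frame oJ sY CY.
have [_ _ sa sb HF] := AF.
have a0 t : J t -> 0 < a t by move=> /HF[].
have [G [kappa [sG sk HG GF]]] := special_frame oJ iJ J0 AF.
have gG t : J t -> g t = <[col o0 (G t)]>%VS.
  move=> Jt; have [c c0 ->] := GF t Jt; have [_ ->] := gY t Jt.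
  have -> : col o0 (c *: F t) = c *: col o0 (F t) by apply/matrixP=> i j; rewrite !mxE.
  rewrite line_scale // -ord3_0 FY line_scale //.
  by rewrite (fmorph_eq0 (real_complex R)) gt_eqF // m0.
exists a, (fun t => b t * (a t)^-1); split.
- exact: special_frame_strain sG sk sa sb a0 HG gG.
- exact: special_frame_twist sG sk sa sb a0 HG gG.
Qed.

End Existence.

(** * First variation *)

Section AdaptedScalar.
Variables (R : realType) (V : normedModType R) (v : V) (U : set V).
Variables (F G : V -> 'M[R[i]]_3) (k k' : V -> R) (y y' : V -> R[i]) (a a' b b' : V -> R).
Hypotheses (oU : open U) (AF : adapted v U F k y a b) (AG : adapted v U G k' y' a' b').
Hypothesis FG : forall x, U x -> exists c, col 0 (G x) = c *: col 0 (F x).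

Lemma adapted_scalar : exists2 c, csmooth U c &
  forall x, U x -> conjc (c x) * c x = 1 /\ G x = c x *: F x.
Proof.
have [sF _ _ _ HF] := AF; have [sG _ _ _ HG] := AG.
(* Taking the corner entry of [F^-1 G], instead of a witness at each point, exhibits the phase as a
   smooth function. *)
exists (fun x => (uinv (F x) *m G x) o0 o0).
  exact: (mxsmoothM oU (mxsmooth_uinv oU AF) sG).
move=> x Ux; have [_ _ [c [c1 ->]]] := adapted_unique oU AF AG FG Ux.
have [_ UF _] := HF x Ux.
by rewrite -scalemxAr (uinvl UF) !mxE mulr1.
Qed.

End AdaptedScalar.

Section Variation.
Variable R : realType.
Local Notation C := R[i].
Local Notation e1 := ((1 : R), (0 : R)).
Local Notation e2 := ((0 : R), (1 : R)).

Let solve_linear (x y : R) : 3%:R * x + 2%:R * y = 0 -> x = - (2%:R / 3%:R * y).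
Proof. by move=> E; lra. Qed.

Lemma cderive2_fst (f : R -> C) p : cderive e2 (fun p : R * R => f p.1) p = 0.
Proof.
case: p => t u; have D0 (g : R -> R) : 'D_e2 (fun p : R * R => g p.1) (t, u) = 0.
  by rewrite -(derive_slice2 (fun p : R * R => g p.1)); exact: (derive_cst (g t) u (1 : R)).
by rewrite /cderive (D0 (fun t => complex.Re (f t))) (D0 (fun t => complex.Im (f t))).
Qed.

Lemma mxD2_fst m n (F : R -> 'M[C]_(m, n)) p :
  mxD e2 (fun p : R * R => F p.1) p = 0.
Proof.
by apply/matrixP=> i j; rewrite [LHS]mxE [RHS]mxE; exact: (cderive2_fst (fun t => F t i j)).
Qed.

Lemma oscD_slice1 (Z : R * R -> 'cV[C]_3) t u :
  oscD (1 : R) (fun t => Z (t, u)) t = oscD e1 Z (t, u).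
Proof.
have E : mxD (1 : R) (fun t => Z (t, u)) = (fun t => mxD e1 Z (t, u)).
  by apply/funext => s; exact: mxD_slice1.
by rewrite /oscD (mxD_slice1 Z) E (mxD_slice1 (mxD e1 Z)).
Qed.

Lemma open_strip (J : set R) (e : R) : open J ->
  open (J `*` [set u : R | `|u| < e]).
Proof.
move=> oJ; apply: openI.
  by apply: (open_comp _ oJ) => p _; exact: cvg_fst.
have -> : (fun p : R * R => [set u : R | `|u| < e] p.2) =
    (fun p => `|p.2|) @^-1` [set x | x < e] by [].
apply: open_comp; last exact: open_lt.
move=> p _; by apply: continuous_comp; [exact: cvg_snd | exact: norm_continuous].
Qed.

Lemma is_diff_fst (p : R * R) : is_diff p (@fst R R) (@fst R R).
Proof.
have cf : continuous (@fst R R : {linear (R * R)%type -> R}) by move=> q; exact: cvg_fst.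
by apply: DiffDef; [exact: linear_differentiable | rewrite (diff_lin _ cf)].
Qed.

(** Only [b] is kept among the parameters of the frame: it is the twist density, and the other
    entries do not enter the variation formula. *)
Definition local_frame (D : set (R * R)) (v : R -> R -> {vspace 'cV[C]_3})
    (t : R) (U : set (R * R)) (F : R * R -> 'M[C]_3) (b : R * R -> R) : Prop :=
  [/\ open U, U (t, 0), U `<=` D,
      exists k y a, adapted e1 U F k y a b &
      forall p, U p -> v p.2 p.1 = <[col o0 (F p)]>%VS].

(** A smooth local representative of the family exists by smoothness into the projective plane.
    Nullity, positivity and genericity concern derivatives in [t] only, so they are checked on each
    slice of fixed [u]. *)
Lemma local_frame_exist (J : set R) (e : R) v t : open J -> 0 < e ->
  smooth_into_CP2 (J `*` [set u : R | `|u| < e]) (fun p => v p.2 p.1) ->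
  (forall u, `|u| < e -> generic_transversal J (v u)) -> J t ->
  exists U F b, local_frame (J `*` [set u : R | `|u| < e]) v t U F b.
Proof.
move=> oJ e0 sv gv Jt; set D := J `*` _.
have oD : open D by exact: open_strip.
have Dt : D (t, 0) by split=> //=; rewrite normr0.
have [W [Z [oW Wt sZ HZ]]] := sv _ Dt.
pose U := W `&` D; have oU : open U by exact: openI.
have sZU : mxsmooth U Z by apply: mxsmooth_sub sZ; exact: subIsetl.
have HZU p : U p -> [/\ herm (Z p) (Z p) = 0,
    0 < - 'i%R * herm (Z p) (mxD e1 Z p) & oscD e1 Z p != 0].
  case: p => s u [Wsu Dsu]; have [Js ue] := Dsu; rewrite /= in Js ue.
  pose T := [set t | U (t, u)].
  have TJ : T `<=` J by move=> r [_ []].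
  have gT r : T r -> Z (r, u) != 0 /\ v u r = <[Z (r, u)]>%VS.
    by move=> [Wr Dr]; exact: HZ Wr Dr.
  have := generic_transversal_lift (open_slice1 oU) TJ (mxsmooth_slice1 u oU sZU) gT
    (gv u ue) (conj Wsu Dsu).
  by rewrite (mxD_slice1 Z) (oscD_slice1 Z).
have [F [k [y [a [b [m [AF m0 FZ]]]]]]] := lift_frame oU sZU HZU.
exists U, F, b; split; [exact: oU | by split | exact: subIsetr | by exists k, y, a | ].
move=> p Up; have [Z0 ->] := HZ p Up.1 Up.2.
rewrite -ord3_0 FZ line_scale //.
by rewrite (fmorph_eq0 (real_complex R)) gt_eqF // m0.
Qed.

Section Uniqueness.
Variables (D : set (R * R)) (v : R -> R -> {vspace 'cV[C]_3}) (t : R).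
Variables (U U' : set (R * R)) (F F' : R * R -> 'M[C]_3) (b b' : R * R -> R).
Hypotheses (LF : local_frame D v t U F b) (LF' : local_frame D v t U' F' b').

(** The frames differ by a smooth phase [c] in both variables, which contributes [conj c] times the
    [u]-derivative of [c]. *)
Lemma variation_mx_unique : exists l : C,
  variation_mx F' t = variation_mx F t + l%:M.
Proof.
have [oU Ut _ [k [y [a AF]]] vF] := LF; have [oU' Ut' _ [k' [y' [a' AF']]] vF'] := LF'.
pose W := U `&` U'; have oW : open W by exact: openI.
have AFW := adapted_sub (@subIsetl _ U U') AF.
have AFW' := adapted_sub (@subIsetr _ U U') AF'.
have [|c sc cE] := adapted_scalar oW AFW AFW'.
  move=> p [Up Up']; rewrite ord3_0; apply: eq_lineP.
  by rewrite -vF // -vF'.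
have Wt : W (t, 0) by [].
have [c1 Fc] := cE _ Wt; have [sF _ _ _ /(_ _ Wt)[_ UF _]] := AFW.
exists (conjc (c (t, 0)) * cderive e2 c (t, 0)).
have Ec : {in W, F' =1 (fun p => c p *: F p)} by move=> p /set_mem /cE[].
rewrite /variation_mx (mxD_near oW e2 Wt Ec) (mxD_scale e2 Wt sc sF) Fc.
have -> : uinv (c (t, 0) *: F (t, 0)) = conjc (c (t, 0)) *: uinv (F (t, 0)).
  by rewrite /uinv conjT_scale -scalemxAr -scalemxAl.
rewrite mulmxDr addrC -!scalemxAr -!scalemxAl !scalerA (uinvl UF).
by rewrite mulrC c1 scale1r scalemx1 mulrC.
Qed.

Lemma variation_mx_unique10 : variation_mx F' t o1 o0 = variation_mx F t o1 o0.
Proof. by have [l ->] := variation_mx_unique; rewrite !mxE mulr0n addr0. Qed.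

Lemma lax_pairing_unique kappa tau :
  lax_pairing kappa tau F' t = lax_pairing kappa tau F t.
Proof.
have [l E] := variation_mx_unique; rewrite /lax_pairing E mulmxDr mxtraceD.
have tL : \tr (Lmx kappa tau t) = 0 by rewrite mxtr3 !mxE /= !addr0.
by rewrite mul_mx_scalar mxtraceZ tL mulr0 addr0.
Qed.

End Uniqueness.

Section FirstVariationFormula.
Variables (J : set R) (gamma : R -> {vspace 'cV[C]_3}) (kappa tau : R -> R).
Variable F0 : R -> 'M[C]_3.
Hypotheses (oJ : open J) (iJ : is_interval J) (sk : smooth J kappa) (st : smooth J tau).
Hypothesis sF0 : mxsmooth J F0.
Hypothesis HF0 : forall t, J t ->
  in_U (F0 t) /\ mxD (1 : R) F0 t = F0 t *m Kmx kappa tau t.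
Hypothesis gF0 : forall t, J t -> gamma t = <[col o0 (F0 t)]>%VS.
Variables (a b e : R) (v : R -> R -> {vspace 'cV[C]_3}) (W : R -> R).
Hypotheses (ab : a <= b) (abJ : `[a, b] `<=` J) (e0 : 0 < e).
Hypothesis vP : cs_variation J gamma a b e v.
Hypothesis WP : forall u, `|u| < e -> total_twist J (v u) a b (W u).

Let D := J `*` [set u : R | `|u| < e].
Let w := lax_defect kappa tau.

Let local_exist t : J t -> exists U F be, local_frame D v t U F be.
Proof. by have [sv gv _ _] := vP; exact: local_frame_exist. Qed.

Let local_frame_move s t U F be : local_frame D v t U F be -> U (s, 0) ->
  local_frame D v s U F be.
Proof. by move=> [oU _ UD AF vF] Us; split. Qed.

Let local_frame_J t U F be : local_frame D v t U F be -> J t.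
Proof. by move=> [_ Ut UD _ _]; have [] := UD _ Ut. Qed.

Let local_lax t U F be : local_frame D v t U F be ->
  is_derive t 1 (lax_pairing kappa tau F)
    (3%:R * 'D_e2 be (t, 0) + 2%:R * complex.Re (conjc (w t) * variation_mx F t o1 o0)).
Proof.
move=> [oU Ut UD [k [y [al AF]]] vF].
apply: (is_derive_lax_pairing oJ sk st sF0 HF0 oU AF _ _ Ut).
  by move=> s /UD[].
move=> s Us; have [Js _] := UD _ Us; have [_ _ v0 _] := vP.
by rewrite ord3_0; apply: eq_lineP; rewrite -gF0 // -v0 // (vF _ Us).
Qed.

(** The strain and twist are chosen for each [u] independently, with no regularity in [u]. Agreement
    with [be] in every local frame supplies the joint smoothness afterwards. *)
Let density : exists f : R -> R -> R,
  (forall u, `|u| < e -> W u = \int[lebesgue_measure]_(t in `[a, b]) f u t) /\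
  forall t U F be s u, local_frame D v t U F be -> U (s, u) -> f u s = be (s, u).
Proof.
have [f fP] : {f : R -> R -> R & forall u, `|u| < e ->
    exists al ta, [/\ strain J (v u) al, twist J (v u) ta,
      W u = \int[lebesgue_measure]_(t in `[a, b]) (ta t * al t) &
      f u = fun t => ta t * al t]}.
  apply: (@choice _ _ (fun u fu => `|u| < e -> exists al ta,
    [/\ strain J (v u) al, twist J (v u) ta,
      W u = \int[lebesgue_measure]_(t in `[a, b]) (ta t * al t) &
      fu = fun t => ta t * al t])) => u.
  have [ue|_] := boolP (`|u| < e); last by exists (cst 0).
  have [al [ta [sal tta WE]]] := WP ue.
  by exists (fun t => ta t * al t) => _; exists al, ta.
exists f; split.
  by move=> u /fP[al [ta [_ _ -> ->]]].
move=> t U F be s u [oU Ut UD [k [y [a' AF]]] vF] Us.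
have [_ ue] := UD _ Us; have [al [ta [sal tta _ ->]]] := fP u ue.
pose T := [set t | U (t, u)].
have TJ : T `<=` J by move=> r /UD[].
have gT r : T r -> v u r = <[col o0 (F (r, u))]>%VS by move=> /vF.
by have [] := twist_density oJ sal tta (open_slice1 oU) TJ (adapted_slice1 u oU AF) gT Us.
Qed.

Let frame_choice : exists Fr : R -> R * R -> 'M[C]_3,
  forall t, J t -> exists U be, local_frame D v t U (Fr t) be.
Proof.
have [Fr FrP] := @choice _ _ (fun t F => J t -> exists U be, local_frame D v t U F be)
  (fun t => ltac:(
    have [Jt|nJ] := pselect (J t);
    [have [U [F [be L]]] := local_exist Jt; exists F => _; by exists U, be
    | by exists (cst 0)])).
by exists Fr.
Qed.

(** Off the support the curves do not move, so the Wilczynski frame of [gamma], taken constant in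
    [u], is a local frame. *)
Let frame0 t : J t -> t \notin `[a, b] ->
  exists U F be, local_frame D v t U F be /\ variation_mx F t = 0.
Proof.
move=> Jt tab; have [_ _ _ vg] := vP.
pose J' := J `&` ~` `[a, b]; have oJ' : open J'.
  by apply: openI => //; apply: closed_openC; exact: interval_closed.
pose U := J' `*` [set u : R | `|u| < e]; have oU : open U by exact: open_strip.
have UJ p : U p -> J p.1 by move=> [[]].
have dp (p : R * R) : is_diff p (@fst R R) (@fst R R).
  exact: is_diff_fst.
exists U, (fun p => F0 p.1), (fun p => tau p.1); split.
  split=> //.
  - by split=> /=; [split=> //; exact/negP | rewrite normr0].
  - by move=> p [[]].
  - exists (fun p => kappa p.1), (fun p => - (2%:R * 'i%R * (kappa p.1)%:C)), (fun=> 1).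
    have [_ [_ sy] _ _ HA] := adapted_natural oJ sk st sF0 HF0.
    split.
    + exact: (mxsmooth_comp_affine oU dp UJ sF0).
    + split; first exact: (smooth_comp_affine oU dp UJ sk).
      exact: (csmooth_comp_affine oU dp UJ sy).
    + exact: smooth_cst.
    + exact: (smooth_comp_affine oU dp UJ st).
    + by case=> s u /UJ Js; rewrite -(mxD_slice1 (fun p => F0 p.1)); exact: HA.
  - by case=> s u [[Js sab] ue] /=; rewrite vg //; [exact: gF0 | exact/negP].
by rewrite /variation_mx (mxD2_fst F0) mulmx0.
Qed.

(** The integrand [r] is described in every local frame, so that a caller may evaluate it in a frame
    of its own. Frames are picked for each [t] separately; frame independence makes [h] and [r]
    locally equal to smooth expressions. *)
Lemma first_variation : exists r : R -> R,
  [/\ forall t, J t -> {for t, continuous r},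
      forall t U F be, local_frame D v t U F be ->
        r t = complex.Re (conjc (w t) * variation_mx F t o1 o0) &
      is_derive (0 : R) 1 W
        (- (2%:R / 3%:R * \int[lebesgue_measure]_(t in `[a, b]) r t))].
Proof.
have [f [Wf fbe]] := density.
have [Fr FrP] := frame_choice.
pose h t := lax_pairing kappa tau (Fr t) t.
pose r t := complex.Re (conjc (w t) * variation_mx (Fr t) t o1 o0).
have hE t U F be : local_frame D v t U F be -> h t = lax_pairing kappa tau F t.
  move=> L; have [U' [be' L']] := FrP t (local_frame_J L).
  exact: lax_pairing_unique L L' _ _.
have rE t U F be : local_frame D v t U F be ->
    r t = complex.Re (conjc (w t) * variation_mx F t o1 o0).
  move=> L; have [U' [be' L']] := FrP t (local_frame_J L).
  by rewrite /r (variation_mx_unique10 L L').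
have near_frame t U F be : local_frame D v t U F be ->
    \forall s \near t, local_frame D v s U F be.
  move=> L; have [oU Ut _ _ _] := L.
  apply: filterS (open_nbhs_nbhs (conj (open_slice1 oU) Ut)) => s Us.
  exact: local_frame_move L Us.
pose X (t : R) : R := 'D_1 (f ^~ t) 0.
have XE t U F be : local_frame D v t U F be -> X t = 'D_e2 be (t, 0).
  move=> L; have [oU Ut _ _ _] := L.
  rewrite -derive_slice2; apply: near_eq_derive.
  apply: filterS (open_nbhs_nbhs (conj (open_slice2 oU) Ut)) => u Uu.
  exact: fbe L Uu.
have cX t : J t -> {for t, continuous X}.
  move=> Jt; have [U [F [be L]]] := local_exist Jt.
  have [oU Ut _ [k [y [al [_ _ _ sbe _]]]] _] := L.
  have E : \forall s \near t, 'D_e2 be (s, 0) = X s.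
    by apply: filterS (near_frame _ _ _ _ L) => s /XE.
  rewrite /prop_for /continuous_at -(nbhs_singleton E).
  apply: cvg_trans (near_eq_cvg E) _.
  exact: (smooth_continuous (smooth_slice1 (0 : R) oU (smooth_derive e2 sbe)) Ut).
have cr t : J t -> {for t, continuous r}.
  move=> Jt; have [U [F [be L]]] := local_exist Jt.
  have [oU Ut UD [k [y [al AF]]] _] := L.
  pose T := [set s | U (s, 0)]; have oT : open T := open_slice1 oU.
  have TJ : T `<=` J by move=> s /UD[].
  have E : \forall s \near t,
      complex.Re (conjc (w s) * variation_mx F s o1 o0) = r s.
    by apply: filterS (near_frame _ _ _ _ L) => s Ls; rewrite (rE _ _ _ _ Ls).
  rewrite /prop_for /continuous_at -(nbhs_singleton E).
  apply: cvg_trans (near_eq_cvg E) _.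
  have sw := csmooth_sub TJ (csmooth_lax_defect oJ sk st).
  have sQ : csmooth T (fun s => variation_mx F s o1 o0).
    exact: (csmooth_slice1 0 oU (mxsmooth_connection e2 oU AF o1 o0)).
  exact: (smooth_continuous (csmoothM oT (csmooth_conj oT sw) sQ).1 Ut).
have dh t : J t -> is_derive t 1 h (3%:R * X t + 2%:R * r t).
  move=> Jt; have [U [F [be L]]] := local_exist Jt.
  rewrite (XE _ _ _ _ L) (rE _ _ _ _ L); apply: near_eq_is_derive (local_lax L).
  by apply: filterS (near_frame _ _ _ _ L) => s Ls; rewrite (hE _ _ _ _ Ls).
have h0 t : J t -> t \notin `[a, b] -> h t = 0.
  move=> Jt tab; have [U [F [be [L Q0]]]] := frame0 Jt tab.
  by rewrite (hE _ _ _ _ L) /lax_pairing Q0 mulmx0 mxtrace0.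
have ch t : J t -> {for t, continuous h}.
  by move=> Jt; apply: differentiable_continuous; apply/derivable1_diffP; have [] := dh t Jt.
have Ja : J a by apply: abJ; rewrite /= in_itv /= lexx.
have Jb : J b by apply: abJ; rewrite /= in_itv /= lexx ab.
(* [a] itself belongs to the segment. Points slightly to its left are in [J] and off the segment,
   and continuity carries the value 0 to [a]. *)
have ha : h a = 0.
  have h1 : h x @[x --> a^'-] --> h a by apply: cvg_at_left_filter; exact: ch.
  have h2 : h x @[x --> a^'-] --> (0 : R).
    apply: cvg_near_cst; near=> x; apply: h0.
      by near: x; apply: cvg_within; exact: open_nbhs_nbhs.
    rewrite in_itv /= negb_and -ltNge; apply/orP; left.
    by near: x; exact: nbhs_left_lt.
  exact: cvg_unique h1 h2.
have hb : h b = 0.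
  have h1 : h x @[x --> b^'+] --> h b by apply: cvg_at_right_filter; exact: ch.
  have h2 : h x @[x --> b^'+] --> (0 : R).
    apply: cvg_near_cst; near=> x; apply: h0.
      by near: x; apply: cvg_within; exact: open_nbhs_nbhs.
    rewrite in_itv /= negb_and -!ltNge; apply/orP; right.
    by near: x; exact: nbhs_right_gt.
  exact: cvg_unique h1 h2.
have iX := segment_continuous_integrable (fun x xab => cX x (abJ xab)).
have ir := segment_continuous_integrable (fun x xab => cr x (abJ xab)).
have intX : \int[lebesgue_measure]_(t in `[a, b]) X t =
    - (2%:R / 3%:R * \int[lebesgue_measure]_(t in `[a, b]) r t).
  have c3 t : J t -> {for t, continuous (fun t => 3%:R * X t + 2%:R * r t)}.
    move=> Jt; apply: cvgD; apply: cvgM; [exact: cvg_cst | exact: cX | exact: cvg_cst | exact: cr].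
  have := Rintegral_FTC ab (fun x xab => c3 x (abJ xab)) (fun x xab => dh x (abJ xab)).
  have iZ (c : R) (g : R -> R) : (forall t, J t -> {for t, continuous g}) ->
      lebesgue_measure.-integrable `[a, b] (EFin \o (fun t => c * g t)).
    move=> cg; apply: segment_continuous_integrable => x xab.
    by apply: cvgM; [exact: cvg_cst | exact/cg/abJ].
  rewrite ha hb subr0 RintegralD //; [|exact: iZ|exact: iZ].
  rewrite !RintegralZl //.
  exact: solve_linear.
exists r; split=> //.
(* [W] is the integral of the density only for [|u| < e], which is enough for the derivative at
   0. *)
rewrite -intX; apply: near_eq_is_derive (is_derive_under_integral _).
  near=> u; rewrite Wf //; near: u; exact: nbhs0_lt.
move=> t tab; have [U [F [be L]]] := local_exist (abJ tab).
have [oU Ut _ [k [y [al [_ _ _ sbe _]]]] _] := L.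
exists U, be; split=> // s u Usu; exact: fbe L Usu.
Unshelve. all: end_near.
Qed.

End FirstVariationFormula.

End Variation.

Section RealTools.
Variable R : realType.

(** A primitive is nondecreasing with equal values at the ends, hence constant in between, and [r s]
    is its derivative. *)
Lemma nonneg_integral_eq0 (J : set R) (r : R -> R) (a b s : R) :
  open J -> is_interval J -> J a -> J b -> a < s < b ->
  (forall t, J t -> {for t, continuous r}) -> (forall t, J t -> 0 <= r t) ->
  \int[lebesgue_measure]_(t in `[a, b]) r t = 0 -> r s = 0.
Proof.
move=> oJ iJ Ja Jb /andP[as_ sb] cr r0 int0.
have abJ := sub_interval iJ Ja Jb.
have [H dH] := exists_primitive oJ iJ (ex_intro _ a Ja) cr.
have HbHa : H b = H a.
  apply/eqP; rewrite -subr_eq0 -int0 eq_sym; apply/eqP; apply: Rintegral_FTC.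
  - exact/ltW/(lt_trans as_ sb).
  - by move=> x /abJ; exact: cr.
  - by move=> x /abJ; exact: dH.
have mono x y : J x -> J y -> x <= y -> H x <= H y.
  move=> Jx Jy; rewrite le_eqVlt => /predU1P[->//|xy].
  have xyJ := sub_interval iJ Jx Jy.
  have [||c cxy] := @MVT R H r x y xy.
  - by move=> t /subset_itv_oo_cc txy; apply/dH/xyJ.
  - apply: derivable_within_continuous => t txy.
    by have [] := dH t (xyJ t txy).
  move=> E; rewrite -subr_ge0 E mulr_ge0 ?subr_ge0 ?(ltW xy) //; apply/r0/xyJ.
  exact: subset_itv_oo_cc cxy.
have Js : J s by apply: abJ; rewrite /= in_itv /= !ltW.
have E : \forall t \near s, H t = cst (H a) t.
  near=> t.
  have at_ : a < t by near: t; exact: lt_nbhsr.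
  have tb : t < b by near: t; exact: lt_nbhsl.
  have Jt : J t by apply: abJ; rewrite /= in_itv /= !ltW.
  apply/eqP; rewrite eq_le /= -{1}HbHa; apply/andP; split; apply: mono => //; exact: ltW.
have <- : 'D_1 H s = r s by have Ds := dH s Js; exact: derive_val.
by rewrite (near_eq_derive _ E) derive_cst.
Unshelve. all: end_near. Qed.

Lemma tube_segment (a b : R) (P : set (R * R)) :
  (forall t, t \in `[a, b] -> \forall p \near (t, 0 : R), P p) ->
  exists2 e : R, 0 < e & forall t u, t \in `[a, b] -> `|u| < e -> P (t, u).
Proof.
move=> HP; have /compact_near_coveringP cov := @segment_compact R a b.
have : \forall n \near \oo, `[a, b] `<=`
    [set t | forall u : R, `|u| < n.+1%:R^-1 -> P (t, u)].
  apply: (cov nat \oo (fun n => [set t | forall u : R, `|u| < n.+1%:R^-1 -> P (t, u)])) => t tab.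
  have /nbhs_ballP[r /= r0 rP] := HP t tab.
  exists (ball t r, [set n | n.+1%:R^-1 < r]).
    by split=> /=; [exact: nbhsx_ballx | exact: near_infty_natSinv_lt (PosNum r0)].
  move=> [t' n] [/= tt nr] u un; apply: rP; split=> //=.
  by rewrite -ball_normE /ball_ /= sub0r normrN; exact: lt_trans nr.
move=> [n _ /(_ n (leqnn n)) H]; exists n.+1%:R^-1; first by rewrite invr_gt0.
by move=> t u tab; exact: H.
Qed.

End RealTools.

(** * Test variations *)

Section TestVariation.
Variable R : realType.
Local Notation C := R[i].
Local Notation e1 := ((1 : R), (0 : R)).
Local Notation e2 := ((0 : R), (1 : R)).

Lemma is_diff_snd (p : R * R) : is_diff p (@snd R R) (@snd R R).
Proof.
have cf : continuous (@snd R R : {linear (R * R)%type -> R}) by move=> q; exact: cvg_snd.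
by apply: DiffDef; [exact: linear_differentiable | rewrite (diff_lin _ cf)].
Qed.

Lemma smooth_snd (U : set (R * R)) : open U -> smooth U (@snd R R).
Proof.
move=> oU; have sid : smooth [set: R] (fun x : R => x).
  apply: (smooth_eqderiv openT _ (smooth_cst _ (1 : R))).
exact: (smooth_comp_affine oU is_diff_snd (fun _ _ => I) sid).
Qed.

Lemma variation_mx10 (F : R * R -> 'M[C]_3) t : variation_mx F t o1 o0 =
  herm (col o1 (F (t, 0))) (mxD e2 (fun p => col o0 (F p)) (t, 0)).
Proof.
rewrite mxD_col -gramE /variation_mx /uinv -!mulmxA.
by rewrite mxE sum_ord3 !mxE /= !mul0r add0r addr0 mul1r.
Qed.

Variables (J : set R) (kappa tau : R -> R) (F0 : R -> 'M[C]_3) (q : R -> C).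
Hypotheses (oJ : open J) (sk : smooth J kappa) (st : smooth J tau).
Hypothesis sF0 : mxsmooth J F0.
Hypothesis HF0 : forall t, J t ->
  in_U (F0 t) /\ mxD (1 : R) F0 t = F0 t *m Kmx kappa tau t.
Hypothesis sq : csmooth J q.

Definition test_coef (p : R * R) : C := (p.2)%:C * q p.1.

(* The last coefficient makes the vectors null. *)
Definition test_lift (p : R * R) : 'cV[C]_3 :=
  col o0 (F0 p.1) + test_coef p *: col o1 (F0 p.1)
  + ('i%R * (2%:R^-1)%:C * (conjc (test_coef p) * test_coef p)) *: col o2 (F0 p.1).

Let E : set (R * R) := [set p | J p.1].
Let oE : open E.
Proof. by apply: (open_comp _ oJ) => p _; exact: cvg_fst. Qed.

Let EJ p : E p -> J p.1. Proof. by []. Qed.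

Let sF0f : mxsmooth E (fun p => F0 p.1).
Proof. exact: (mxsmooth_comp_affine oE (@is_diff_fst R) EJ sF0). Qed.

Let sqf : csmooth E (fun p => q p.1).
Proof. exact: (csmooth_comp_affine oE (@is_diff_fst R) EJ sq). Qed.

Let su : csmooth E (fun p => (p.2)%:C).
Proof. exact/csmooth_real/smooth_snd. Qed.

Let sc : csmooth E test_coef. Proof. exact: csmoothM oE su sqf. Qed.
Let scc : csmooth E (fun p => conjc (test_coef p) * test_coef p).
Proof. exact: csmoothM oE (csmooth_conj oE sc) sc. Qed.
Let sd : csmooth E (fun p => 'i%R * (2%:R^-1)%:C * (conjc (test_coef p) * test_coef p)).
Proof. exact: csmoothM oE (csmooth_cst _ _) scc. Qed.

Let scol j : mxsmooth E (fun p => col j (F0 p.1)).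
Proof. exact: mxsmooth_col. Qed.

Lemma mxsmooth_test_lift : mxsmooth E test_lift.
Proof.
have s1 := mxsmoothZ oE sc (scol o1); have s2 := mxsmoothZ oE sd (scol o2).
exact (mxsmoothD oE (mxsmoothD oE (scol o0) s1) s2).
Qed.

Let halfE : (2%:R^-1)%:C + (2%:R^-1)%:C = 1 :> C.
Proof.
by rewrite -(rmorphD (real_complex R)) -(rmorph1 (real_complex R)); congr (_%:C); lra.
Qed.

Lemma herm_test_lift p : E p -> herm (test_lift p) (test_lift p) = 0.
Proof.
move=> Ep; have [UF _] := HF0 Ep.
rewrite /test_lift; move: (test_coef p) => c.
rewrite !hermlin !in_U_herm // !mxE !conjcE.
rewrite /= ?complexiE; move: (conjc c) => c'.
transitivity (c' * c * (1 + ('i%R * 'i%R) * ((2%:R^-1)%:C + (2%:R^-1)%:C))).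
  by ring.
by rewrite mul_i_i halfE mulr1 subrr mulr0.
Qed.

Lemma test_lift_neq0 p : E p -> test_lift p != 0.
Proof.
move=> Ep; have [UF _] := HF0 Ep; apply/eqP => E0.
have : herm (col o2 (F0 p.1)) (test_lift p) = - 'i%R.
  by rewrite /test_lift !hermlin !in_U_herm // !mxE /= !mulr0 !addr0.
rewrite E0 /herm mulmx0 mxE => /esym/eqP; rewrite oppr_eq0.
by rewrite (negbTE (neq0Ci _)).
Qed.

Lemma test_lift0 p : test_coef p = 0 -> test_lift p = col o0 (F0 p.1).
Proof. by rewrite /test_lift => ->; rewrite mulr0 mulr0 !scale0r !addr0. Qed.

(** The coefficient restoring nullity is quadratic in [u], so to first order the lift moves along
    the second column only. *)
Lemma mxD2_test_lift t : J t -> mxD e2 test_lift (t, 0) = q t *: col o1 (F0 t).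
Proof.
move=> Jt; have Et : E (t, 0) by [].
have D0 j : mxD e2 (fun p => col j (F0 p.1)) (t, 0) = 0.
  exact: (mxD2_fst (fun t => col j (F0 t))).
have Dq : cderive e2 (fun p : R * R => q p.1) (t, 0) = 0 by exact: cderive2_fst.
have Du : cderive e2 (fun p : R * R => (p.2)%:C) (t, 0) = 1.
  by rewrite cderive_real -(derive_slice2 snd) derive_id.
have c0 : test_coef (t, 0) = 0 by rewrite /test_coef /= mul0r.
have Dc : cderive e2 test_coef (t, 0) = q t.
  by rewrite (cderiveM e2 su sqf Et) Dq Du mulr0 addr0 mul1r.
have Dd : cderive e2 (fun p => 'i%R * (2%:R^-1)%:C *
    (conjc (test_coef p) * test_coef p)) (t, 0) = 0.
  rewrite (cderiveM e2 (csmooth_cst _ _) scc Et) (cderiveM e2 (csmooth_conj oE sc) sc Et).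
  by rewrite c0 cderive_cst mul0r add0r mulr0 add0r conjc0 mul0r mulr0.
have s1 := mxsmoothZ oE sc (scol o1); have s2 := mxsmoothZ oE sd (scol o2).
rewrite (mxD_add e2 Et (mxsmoothD oE (scol o0) s1) s2) (mxD_add e2 Et (scol o0) s1).
rewrite (mxD_scale e2 Et sc (scol o1)) (mxD_scale e2 Et sd (scol o2)).
by rewrite !D0 Dd Dc c0 !scaler0 scale0r !addr0 add0r.
Qed.

(** Differentiating [<Y, Y> = 0] makes [<Y, Y'>] imaginary. Positivity in the order of the complex
    numbers thus becomes an inequality for a continuous real function, which is an open
    condition. *)
Lemma test_lift_imaginary p : E p ->
  - 'i%R * herm (test_lift p) (mxD e1 test_lift p) =
  (complex.Im (herm (test_lift p) (mxD e1 test_lift p)))%:C.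
Proof.
move=> Ep; have s := mxsmooth_test_lift.
have := cderive_herm oE e1 Ep s s.
rewrite (cderive_eq0 e1 oE herm_test_lift Ep) -[herm (mxD _ _ _) _]herm_conj.
case: (herm _ _) => x y /eqP; rewrite eq_complex /= => /andP[/eqP x0 _].
have -> : x = 0 by lra.
by apply/eqP; rewrite eq_complex /=; apply/andP; split; apply/eqP; ring.
Qed.

Let ok (p : R * R) := 0 < complex.Im (herm (test_lift p) (mxD e1 test_lift p)) /\
  0 < complex.Re (oscD e1 test_lift p) ^+ 2 + complex.Im (oscD e1 test_lift p) ^+ 2.

(** Serves twice: with [T = J] at [u = 0], and with [T] the complement of the segment at any [u]. In
    both cases the lift is the first column of [F0]. *)
Let ok_slice (T : set R) t u : open T -> T t -> T `<=` J ->
  (forall s, T s -> test_coef (s, u) = 0) -> ok (t, u).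
Proof.
move=> oT Tt TJ c0; have Jt := TJ t Tt.
have AF := adapted_natural oJ sk st sF0 HF0.
have Es : {in T, (fun s => test_lift (s, u)) =1 (fun s => col o0 (F0 s))}.
  by move=> s /set_mem /c0 /test_lift0.
have [UF _] := HF0 Jt.
rewrite /ok -(mxD_slice1 test_lift) -oscD_slice1 (mxD_near oT (1 : R) Tt Es).
rewrite (oscD_near (1 : R) oT Tt Es) (test_lift0 (c0 t Tt)) (herm_adapted AF Jt).
rewrite (oscD_adapted oJ AF Jt); split.
  by rewrite complexIm_mul /= !mul0r !mul1r add0r ltr01.
apply: complex_sqnorm_gt0; rewrite oppr_eq0 expr1n mulr1.
by have := in_U_unit UF; rewrite unitmxE unitfE.
Qed.

Let ok_near p : E p -> ok p -> \forall p' \near p, ok p'.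
Proof.
move=> Ep [p1 p2]; have s := mxsmooth_test_lift.
have s1 := mxsmooth_D e1 s.
have c1 := smooth_continuous (csmooth_herm oE s s1).2 Ep.
have c2 := smooth_continuous (csmooth_sqnorm oE (csmooth_oscD e1 oE s)) Ep.
apply: filterI; first exact: (cvgr_gt _ c1).
exact: (cvgr_gt _ c2).
Qed.

(** Over the segment, openness and compactness give a uniform [e]; elsewhere the curve is unchanged
    for every [u]. *)
Lemma test_lift_conditions (a b : R) : `[a, b] `<=` J ->
  (forall t, J t -> t \notin `[a, b] -> q t = 0) ->
  exists2 e : R, 0 < e & forall p, (J `*` [set u | `|u| < e]) p ->
    [/\ herm (test_lift p) (test_lift p) = 0,
      0 < - 'i%R * herm (test_lift p) (mxD e1 test_lift p) &
      oscD e1 test_lift p != 0].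
Proof.
move=> abJ q0.
have [|e e0 He] := @tube_segment R a b [set p | ok p].
  move=> t tab; have Jt : J t := abJ t tab; apply: ok_near => //.
  by apply: (ok_slice oJ Jt) => // s _; rewrite /test_coef /= mul0r.
exists e => // -[t u] [/= Jt ue].
have [ok1 ok2] : ok (t, u).
  have [tab|tab] := boolP (t \in `[a, b]); first exact: He.
  apply: (@ok_slice (J `&` ~` `[a, b])).
  - by apply: openI => //; apply: closed_openC; exact: interval_closed.
  - by split=> //; exact/negP.
  - by move=> s [].
  - by move=> s [Js /negP sab]; rewrite /test_coef /= q0 // mulr0.
split; first exact: herm_test_lift.
  by rewrite test_lift_imaginary // -(rmorph0 (real_complex R)) ltcR.
by apply: contraTneq ok2 => ->; rewrite /= expr0n addr0 ltxx.
Qed.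

Definition test_curve (u t : R) : {vspace 'cV[C]_3} := <[test_lift (t, u)]>%VS.

Section TestStrip.
Variable e : R.
Hypothesis e0 : 0 < e.
Let D := J `*` [set u : R | `|u| < e].
Hypothesis HD : forall p, D p -> [/\ herm (test_lift p) (test_lift p) = 0,
  0 < - 'i%R * herm (test_lift p) (mxD e1 test_lift p) & oscD e1 test_lift p != 0].

Let oD : open D. Proof. exact: open_strip. Qed.
Let DE : D `<=` E. Proof. by move=> p []. Qed.
Let sYD : mxsmooth D test_lift. Proof. exact: mxsmooth_sub DE mxsmooth_test_lift. Qed.

Lemma test_local_frame : exists F b,
  (forall t, J t -> local_frame D test_curve t D F b) /\
  forall t, J t -> variation_mx F t o1 o0 = q t.
Proof.
have [F [k [y [a [b [m [AF m0 FY]]]]]]] := lift_frame oD sYD HD.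
have [sF _ _ _ HF] := AF.
have Dt t : J t -> D (t, 0) by move=> Jt; split=> //=; rewrite normr0.
have YF p : D p -> (<[test_lift p]> = <[col o0 (F p)]>)%VS.
  move=> Dp; rewrite -ord3_0 FY line_scale //.
  by rewrite (fmorph_eq0 (real_complex R)) gt_eqF // m0.
exists F, b; split.
  move=> t Jt; split; [exact: oD | exact: Dt | by [] | by exists k, y, a | ].
  by case=> s u Dp; exact: YF.
move=> t Jt; have Dt0 := Dt t Jt; have sF1 := mxsmooth_col o0 sF.
have [|c sc' cE] := proportional_lifts oD sF1 sYD.
  move=> p Dp; have [_ UF _] := HF p Dp.
  by rewrite in_U_col_neq0 // test_lift_neq0 ?YF //; exact: DE.
have Ec : {in D, (fun p => col o0 (F p)) =1 (fun p => c p *: test_lift p)}.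
  by move=> p /set_mem /cE[].
have [z [z1 Fz]] : exists z, conjc z * z = 1 /\ F (t, 0) = z *: F0 t.
  have DJ s : D (s, 0) -> J s by move=> [].
  have [|_ _ //] := natural_slice oJ sk st sF0 HF0 oD AF DJ _ Dt0.
  move=> s Ds; rewrite ord3_0; apply: eq_lineP.
  by rewrite -(YF _ Ds) test_lift0 // /test_coef /= mul0r.
have [UF0 _] := HF0 Jt.
have Y0 : test_lift (t, 0) = col o0 (F0 t) by rewrite test_lift0 // /test_coef /= mul0r.
have colZ j : col j (z *: F0 t) = z *: col j (F0 t) by apply/matrixP=> i l; rewrite !mxE.
(* The frame column is [c] times the test lift. The derivative of [c] multiplies the first column of
   [F0] and is lost by orthogonality; the remaining factor is [conj z * z = 1]. *)
have cz : c (t, 0) = z.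
  have [_] := cE _ Dt0; rewrite Fz Y0 colZ => /eqP.
  rewrite -subr_eq0 -scalerBl scaler_eq0 (negbTE (in_U_col_neq0 o0 UF0)) orbF.
  by rewrite subr_eq0 => /eqP.
rewrite variation_mx10 (mxD_near oD e2 Dt0 Ec) (mxD_scale e2 Dt0 sc' sYD).
rewrite mxD2_test_lift // Y0 Fz colZ cz !hermlin !in_U_herm // !mxE /=.
by rewrite mulr0 mulr1 add0r mulrA z1 mul1r.
Qed.

Lemma test_cs_variation (a b : R) gamma :
  (forall t, J t -> gamma t = <[col o0 (F0 t)]>%VS) ->
  (forall t, J t -> t \notin `[a, b] -> q t = 0) ->
  cs_variation J gamma a b e test_curve.
Proof.
move=> gF q0; split.
- move=> p Dp; exists E, test_lift; split.
  + exact: oE.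
  + exact: DE.
  + exact: mxsmooth_test_lift.
  + by case=> t u Etu _; split; [exact: test_lift_neq0 | ].
- move=> u ue; apply: (generic_transversal_of_lift (Y := fun t => test_lift (t, u)) oJ).
  + have := mxsmooth_slice1 u oE mxsmooth_test_lift.
    by apply: mxsmooth_sub.
  + by [].
  + move=> t Jt; rewrite (mxD_slice1 test_lift) oscD_slice1.
    have Dtu : D (t, u) by split.
    by have [-> H1 H2] := HD Dtu; split=> //; exact: test_lift_neq0.
- by move=> t Jt; rewrite gF // /test_curve test_lift0 // /test_coef /= mul0r.
- by move=> u t _ Jt tab; rewrite gF // /test_curve test_lift0 // /test_coef /= q0 // mulr0.
Qed.

End TestStrip.

End TestVariation.

(** * The Euler-Lagrange equation *)

Section EulerLagrange.
Variable R : realType.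
Local Notation C := R[i].
Variables (J : set R) (gamma : R -> {vspace 'cV[C]_3}) (kappa tau : R -> R).
Variable F0 : R -> 'M[C]_3.
Hypotheses (oJ : open J) (iJ : is_interval J) (sk : smooth J kappa) (st : smooth J tau).
Hypothesis sF0 : mxsmooth J F0.
Hypothesis HF0 : forall t, J t ->
  in_U (F0 t) /\ mxD (1 : R) F0 t = F0 t *m Kmx kappa tau t.
Hypothesis gF0 : forall t, J t -> gamma t = <[col o0 (F0 t)]>%VS.

Lemma lax_defect0_critical : (forall t, J t -> lax_defect kappa tau t = 0) ->
  critical_curve J gamma.
Proof.
move=> w0 a b e v W ab abJ e0 vP WP.
have [r [cr rE]] := first_variation oJ sk st sF0 HF0 gF0 ab abJ e0 vP WP.
have r0 t : `[a, b]%classic t -> r t = 0.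
  move=> /abJ Jt; have [sv gv _ _] := vP.
  have [U [F [be L]]] := local_frame_exist oJ e0 sv gv Jt.
  by rewrite (rE _ _ _ _ L) w0 // conjc0 mul0r.
have -> : \int[lebesgue_measure]_(t in `[a, b]) r t = 0.
  have dcst x : x \in `[a, b] -> is_derive x 1 (cst 0) (r x).
    by move=> /r0 ->; exact: is_derive_cst.
  by rewrite (Rintegral_FTC ab (fun x xab => cr x (abJ x xab)) dcst) /= subrr.
by rewrite mulr0 oppr0.
Qed.

Lemma critical_lax_defect0 s : critical_curve J gamma -> J s ->
  lax_defect kappa tau s = 0.
Proof.
move=> crit Js; have [a [b [Ja Jb as_ _ [sb _]]]] := open_interval_bounds oJ Js Js.
have abJ := sub_interval iJ Ja Jb.
have [phi [sphi phi0 phip phin]] := exists_bump a b.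
(* For this [q] the first-variation integrand becomes [phi |w|^2], which is nonnegative and positive
   at [s] unless [w s = 0]. *)
pose w := lax_defect kappa tau; pose q t := (phi t)%:C * w t.
have sw := csmooth_lax_defect oJ sk st.
have sq : csmooth J q.
  apply: csmoothM => //; apply: csmooth_real.
  by apply: smooth_sub sphi.
have q0 t : J t -> t \notin `[a, b] -> q t = 0.
  move=> _ tab; rewrite /q phin ?mul0r //; apply: contraNN tab => /andP[at_ tb].
  by rewrite in_itv /= !ltW.
have [e e0 HD] := test_lift_conditions oJ sk st sF0 HF0 sq abJ q0.
have vP := test_cs_variation oJ sF0 HF0 sq HD gF0 q0.
have [F [be [LF QF]]] := test_local_frame oJ sk st sF0 HF0 sq e0 HD.
have [W WP] : {W : R -> R & forall u, `|u| < e -> total_twist J (test_curve F0 q u) a b (W u)}.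
  apply: (@choice _ _ (fun u W => `|u| < e -> total_twist J (test_curve F0 q u) a b W)) => u.
  have [ue|_] := boolP (`|u| < e); last by exists 0.
  have [_ gv _ _] := vP.
  have [al [ta [sal tta]]] := strain_twist_exist oJ iJ (ex_intro _ s Js) (gv u ue).
  by exists (\int[lebesgue_measure]_(t in `[a, b]) (ta t * al t)) => _; exists al, ta.
have ab : a <= b by exact/ltW/(lt_trans as_).
have [r [cr rE dW]] := first_variation oJ sk st sF0 HF0 gF0 ab abJ e0 vP WP.
have dW0 := crit a b e _ W ab abJ e0 vP WP.
have r_w t : J t -> r t = phi t * (complex.Re (w t) ^+ 2 + complex.Im (w t) ^+ 2).
  move=> Jt; rewrite (rE _ _ _ _ (LF t Jt)) QF // /q mulrCA conjc_mulE.
  by rewrite -real_complexM.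
(* Criticality and the first variation formula give two values for the derivative of [W] at 0; they
   must coincide. *)
have int0 : \int[lebesgue_measure]_(t in `[a, b]) r t = 0.
  have := @derive_val _ _ _ _ _ _ _ dW; rewrite (@derive_val _ _ _ _ _ _ _ dW0) => /esym/eqP.
  by rewrite oppr_eq0 mulf_eq0 mulf_eq0 invr_eq0 !pnatr_eq0 => /eqP.
have r0 t : J t -> 0 <= r t by move=> Jt; rewrite r_w // mulr_ge0 // addr_ge0 // sqr_ge0.
have asb : a < s < b by rewrite as_.
have := nonneg_integral_eq0 oJ iJ Ja Jb asb cr r0 int0.
rewrite r_w // => /eqP; rewrite mulf_eq0 gt_eqF ?phip //= => w0.
by apply/eqP; apply: contraLR w0 => /complex_sqnorm_gt0 /gt_eqF ->.
Qed.

End EulerLagrange.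

Theorem theorem1 (R : realType) (J : set R)
    (gamma : R -> {vspace 'cV[R[i]]_3}) (kappa tau : R -> R)
    (J_nonempty : J !=set0) (J_open : open J) (J_interval : is_interval J)
    (gamma_gt : generic_transversal J gamma)
    (gamma_natural : natural_parameter J gamma)
    (gamma_kt : bending_twist J gamma kappa tau) :
  critical_curve J gamma <->
  (forall s, J s ->
     mxderive (Lmx kappa tau) s =
       Lmx kappa tau s *m Kmx kappa tau s - Kmx kappa tau s *m Lmx kappa tau s).
Proof.
have [sk st [F WF]] := gamma_kt; have [sF _ [[_ LF] _] _] := WF.
have HF t (Jt : J t) := wilczynski_frame_D WF Jt.
have gF t : J t -> gamma t = <[col o0 (F t)]>%VS.
  by move=> Jt; rewrite -ord3_0; have [] := LF t Jt.
have lax s : J s -> (mxderive (Lmx kappa tau) s =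
    Lmx kappa tau s *m Kmx kappa tau s - Kmx kappa tau s *m Lmx kappa tau s) <->
    lax_defect kappa tau s = 0.
  move=> Js; have E := lax_equation J_open sk st Js; split=> [H|H].
    by move: E; rewrite H subrr => /matrixP/(_ o1 o2); rewrite !mxE.
  apply/subr0_eq; rewrite E H conjc0 mulr0.
  by apply/matrixP; apply: ord3P; apply: ord3P; rewrite !mxE.
split=> [crit s Js | H].
  by apply/(lax s Js); exact: critical_lax_defect0 sF HF gF s crit Js.
apply: (lax_defect0_critical J_open sk st sF HF gF) => s Js.
by apply/(lax s Js); exact: H.
Qed.
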